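(* Let $\mathfrak{g}$ be a complex semisimple Lie algebra, $\lambda \in \mathfrak{h}^*$, and let $\mathbb{V}^\lambda$ be a nonzero quotient of the Verma module $M(\lambda)$. Suppose that either $|J_\lambda \setminus J(\mathbb{V}^\lambda)| \leq 1$, or $\mathbb{V}^\lambda = M(\lambda,J')$ for some $J' \subset J_\lambda$. Write $J := J(\mathbb{V}^\lambda)$. Then \[ \operatorname{wt} \mathbb{V}^\lambda = (\lambda - \mathbb{Z}\Delta) \cap \operatorname{conv}_{\mathbb{R}} \operatorname{wt} \mathbb{V}^\lambda = \operatorname{wt} L_{J}(\lambda) - \mathbb{Z}_+ (\Phi^+ \setminus \Phi^+_{J}) = \coprod_{\mu \in \mathbb{Z}_+ \Delta_{I \setminus J}} \operatorname{wt} L_{J}(\lambda - \mu), \] where the last union is disjoint.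
   Context: $\mathfrak{g}=\mathfrak{n}^-\oplus\mathfrak{h}\oplus\mathfrak{n}^+$ is a fixed triangular decomposition with Cartan subalgebra $\mathfrak{h}$, positive roots $\Phi^+$, simple roots $\Delta=\{\alpha_i : i\in I\}$, Weyl group $W$. $(\cdot,\cdot)$ is the form on $\mathfrak{h}^*$ induced by the Killing form, $h_i\in\mathfrak{h}$ corresponds to $2\alpha_i/(\alpha_i,\alpha_i)$, and $x^\pm_{\alpha_i}$ are Chevalley generators with $[x^+_{\alpha_i},x^-_{\alpha_j}]=\delta_{ij}h_i$. $M(\lambda)=U\mathfrak{g}/U\mathfrak{g}(\mathfrak{n}^+ + \ker_{\mathfrak{h}}\lambda)$ is the Verma module, $L(\lambda)$ its simple quotient. For a quotient $\mathbb{V}^\lambda$ of $M(\lambda)$, $v_\lambda$ spans its $\lambda$-weight space, and $\operatorname{wt} M$ denotes the set of $\mathfrak{h}$-weights of a module $M$. For $R\subset\mathbb{R}$, $R_+=R\cap[0,\infty)$ and $RX$ is the set of finite linear combinations of elements of $X$ with coefficients in $R$; $\operatorname{conv}_{\mathbb{R}}X$ is the convex hull of $X$ (taken in the real affine space $\lambda+\mathbb{R}\Delta$, which contains all weights of $\mathbb{V}^\lambda$). Definitions: $J_\lambda=\{i\in I: \lambda(h_i)\in\mathbb{Z}_{\geq 0}\}$; $J(\mathbb{V}^\lambda)=\{i\in J_\lambda : (x^-_{\alpha_i})^{\lambda(h_i)+1}v_\lambda=0\}$. For $J\subset I$: $\Delta_J=\{\alpha_i:i\in J\}$, $\Phi^+_J=\Phi^+\cap\mathbb{Z}\Delta_J$,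 $\mathfrak{g}_J$ is the semisimple subalgebra generated by $\{x^\pm_{\alpha_i}: i\in J\}$. For $J'\subset J_\lambda$, the parabolic Verma module is $M(\lambda,J')=U\mathfrak{g}/U\mathfrak{g}\big(\mathfrak{n}^+ + \ker_{\mathfrak{h}}\lambda + \sum_{i\in J'}\mathbb{C}(x^-_{\alpha_i})^{\lambda(h_i)+1}\big)$. For $J\subset I$ and $\nu\in\mathfrak{h}^*$ with $\nu(h_i)\in\mathbb{Z}_{\geq0}$ for all $i\in J$, $L_J(\nu)$ denotes the finite-dimensional simple highest weight module of highest weight $\nu$ over $\mathfrak{g}_J+\mathfrak{h}$, and $\operatorname{wt}L_J(\nu)$ its set of $\mathfrak{h}$-weights. *)

(* Defs.v *)
From mathcomp Require Import all_boot all_order all_algebra.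
From mathcomp Require Import reals.
From mathcomp.real_closed Require Import complex.
Set Implicit Arguments. Unset Strict Implicit. Unset Printing Implicit Defensive.
Import Order.TTheory GRing.Theory Num.Theory.
Local Open Scope ring_scope.

(* Scalars: C := complex R for R : realType (a model of the complex numbers).
   Elements of h^* are represented by their coordinates mu(h_i), i in I = 'I_n,
   i.e. by row vectors mu : 'rV[C]_n with  mu 0 i = mu(h_i).
   (The coroots h_i form a basis of h, imposed in [chevalley_setup].) *)

Section LieDefs.
Variable R : realType.
Local Notation C := (complex R).
Variable n : nat.
Local Notation wght := 'rV[C]_n.

Definition natcomb (X : wght -> Prop) (mu : wght) : Prop :=
  exists s : seq (nat * wght),
    (forall p, p \in s -> X p.2) /\ mu = \sum_(p <- s) (p.1)%:R *: p.2.

Definition intcomb (X : wght -> Prop) (mu : wght) : Prop :=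
  exists s : seq (int * wght),
    (forall p, p \in s -> X p.2) /\ mu = \sum_(p <- s) (p.1)%:~R *: p.2.

(* real convex hull (the weights live in lambda + R Delta, real coefficients) *)
Definition conv_hull (X : wght -> Prop) (mu : wght) : Prop :=
  exists s : seq (R * wght),
    (forall p, p \in s -> 0 <= p.1 /\ X p.2) /\
    \sum_(p <- s) p.1 = 1 /\
    mu = \sum_(p <- s) ((p.1)%:C)%C *: p.2.

Variable g : vectType C.
Variable br : g -> g -> g.

Definition lie_algebra : Prop :=
  (forall a x y z, br (a *: x + y) z = a *: br x z + br y z) /\
  (forall a x y z, br x (a *: y + z) = a *: br x y + br x z) /\
  (forall x, br x x = 0) /\
  (forall x y z, br x (br y z) + br y (br z x) + br z (br x y) = 0).

Definition lie_ideal (I : {vspace g}) : Prop :=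
  forall x y, y \in I -> br x y \in I.

(* semisimple: no nonzero abelian ideal (equivalently, zero radical) *)
Definition semisimple : Prop :=
  forall I : {vspace g}, lie_ideal I ->
    (forall y z, y \in I -> z \in I -> br y z = 0) -> I = 0%VS.

Variables (hs e f : 'I_n -> g) (alpha : 'I_n -> wght).

Definition hspace : {vspace g} := (\sum_i <[hs i]>)%VS.

Definition root_space (mu : wght) (x : g) : Prop :=
  forall i, br (hs i) x = mu 0 i *: x.

Definition is_root (mu : wght) : Prop :=
  mu != 0 /\ exists x, x != 0 /\ root_space mu x.

Definition simple_root_in (J : 'I_n -> Prop) (mu : wght) : Prop :=
  exists2 i, J i & mu = alpha i.

Definition pos_root (mu : wght) : Prop :=
  is_root mu /\ natcomb (simple_root_in (fun _ => True)) mu.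

Definition pos_root_J (J : 'I_n -> Prop) (mu : wght) : Prop :=
  pos_root mu /\ intcomb (simple_root_in J) mu.

(* g is a complex semisimple Lie algebra, h = span(h_i) is a Cartan subalgebra
   (abelian, self-centralizing, ad-diagonalizable), Delta = {alpha_i} is the set
   of simple roots of a positive system (every root is in Z_+Delta or -Z_+Delta),
   e_i = x^+_{alpha_i}, f_i = x^-_{alpha_i} are Chevalley generators with
   [x^+_{alpha_i}, x^-_{alpha_j}] = delta_ij h_i and alpha_i(h_i) = 2
   (h_i the coroot 2 alpha_i/(alpha_i,alpha_i)). *)
Definition chevalley_setup : Prop :=
  lie_algebra /\ semisimple /\
  free [seq hs i | i <- enum 'I_n] /\
  (forall i j, br (hs i) (hs j) = 0) /\
  (forall x, (forall i, br (hs i) x = 0) -> x \in hspace) /\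
  (forall x, exists s : seq (wght * g),
      (forall p, p \in s -> root_space p.1 p.2) /\ x = \sum_(p <- s) p.2) /\
  (forall i, [/\ root_space (alpha i) (e i), root_space (- alpha i) (f i)
              & alpha i 0 i = 2]) /\
  (forall i j, br (e i) (f j) = if i == j then hs i else 0) /\
  (forall mu, is_root mu ->
      natcomb (simple_root_in (fun _ => True)) mu \/
      natcomb (simple_root_in (fun _ => True)) (- mu)).

Definition in_gJ (J : 'I_n -> Prop) (x : g) : Prop :=
  forall U : {vspace g},
    (forall y z, y \in U -> z \in U -> br y z \in U) ->
    (forall i, J i -> e i \in U /\ f i \in U) -> x \in U.

Definition in_gJh (J : 'I_n -> Prop) (x : g) : Prop :=
  exists y z, [/\ in_gJ J y, z \in hspace & x = y + z].

Section Modules.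
Variables (V : lmodType C) (act : g -> V -> V).

(* a module over the subalgebra S (the action is given on all of g,
   linearly, but the bracket relation is only required on S) *)
Definition lie_module (S : g -> Prop) : Prop :=
  [/\ (forall a x y v, act (a *: x + y) v = a *: act x v + act y v),
      (forall x a u v, act x (a *: u + v) = a *: act x u + act x v) &
      (forall x y v, S x -> S y -> act (br x y) v = act x (act y v) - act y (act x v))].

Definition weight_vec (mu : wght) (v : V) : Prop :=
  forall i, act (hs i) v = mu 0 i *: v.

Definition wt (mu : wght) : Prop := exists v, v != 0 /\ weight_vec mu v.

Definition submodule (P : V -> Prop) : Prop :=
  [/\ P 0, (forall a u w, P u -> P w -> P (a *: u + w)) &
      (forall x u, P u -> P (act x u))].

Definition generated_by (v : V) : Prop :=
  forall P, submodule P -> P v -> forall w, P w.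

Definition hw_vector (lam : wght) (v : V) : Prop :=
  weight_vec lam v /\ forall i, act (e i) v = 0.

(* (V, v) is a nonzero quotient of the Verma module M(lam), v = image of 1:
   i.e. V = U(g) v with v a nonzero highest weight vector of weight lam *)
Definition verma_quotient (lam : wght) (v : V) : Prop :=
  [/\ lie_module (fun _ => True), v != 0, hw_vector lam v & generated_by v].

Definition J_lambda (lam : wght) (i : 'I_n) : Prop :=
  exists k : nat, lam 0 i = k%:R.

Definition J_of (lam : wght) (v : V) (i : 'I_n) : Prop :=
  exists k : nat, lam 0 i = k%:R /\ iter k.+1 (act (f i)) v = 0.

Definition parabolic_rel (J' : 'I_n -> Prop) (lam : wght) (v : V) : Prop :=
  forall i, J' i -> forall k : nat, lam 0 i = k%:R -> iter k.+1 (act (f i)) v = 0.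

End Modules.

Definition module_hom (V W : lmodType C) (actV : g -> V -> V) (actW : g -> W -> W)
    (phi : V -> W) : Prop :=
  (forall a u u', phi (a *: u + u') = a *: phi u + phi u') /\
  (forall x u, phi (actV x u) = actW x (phi u)).

(* (V, v) equals the parabolic Verma module M(lam, J') (with v the image of 1):
   v satisfies the defining relations of M(lam,J') and (V, v) has the universal
   property of U g / U g (n^+ + ker lam + sum_{i in J'} C (x^-_i)^{lam(h_i)+1}). *)
Definition is_parabolic_verma (V : lmodType C) (act : g -> V -> V)
    (J' : 'I_n -> Prop) (lam : wght) (v : V) : Prop :=
  parabolic_rel act J' lam v /\
  forall (W : lmodType C) (actW : g -> W -> W) (w : W),
    lie_module actW (fun _ => True) -> hw_vector actW lam w ->
    parabolic_rel actW J' lam w ->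
    exists phi : V -> W, module_hom act actW phi /\ phi v = w.

(* mu in wt L_J(nu): a weight of the finite-dimensional simple (g_J + h)-module
   of highest weight nu (unique up to isomorphism) *)
Definition wt_L (J : 'I_n -> Prop) (nu mu : wght) : Prop :=
  exists (W : vectType C) (actW : g -> W -> W),
    [/\ lie_module actW (in_gJh J),
        (forall U : {vspace W},
            (forall x u, in_gJh J x -> u \in U -> actW x u \in U) ->
            U = 0%VS \/ U = fullv),
        (exists w, [/\ w != 0, weight_vec actW nu w &
                       forall j, J j -> actW (e j) w = 0]) &
        wt actW mu].

End LieDefs.

(* Main.v *)
Require Import Defs.
From HB Require Import structures.
From mathcomp Require Import all_boot all_order all_algebra.
From mathcomp Require Import boolp functions reals.
From mathcomp.real_closed Require Import complex.
From mathcomp Require Import ring lra zify.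
Set Implicit Arguments. Unset Strict Implicit. Unset Printing Implicit Defensive.
Import Order.TTheory GRing.Theory Num.Theory.
Local Open Scope ring_scope.

(* Write [J] for [J_of f act lam v].  The weights of [V] form a set of points
   [lam - sum k_i alpha_i], [k >= 0], which is closed under the [alpha_j]-strings for [j] in [J]
   because [V] is integrable in these directions.  The trace form of the adjoint
   representation shows that the Cartan matrix is of finite type, and then any subset of
   [lam - N Delta] stable under the reflections [s_j], [j] in [J], is contained in [wt V] as soon
   as [wt V] contains [lam - nu] for every [nu] in [N Delta_{I \ J}]: reflect upwards to a
   [J]-dominant weight, and reach that one from its [lam - nu] along strings.  The convex
   hull, the sets [wt L_J (lam - nu)] and [wt L_J lam - N (Phi^+ \ Phi_J^+)] are such
   subsets, and the converse inclusions use the same argument inside [L_J (lam - nu)], or the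
   triangular decomposition of [U g].

   It remains to see that [lam - nu] is a weight.  If [J_lambda \ J] has at most one element,
   this follows by killing [f_i]-torsion submodules one at a time.  If [V = M(lam, J')], one
   needs a large highest weight module: the free algebra on the [f_i] is a module over the
   Lie algebra generated by the Chevalley generators without Serre relations, and the
   abelianization character of that algebra vanishes on everything the Serre relations
   generate, hence descends to a functional on [U g] whose translates form such a module. *)

(** The obstacle is to certify that enough vectors of [V] are nonzero. If [lam(h_i)] is not a
    natural number, no power of [f_i] sends [v] into a submodule that misses [v], so such factors
    can be stripped off a monomial one after the other. An index of [J_lambda \ J] is known to have
    this property only modulo 0, which is why just one of them can be treated this way. In
    [M(lam, J')] there may be many, hence the explicit functional. Its character takes the value 0
    on the [f_i] with [i] in [J'], which enforces [f_i^(lam(h_i)+1) v = 0], and the value 1 on the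
    others, so that every monomial in them is detected. The modules [L_J(lam - nu)] must also be
    produced, not only compared with. Positive definiteness bounds the heights of the weights of [V]
    with a given part off [J], so a vector of weight [lam - nu] generates a finite-dimensional
    module over [g_J + h], and a minimal subquotient of it is simple. *)

Section Subspaces.
Variables (F : fieldType) (V : lmodType F).

Definition subspace (Q : V -> Prop) : Prop :=
  Q 0 /\ forall a u w, Q u -> Q w -> Q (a *: u + w).

Definition linop (A : V -> V) : Prop := forall a u w, A (a *: u + w) = a *: A u + A w.

Lemma subspace_mem0 Q : subspace Q -> Q 0.
Proof. by case. Qed.

Lemma subspace_lin Q a u w : subspace Q -> Q u -> Q w -> Q (a *: u + w).
Proof. by case=> _; apply. Qed.

Lemma subspaceD Q u w : subspace Q -> Q u -> Q w -> Q (u + w).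
Proof. by case=> _ h Qu Qw; rewrite -(scale1r u); apply: h. Qed.

Lemma subspaceZ Q a u : subspace Q -> Q u -> Q (a *: u).
Proof. by case=> h0 h Qu; rewrite -(addr0 (_ *: _)); apply: h. Qed.

Lemma subspaceN Q u : subspace Q -> Q u -> Q (- u).
Proof. by move=> sQ Qu; rewrite -scaleN1r; apply: subspaceZ. Qed.

Lemma subspaceB Q u w : subspace Q -> Q u -> Q w -> Q (u - w).
Proof. by move=> sQ Qu Qw; apply: subspaceD => //; apply: subspaceN. Qed.

Lemma subspace_sum Q (I : eqType) (r : seq I) (G : I -> V) :
  subspace Q -> (forall i, i \in r -> Q (G i)) -> Q (\sum_(i <- r) G i).
Proof.
move=> sQ; elim: r => [|i r IH] h; first by rewrite big_nil; case: sQ.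
rewrite big_cons; apply: subspaceD => //; first by apply: h; rewrite mem_head.
by apply: IH => j jr; apply: h; rewrite inE jr orbT.
Qed.

Lemma subspaceZK Q a u : subspace Q -> a != 0 -> Q (a *: u) -> Q u.
Proof. by move=> sQ a0 /(subspaceZ a^-1 sQ); rewrite scalerA mulVf // scale1r. Qed.

Lemma subspace0 : subspace (fun u => u = 0).
Proof. by split=> // a u w -> ->; rewrite scaler0 addr0. Qed.

Lemma linop0 A : linop A -> A 0 = 0.
Proof.
move=> lA; have := lA (-1) 0 0; rewrite scaler0 addr0 => {1}->.
by rewrite scaleN1r addNr.
Qed.

Lemma linopD A u w : linop A -> A (u + w) = A u + A w.
Proof. by move=> lA; rewrite -{1}(scale1r u) lA scale1r. Qed.

Lemma linopZ A a u : linop A -> A (a *: u) = a *: A u.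
Proof. by move=> lA; rewrite -(addr0 (a *: u)) lA linop0 // addr0. Qed.

Lemma linopN A u : linop A -> A (- u) = - A u.
Proof. by move=> lA; rewrite -scaleN1r linopZ // scaleN1r. Qed.

Lemma linopB A u w : linop A -> A (u - w) = A u - A w.
Proof. by move=> lA; rewrite linopD // linopN. Qed.

Lemma linop_sum A (I : Type) (r : seq I) (G : I -> V) :
  linop A -> A (\sum_(i <- r) G i) = \sum_(i <- r) A (G i).
Proof.
move=> lA; elim: r => [|i r IH]; first by rewrite !big_nil linop0.
by rewrite !big_cons linopD // IH.
Qed.

Lemma linop_iter A k : linop A -> linop (iter k A).
Proof. by move=> lA; elim: k => [|k IH] a u w //=; rewrite IH lA. Qed.

Lemma stable_iter (Q : V -> Prop) A k u :
  (forall u, Q u -> Q (A u)) -> Q u -> Q (iter k A u).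
Proof. by move=> sA Qu; elim: k => //= k IH; apply: sA. Qed.

End Subspaces.

Section VectSubspace.
Variables (F : fieldType) (W : vectType F).

(** Adjoining to a contained vspace a vector of [Q] outside it raises the dimension, so the process
    stops, and only at [Q] itself. This lets predicates be fed to hypotheses that quantify over
    vspaces. *)
Lemma subspace_vspace (Q : W -> Prop) :
  subspace Q -> exists U : {vspace W}, forall x, x \in U <-> Q x.
Proof.
move=> sQ.
have step : forall m (U : {vspace W}), (\dim {:W} - \dim U < m)%N ->
    (forall x, x \in U -> Q x) -> exists U : {vspace W}, forall x, x \in U <-> Q x.
  elim=> // m IH U lt hU.
  have [[x [Qx nUx]]|hn] := pselect (exists x, Q x /\ x \notin U); last first.
    exists U => x; split; first exact: hU.
    by move=> Qx; apply/negPn/negP => nx; apply: hn; exists x.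
  have lt2 : (\dim U < \dim (U + <[x]>))%N.
    rewrite ltn_neqAle dimvS ?addvSl // andbT; apply/negP => /eqP eqd.
    have : (U == U + <[x]>)%VS by rewrite eqEdim addvSl /= eqd.
    by move=> /eqP eqU; move: nUx; rewrite eqU (subvP (addvSr _ _)) ?memv_line.
  apply: (IH (U + <[x]>)%VS).
    have := dimvS (subvf (U + <[x]>)%VS); lia.
  move=> y /memv_addP[u Uu [w /vlineP[k ->] ->]].
  by apply: subspaceD => //; [apply: hU | apply: subspaceZ].
apply: (step (\dim {:W}).+1 0%VS); first by rewrite dimv0 subn0.
by move=> x; rewrite memv0 => /eqP->; case: sQ.
Qed.

End VectSubspace.

(** * Representations of [sl_2] modulo a stable subspace [Q], in place of a quotient module *)

Section SL2.
Variables (C : numFieldType) (V : lmodType C) (e f h : V -> V).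
Variable Q : V -> Prop.

Definition sl2_triple : Prop :=
  [/\ linop e /\ linop f, linop h, (forall u, e (f u) = f (e u) + h u),
      (forall u, h (e u) = e (h u) + 2 *: e u) &
      (forall u, h (f u) = f (h u) - 2 *: f u)].

Hypothesis sl2 : sl2_triple.
Hypothesis sQ : subspace Q.
Hypothesis Qe : forall u, Q u -> Q (e u).
Hypothesis Qf : forall u, Q u -> Q (f u).

Lemma sl2_h_iter_f c u k : h u = c *: u -> h (iter k f u) = (c - (2 * k)%:R) *: iter k f u.
Proof.
case: sl2 => [[le lf] lh ef he hf] hu; elim: k => [|k IH] /=; first by rewrite muln0 subr0.
rewrite hf IH (linopZ _ _ lf) -scalerBl; congr (_ *: _).
by rewrite mulnS natrD; ring.
Qed.

Lemma sl2_h_iter_e c u k : h u = c *: u -> h (iter k e u) = (c + (2 * k)%:R) *: iter k e u.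
Proof.
case: sl2 => [[le lf] lh ef he hf] hu; elim: k => [|k IH] /=; first by rewrite muln0 addr0.
rewrite he IH (linopZ _ _ le) -scalerDl; congr (_ *: _).
by rewrite mulnS natrD; ring.
Qed.

(** [u] is a highest weight vector only modulo [Q], so the classical formula for [e f^(k+1) u] holds
    up to an error in [Q]. Its coefficient [(k+1)(c-k)] vanishes exactly at [c = k], the source of
    the integrality results below. *)
Lemma sl2_e_iter_f c u k : Q (e u) -> h u = c *: u ->
  Q (e (iter k.+1 f u) - (k.+1%:R * (c - k%:R)) *: iter k f u).
Proof.
case: sl2 => [[le lf] lh ef he hf] Qeu hu; elim: k => [|k IH].
  by rewrite /= ef hu subr0 mul1r addrK; apply: Qf.
rewrite [iter k.+2 f u]iterS ef (sl2_h_iter_f _ hu).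
have := Qf IH; rewrite (linopB _ _ lf) (linopZ _ _ lf) -iterS.
set x := iter k.+1 f u; set y := f (e x).
have -> : y + (c - (2 * k.+1)%:R) *: x - (k.+2%:R * (c - k.+1%:R)) *: x
  = y - (k.+1%:R * (c - k%:R)) *: x; last by [].
rewrite -addrA -scalerBl -scaleNr; congr (_ + _ *: _).
by rewrite natrM -!natr1; ring.
Qed.

(** Applying [e] to [f^(k+1) u] in [Q] gives back a multiple of [f^k u], with a nonzero factor as
    long as [c] avoids [k]; descend in this way to [u]. *)
Lemma sl2_iter_f_notin c u k : ~ Q u -> Q (e u) -> h u = c *: u ->
  (forall j, (j < k)%N -> c != j%:R) -> ~ Q (iter k f u).
Proof.
move=> nQu Qeu hu; elim: k => [//|k IH] hc Qk; apply: IH => [j jk|].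
  by apply: hc; apply: leqW.
have := subspaceB sQ (Qe Qk) (sl2_e_iter_f k Qeu hu).
rewrite opprB addrC subrK; apply: subspaceZK => //.
by rewrite mulf_neq0 ?pnatr_eq0 // subr_eq0 hc.
Qed.

Lemma sl2_hw_nat c u N : ~ Q u -> Q (e u) -> h u = c *: u -> Q (iter N f u) ->
  exists2 k : nat, c = k%:R & (k < N)%N.
Proof.
move=> nQu Qeu hu QN; apply: contrapT => hn.
apply: (sl2_iter_f_notin (k := N) nQu Qeu hu) => // j jN.
by apply/negP => /eqP cj; apply: hn; exists j.
Qed.

Lemma sl2_iter_f_le (k j : nat) u : ~ Q u -> Q (e u) -> h u = k%:R *: u ->
  (j <= k)%N -> ~ Q (iter j f u).
Proof.
move=> nQu Qeu hu jk; apply: (sl2_iter_f_notin nQu Qeu hu) => i ij.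
by rewrite eqr_nat; apply/eqP => eki; move: jk; rewrite eki leqNgt ij.
Qed.

Lemma first_iter_in (A : V -> V) u N : ~ Q u -> Q (iter N A u) ->
  exists p, ~ Q (iter p A u) /\ Q (iter p.+1 A u).
Proof.
move=> nQu; elim: N => [//|N IH] QN.
have [QN'|nQN] := pselect (Q (iter N A u)); first exact: IH.
by exists N.
Qed.

End SL2.

Section SL2String.
Variables (C : numFieldType) (V : lmodType C).

Lemma sl2_triple_swap (e f h : V -> V) :
  sl2_triple e f h -> sl2_triple f e (fun u => - h u).
Proof.
case=> [[le lf] lh ef he hf]; split=> //.
- by move=> a u w; rewrite lh opprD scalerN.
- by move=> u; rewrite ef addrK.
- by move=> u; rewrite hf opprB (linopN _ lf) addrC.
- by move=> u; rewrite he opprD (linopN _ le).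
Qed.

Variables (e f h : V -> V) (Q : V -> Prop).
Hypothesis sl2 : sl2_triple e f h.
Hypothesis sQ : subspace Q.
Hypothesis Qe : forall u, Q u -> Q (e u).
Hypothesis Qf : forall u, Q u -> Q (f u).
Hypothesis nilp_e : forall u, exists N, Q (iter N e u).
Hypothesis nilp_f : forall u, exists N, Q (iter N f u).

(** Raise [u] by [e] to the last vector outside [Q], say after [p] steps. Its eigenvalue [c + 2p] is
    a natural number [m], and lowering it [t + p] times stays outside [Q] because [t <= m - 2p]. The
    predicate [P t] carries what has to be remembered [t] steps down the string, in practice the
    weight. *)
Lemma sl2_string_nonneg (P : int -> V -> Prop) c u :
  (forall t w, P t w -> P (t + 1) (f w)) -> (forall t w, P t w -> P (t - 1) (e w)) ->
  ~ Q u -> h u = c *: u -> P 0 u ->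
  exists z : int, c = z%:~R /\ forall t : int, 0 <= t <= z -> exists w, P t w /\ ~ Q w.
Proof.
move=> Pf Pe nQu hu Pu.
have [N QN] := nilp_e u.
have [p [nQp Qp1]] := first_iter_in nQu QN.
have hp := sl2_h_iter_e sl2 p hu.
have [M QM] := nilp_f (iter p e u).
have [m em mM] := sl2_hw_nat sl2 sQ Qe Qf nQp Qp1 hp QM.
exists (m%:Z - (2 * p)%:Z); split.
  by rewrite rmorphB /= -!pmulrn -em addrK.
move=> t /andP[t0 tm]; exists (iter (`|t| + p)%N f (iter p e u)); split.
  have Pp : P (- p%:Z) (iter p e u).
    elim: (p) => [|q IH] /=; first by rewrite oppr0.
    have -> : - (q.+1)%:Z = - q%:Z - 1 by lia.
    exact: Pe.
  have Pq : forall q, P (q%:Z - p%:Z) (iter q f (iter p e u)).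
    elim=> [|q IH] /=; first by rewrite sub0r.
    have -> : (q.+1)%:Z - p%:Z = q%:Z - p%:Z + 1 by lia.
    exact: Pf.
  by have := Pq (`|t| + p)%N; rewrite (_ : _ - _ = t) //; lia.
apply: (sl2_iter_f_le sl2 sQ Qe Qf nQp Qp1 (k := m)); last by lia.
by rewrite hp em.
Qed.

End SL2String.

(** The range below 0 is the range above 0 for the triple with [e] and [f] exchanged; the two
    integers obtained are opposite because both come from [c]. *)
Lemma sl2_string (C : numFieldType) (V : lmodType C) (e f h : V -> V) (Q : V -> Prop)
    (P : int -> V -> Prop) c u :
  sl2_triple e f h -> subspace Q ->
  (forall u, Q u -> Q (e u)) -> (forall u, Q u -> Q (f u)) ->
  (forall u, exists N, Q (iter N e u)) -> (forall u, exists N, Q (iter N f u)) ->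
  (forall t w, P t w -> P (t + 1) (f w)) -> (forall t w, P t w -> P (t - 1) (e w)) ->
  ~ Q u -> h u = c *: u -> P 0 u ->
  exists z : int, c = z%:~R /\
    forall t : int, 0 <= t <= z \/ z <= t <= 0 -> exists w, P t w /\ ~ Q w.
Proof.
move=> sl2 sQ Qe Qf ne nf Pf Pe nQu hu Pu.
have [z [cz hz]] := sl2_string_nonneg sl2 sQ Qe Qf ne nf Pf Pe nQu hu Pu.
have hu' : - h u = (- c) *: u by rewrite hu scaleNr.
have [z' [cz' hz']] := sl2_string_nonneg (P := fun t => P (- t))
  (sl2_triple_swap sl2) sQ Qf Qe nf ne
  (fun t w Pw => eq_rect _ (P^~ (e w)) (Pe _ _ Pw) _ (esym (opprD t 1)))
  (fun t w Pw => eq_rect _ (P^~ (f w)) (Pf _ _ Pw) _ (esym (etrans (opprB t 1) (addrC _ _))))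
  nQu hu' (eq_rect _ (P^~ u) Pu _ (esym (oppr0 _))).
exists z; split=> // t [|tz]; first exact: hz.
have ez : z' = - z.
  by apply: (@intr_inj C); rewrite -cz' rmorphN /= -cz.
have [w] := hz' (- t) ltac:(lia).
by rewrite opprK => hw; exists w.
Qed.

Lemma addr_mulrn_inj (F : numFieldType) (a b : F) (k l : nat) :
  b != 0 -> a + b *+ k = a + b *+ l -> k = l.
Proof. by move=> b0 /addrI; rewrite -!(mulr_natr b) => /(mulfI b0)/eqP; rewrite eqr_nat => /eqP. Qed.

(** * Weight vectors, their independence and their spans *)

Section Weights.
Variables (R : realType) (n : nat) (g : vectType (complex R)).
Local Notation C := (complex R).
Local Notation wght := 'rV[C]_n.
Variables (br : g -> g -> g) (hs : 'I_n -> g).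
Variables (V : lmodType C) (act : g -> V -> V).

(** If the first weight of [s] differs from [mu] at coordinate [i], then [h_i] minus its eigenvalue
    on the first term kills that term, rescales the others and multiplies [u] by a nonzero scalar;
    induct on the length. Weights in [s] may repeat. *)
Lemma weight_sum_eq0 (s : seq (wght * V)) (mu : wght) u :
  (forall i, linop (act (hs i))) ->
  (forall p, p \in s -> weight_vec hs act p.1 p.2 /\ p.1 <> mu) ->
  weight_vec hs act mu u -> u = \sum_(p <- s) p.2 -> u = 0.
Proof.
move=> lh; have [m] := ubnP (size s); elim: m s u => // m IH [|p s] u /= sz hs_ hu eu.
  by rewrite eu big_nil.
have [hp np] := hs_ p (mem_head _ _).
have [i ni] : exists i, p.1 0 i != mu 0 i.
  apply: contrapT => hn; apply: np; apply/rowP => i; apply/eqP/negPn/negP => ni.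
  by apply: hn; exists i.
have ci : mu 0 i - p.1 0 i != 0 by rewrite subr_eq0 eq_sym.
suff : (mu 0 i - p.1 0 i) *: u = 0 by move/eqP; rewrite scaler_eq0 (negPf ci) => /eqP.
apply: (IH (map (fun q : wght * V => (q.1, (q.1 0 i - p.1 0 i) *: q.2)) s)).
- by rewrite size_map.
- move=> q /mapP[q' q's ->] /=; have [hq nq] := hs_ q' (mem_behead (s := p :: s) q's).
  by split=> // j; rewrite (linopZ _ _ (lh j)) hq !scalerA mulrC.
- by move=> j; rewrite (linopZ _ _ (lh j)) hu !scalerA mulrC.
rewrite big_map /= scalerBl -hu {1 2}eu (linop_sum _ _ (lh i)) !big_cons hp scalerDr opprD addrACA subrr add0r.
rewrite scaler_sumr -sumrB; apply: eq_big_seq => q qs.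
by have [hq _] := hs_ q (mem_behead (s := p :: s) qs); rewrite hq scalerBl.
Qed.

Definition weight_span (Om : wght -> Prop) (u : V) : Prop :=
  exists s : seq (wght * V),
    (forall p, p \in s -> weight_vec hs act p.1 p.2 /\ Om p.1) /\ u = \sum_(p <- s) p.2.

Lemma weight_span_subspace Om : (forall i, linop (act (hs i))) -> subspace (weight_span Om).
Proof.
move=> lh; split; first by exists [::]; rewrite big_nil.
move=> a u w [s [hs_ ->]] [t [ht ->]].
exists ([seq (p.1, a *: p.2) | p <- s] ++ t); split.
  move=> p; rewrite mem_cat => /orP[/mapP[q qs ->]|]; last exact: ht.
  have [hq Oq] := hs_ _ qs; split=> // j /=.
  by rewrite (linopZ _ _ (lh j)) hq !scalerA mulrC.
by rewrite big_cat /= big_map /= scaler_sumr.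
Qed.

Lemma weight_span1 (Om : wght -> Prop) mu u : weight_vec hs act mu u -> Om mu -> weight_span Om u.
Proof.
move=> hu Omu; exists [:: (mu, u)]; rewrite big_seq1; split=> // p.
by rewrite inE => /eqP->.
Qed.

Lemma weight_span_mono (Om Om' : wght -> Prop) u :
  (forall mu, Om mu -> Om' mu) -> weight_span Om u -> weight_span Om' u.
Proof.
by move=> OO [s [h1 h2]]; exists s; split=> // p /h1[? ?]; split=> //; apply: OO.
Qed.

Lemma weight_span_ind (Om : wght -> Prop) (Q : V -> Prop) u :
  subspace Q -> (forall mu u, Om mu -> weight_vec hs act mu u -> Q u) ->
  weight_span Om u -> Q u.
Proof.
move=> sQ hQ [s [h1 ->]]; apply: subspace_sum => // p /h1[? ?].
exact: (hQ p.1).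
Qed.

Lemma weight_span_notin Om mu u : (forall i, linop (act (hs i))) ->
  weight_span Om u -> weight_vec hs act mu u -> ~ Om mu -> u = 0.
Proof.
move=> lh [s [h1 h2]] hu nO; apply: (weight_sum_eq0 lh _ hu h2) => p /h1[hp Op].
by split=> // eq; apply: nO; rewrite -eq.
Qed.

Lemma wt_weight_span Om mu : (forall i, linop (act (hs i))) ->
  (forall u, weight_span Om u) -> wt hs act mu -> Om mu.
Proof.
move=> lh hO [u [u0 hu]]; apply: contrapT => nO.
by move/eqP: u0; apply; apply: (weight_span_notin lh (hO u) hu).
Qed.

Lemma nilp_subspace (Q : V -> Prop) (A : V -> V) : subspace Q -> linop A ->
  (forall u, Q u -> Q (A u)) -> subspace (fun u => exists N, Q (iter N A u)).
Proof.
move=> sQ lA QA; split; first by exists 0%N; case: sQ.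
move=> a u w [N QN] [M QM]; exists (N + M)%N.
rewrite (linop_iter _ lA); apply: subspaceD => //; last by rewrite iterD; apply: stable_iter.
by apply: subspaceZ => //; rewrite addnC iterD; apply: stable_iter.
Qed.

End Weights.

(** * Modules under Chevalley generators: root strings, local nilpotency, integrality of the Cartan
    matrix *)

Section LieModules.
Variables (R : realType) (n : nat) (g : vectType (complex R)).
Local Notation C := (complex R).
Local Notation wght := 'rV[C]_n.
Variables (br : g -> g -> g) (hs e f : 'I_n -> g) (alpha : 'I_n -> wght).
Hypothesis setup : chevalley_setup br hs e f alpha.

Lemma br_linr x : linop (br x).
Proof. by case: setup => [[_ [h _]] _] a y z; apply: h. Qed.

Lemma br_linl a x y z : br (a *: x + y) z = a *: br x z + br y z.
Proof. by case: setup => [[h _] _]; apply: h. Qed.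

Lemma br_linop_l z : linop (br^~ z).
Proof. by move=> a x y; apply: br_linl. Qed.

Lemma brxx x : br x x = 0.
Proof. by case: setup => [[_ [_ [h _]]] _]; apply: h. Qed.

Lemma br_anti x y : br x y = - br y x.
Proof.
have := brxx (x + y); rewrite (linopD _ _ (br_linr _)) !(linopD _ _ (br_linop_l _)) !brxx.
by rewrite add0r addr0 => /eqP; rewrite addrC addr_eq0 => /eqP.
Qed.

Lemma jacobi x y z : br x (br y z) = br (br x y) z + br y (br x z).
Proof.
case: setup => [[_ [_ [_ h]]] _]; have /eqP := h x y z.
rewrite -addrA addr_eq0 => /eqP->; rewrite opprD addrC.
rewrite (br_anti (br x y)) (br_anti x z) (linopN _ (br_linr _)).
by [].
Qed.

Lemma br_lie_module S : lie_module br br S.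
Proof.
split; first exact: br_linl.
  by move=> x a u w; apply: br_linr.
move=> x y z _ _; rewrite (jacobi x y z) addrK //.
Qed.

Lemma hs_free : free [seq hs i | i <- enum 'I_n].
Proof. by case: setup => _ [_ [h _]]. Qed.

Lemma br_hs i j : br (hs i) (hs j) = 0.
Proof. by case: setup => _ [_ [_ [h _]]]. Qed.

Lemma centralizer_hs x : (forall i, br (hs i) x = 0) -> x \in hspace hs.
Proof. by case: setup => _ [_ [_ [_ [h _]]]]; apply: h. Qed.

Lemma root_decomposition x : weight_span hs br (fun _ => True) x.
Proof.
case: setup => _ [_ [_ [_ [_ [h _]]]]]; have [s [h1 h2]] := h x.
by exists s; split=> // p ps; split=> //; apply: h1.
Qed.

Lemma root_e i : weight_vec hs br (alpha i) (e i).
Proof. by case: setup => _ [_ [_ [_ [_ [_ [h _]]]]]]; have [] := h i. Qed.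

Lemma root_f i : weight_vec hs br (- alpha i) (f i).
Proof. by case: setup => _ [_ [_ [_ [_ [_ [h _]]]]]]; have [] := h i. Qed.

Lemma alpha_ii i : alpha i 0 i = 2.
Proof. by case: setup => _ [_ [_ [_ [_ [_ [h _]]]]]]; have [] := h i. Qed.

Lemma br_ef i j : br (e i) (f j) = if i == j then hs i else 0.
Proof. by case: setup => _ [_ [_ [_ [_ [_ [_ [h _]]]]]]]. Qed.

Lemma root_sign mu : is_root br hs mu ->
  natcomb (simple_root_in alpha (fun _ => True)) mu \/
  natcomb (simple_root_in alpha (fun _ => True)) (- mu).
Proof. by case: setup => _ [_ [_ [_ [_ [_ [_ [_ h]]]]]]]; apply: h. Qed.

Lemma root_hs i : weight_vec hs br 0 (hs i).
Proof. by move=> j; rewrite br_hs mxE scale0r. Qed.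

Lemma hs_sum_eq0 (c : 'I_n -> C) : \sum_i c i *: hs i = 0 -> forall i, c i = 0.
Proof.
move=> h i; have := hs_free.
have E : [seq hs i | i <- enum 'I_n] = [tuple hs i | i < n] by [].
rewrite E => /freeP/(_ c); apply.
by rewrite -[RHS]h; apply: eq_bigr => j _; rewrite -tnth_nth tnth_mktuple.
Qed.

Lemma hs_neq0 i : hs i != 0.
Proof.
apply/eqP => h0; have H := @hs_sum_eq0 (fun j => (j == i)%:R).
have := oner_neq0 C; rewrite -[1]/(true%:R) -(eqxx i) H ?eqxx //.
rewrite (bigD1 i) //= eqxx scale1r h0 add0r big1 // => j /negPf->.
by rewrite scale0r.
Qed.

Lemma f_neq0 i : f i != 0.
Proof.
apply/eqP => h; have := br_ef i i; rewrite eqxx h (linop0 (br_linr _)) => /esym/eqP.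
by rewrite (negPf (hs_neq0 i)).
Qed.

Section OneModule.
Variables (V : lmodType C) (act : g -> V -> V) (S : g -> Prop).
Hypothesis Hm : lie_module br act S.

Lemma act_linop x : linop (act x).
Proof. by case: Hm => _ h _ a u w; apply: h. Qed.

Lemma act_linl a x y u : act (a *: x + y) u = a *: act x u + act y u.
Proof. by case: Hm => h _ _; apply: h. Qed.

Lemma act_br x y u : S x -> S y -> act x (act y u) = act (br x y) u + act y (act x u).
Proof. by case: Hm => _ _ h Sx Sy; rewrite (h _ _ _ Sx Sy) subrK. Qed.

Lemma act0l u : act 0 u = 0.
Proof.
have := act_linl (-1) 0 0 u; rewrite scaler0 addr0 => {1}->.
by rewrite scaleN1r addNr.
Qed.

Lemma actDl x y u : act (x + y) u = act x u + act y u.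
Proof. by rewrite -{1}(scale1r x) act_linl scale1r. Qed.

Lemma actZl a x u : act (a *: x) u = a *: act x u.
Proof. by rewrite -(addr0 (a *: x)) act_linl act0l addr0. Qed.

Lemma act_suml (I : Type) (r : seq I) (G : I -> g) u :
  act (\sum_(i <- r) G i) u = \sum_(i <- r) act (G i) u.
Proof.
elim: r => [|i r IH]; first by rewrite !big_nil act0l.
by rewrite !big_cons actDl IH.
Qed.

Hypothesis Sh : forall i, S (hs i).

Lemma weight_act mu be x u : S x -> weight_vec hs br be x -> weight_vec hs act mu u ->
  weight_vec hs act (mu + be) (act x u).
Proof.
move=> Sx hx hu i; rewrite act_br // hx actZl hu (linopZ _ _ (act_linop x)).
by rewrite mxE addrC scalerDl.
Qed.

Lemma weight_iter_act mu be x u k : S x -> weight_vec hs br be x ->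
  weight_vec hs act mu u -> weight_vec hs act (mu + be *+ k) (iter k (act x) u).
Proof.
move=> Sx hx hu; elim: k => [|k IH] /=; first by rewrite mulr0n addr0.
by rewrite mulrS (addrC be) addrA; apply: weight_act.
Qed.

Lemma sl2_act i : S (e i) -> S (f i) -> sl2_triple (act (e i)) (act (f i)) (act (hs i)).
Proof.
move=> Se Sf; split; first by split; exact: act_linop.
- exact: act_linop.
- by move=> u; rewrite (act_br _ Se Sf) br_ef eqxx addrC.
- by move=> u; rewrite (act_br _ (Sh i) Se) root_e alpha_ii actZl addrC.
- by move=> u; rewrite (act_br _ (Sh i) Sf) root_f mxE alpha_ii actZl addrC scaleNr.
Qed.

(** An instance of [sl2_string] in which [P t] records the weight [mu - t alpha_i]. [Q] stays
    general because the proof that [g] is generated by the [e_i] and [f_i] uses strings modulo a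
    subalgebra. *)
Lemma wt_string_mod (Q : V -> Prop) i mu u : S (e i) -> S (f i) -> subspace Q ->
  (forall u, Q u -> Q (act (e i) u)) -> (forall u, Q u -> Q (act (f i) u)) ->
  (forall u, exists N, Q (iter N (act (e i)) u)) ->
  (forall u, exists N, Q (iter N (act (f i)) u)) ->
  ~ Q u -> weight_vec hs act mu u ->
  exists z : int, mu 0 i = z%:~R /\ forall t : int, 0 <= t <= z \/ z <= t <= 0 ->
    exists w, weight_vec hs act (mu - alpha i *~ t) w /\ ~ Q w.
Proof.
move=> Se Sf sQ Qe Qf ne nf nQu hu.
apply: (sl2_string (P := fun t w => weight_vec hs act (mu - alpha i *~ t) w)
  (sl2_act Se Sf) sQ Qe Qf ne nf _ _ nQu (hu i)).
- move=> t w hw; rewrite mulrzDr mulr1z opprD addrA.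
  exact: weight_act (root_f i) hw.
- move=> t w hw; rewrite mulrzBr mulr1z opprB addrA [mu + _]addrC -addrA addrC.
  exact: weight_act (root_e i) hw.
- by rewrite mulr0z subr0.
Qed.

Lemma wt_string i mu : S (e i) -> S (f i) ->
  (forall u, exists N, iter N (act (e i)) u = 0) ->
  (forall u, exists N, iter N (act (f i)) u = 0) ->
  wt hs act mu ->
  exists z : int, mu 0 i = z%:~R /\ forall t : int, 0 <= t <= z \/ z <= t <= 0 ->
    wt hs act (mu - alpha i *~ t).
Proof.
move=> Se Sf ne nf [u [u0 hu]].
have [] := @wt_string_mod (fun u => u = 0) i mu u Se Sf (subspace0 V) _ _ ne nf _ hu.
- by move=> w ->; rewrite (linop0 (act_linop _)).
- by move=> w ->; rewrite (linop0 (act_linop _)).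
- exact/eqP.
move=> z [mz hz]; exists z; split=> // t /hz[w [hw /eqP w0]].
by exists w.
Qed.

End OneModule.

Section FiniteDim.
Variables (W : vectType C) (act : g -> W -> W) (S : g -> Prop).
Hypothesis Hm : lie_module br act S.
Hypothesis Sh : forall i, S (hs i).

(** The iterates have weights [mu + k be], pairwise distinct because [be] is nonzero at [h_i]; if
    none vanished, [dim W + 1] of them would be independent. *)
Lemma fd_weight_nilp be x mu u i : S x -> weight_vec hs br be x -> be 0 i != 0 ->
  weight_vec hs act mu u -> exists N, iter N (act x) u = 0.
Proof.
move=> Sx hx bi hu; apply: contrapT => hn.
have nz N : iter N (act x) u != 0 by apply/eqP => hN; apply: hn; exists N.
pose d := \dim {:W}.
pose X := [tuple iter k (act x) u | k < d.+1].
have fX : free X.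
  apply/freeP => k hk.
  have hk' : \sum_(j < d.+1) k j *: iter j (act x) u = 0.
    by rewrite -[RHS]hk; apply: eq_bigr => j _; rewrite -tnth_nth tnth_mktuple.
  move=> j; have /eqP : k j *: iter j (act x) u = 0.
    pose s := map (fun l : 'I_d.+1 => (mu + be *+ l, - k l *: iter l (act x) u))
      [seq l <- enum 'I_d.+1 | l != j].
    apply: (@weight_sum_eq0 R n g hs W act s (mu + be *+ j)).
    - by move=> l; apply: act_linop Hm _.
    - move=> p /mapP[l]; rewrite mem_filter => /andP[lj _] -> /=; split.
        move=> r; rewrite (linopZ _ _ (act_linop Hm _)).
        by rewrite (weight_iter_act Hm Sh l Sx hx hu) !scalerA mulrC.
      move=> /(congr1 (fun M : wght => M 0 i)); rewrite 2!mxE !mulmxnE => eqc.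
      by move: lj; rewrite -val_eqE /= (addr_mulrn_inj bi eqc) eqxx.
    - move=> r; rewrite (linopZ _ _ (act_linop Hm _)).
      by rewrite (weight_iter_act Hm Sh j Sx hx hu) !scalerA mulrC.
    rewrite big_map big_filter big_enum_cond /=.
    have := hk'; rewrite (bigD1 j) //= => /eqP; rewrite addr_eq0 => /eqP ->.
    by rewrite -sumrN; apply: eq_bigr => l _; rewrite scaleNr.
  by rewrite scaler_eq0 (negPf (nz j)) orbF => /eqP.
have := dimvS (subvf <<X>>%VS); rewrite (eqP fX) size_tuple -/d.
by rewrite ltnn.
Qed.

End FiniteDim.

Lemma ad_nilp be x y i : weight_vec hs br be x -> be 0 i != 0 ->
  exists N, iter N (br x) y = 0.
Proof.
move=> hx bi.
apply: (weight_span_ind (Q := fun y => exists N, iter N (br x) y = 0) _ _ (root_decomposition y)).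
  apply: (nilp_subspace (Q := fun y => y = 0)); [exact: subspace0 | exact: br_linr |].
  by move=> w ->; rewrite (linop0 (br_linr _)).
move=> mu w _ hw.
by apply: (fd_weight_nilp (br_lie_module (fun _ => True)) _ _ hx bi hw).
Qed.

Lemma ad_nilp_e i y : exists N, iter N (br (e i)) y = 0.
Proof. by apply: (ad_nilp (i := i) _ (root_e i)); rewrite alpha_ii pnatr_eq0. Qed.

Lemma ad_nilp_f i y : exists N, iter N (br (f i)) y = 0.
Proof.
by apply: (ad_nilp (i := i) _ (root_f i)); rewrite mxE alpha_ii oppr_eq0 pnatr_eq0.
Qed.

Definition cartan_spec (a : 'M[int]_n) : Prop :=
  [/\ (forall i j, alpha j 0 i = (a i j)%:~R), (forall i, a i i = 2) &
      (forall i j, i != j -> a i j <= 0)].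

(** For [i != j], [[e_i, f_j] = 0] makes [f_j] a highest weight vector for the adjoint action of the
    [sl_2] of [i]; nilpotency of [ad f_i] forces its eigenvalue [- alpha_j(h_i)] to be a natural
    number. *)
Lemma cartan_exists : exists a : 'M[int]_n, cartan_spec a.
Proof.
have H : forall i j, exists z : int,
    [/\ alpha j 0 i = z%:~R, (i = j -> z = 2) & (i != j -> z <= 0)].
  move=> i j; have [<-|ij] := eqVneq i j; first by exists 2; rewrite alpha_ii.
  have [N hN] := ad_nilp_f i (f j).
  have t := sl2_act (br_lie_module (fun _ => True)) (fun _ => I) (i := i) I I.
  have st x u : u = 0 -> br x u = 0 by move=> ->; rewrite (linop0 (br_linr _)).
  have ef0 : br (e i) (f j) = 0 by rewrite br_ef (negPf ij).
  have [k hk _] := sl2_hw_nat t (subspace0 g) (st _) (st _) (elimN eqP (f_neq0 j)) ef0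
    (root_f j i) hN.
  exists (- k%:Z); split=> //; last by rewrite oppr_le0.
    by rewrite rmorphN /= -pmulrn -hk mxE opprK.
  by move=> eij; rewrite eij eqxx in ij.
have [F hF] := choice (fun p : 'I_n * 'I_n => H p.1 p.2).
exists (\matrix_(i, j) F (i, j)); split=> [i j|i|i j]; rewrite mxE.
- by have [] := hF (i, j).
- by have [_ ->] := hF (i, i).
- by have [_ _] := hF (i, j).
Qed.

End LieModules.

(** * The trace form of the adjoint representation and finite type *)

Definition finite_type (R : realType) (n : nat) (a : 'M[int]_n) (d : 'I_n -> R) : Prop :=
  [/\ (forall i, 0 < d i), (forall i j, d i * (a i j)%:~R = d j * (a j i)%:~R) &
      (forall k : 'I_n -> R, (exists i, k i != 0) ->
         0 < \sum_i \sum_j d i * k i * (a i j)%:~R * k j)].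

Section TraceForm.
Variables (R : realType) (n : nat) (g : vectType (complex R)).
Local Notation C := (complex R).
Local Notation wght := 'rV[C]_n.
Variables (br : g -> g -> g) (hs e f : 'I_n -> g) (alpha : 'I_n -> wght).
Hypothesis setup : chevalley_setup br hs e f alpha.

(** The line through a central element is an abelian ideal. Semisimplicity enters the proof through
    this fact. *)
Lemma center_eq0 x : (forall y, br x y = 0) -> x = 0.
Proof.
move=> hx; have [_ [ss _]] := setup.
have : (<[x]> = 0 :> {vspace g})%VS.
  apply: ss => [y z|y z] /vlineP[k ->].
    by rewrite (linopZ _ _ (br_linr setup _)) (br_anti setup) hx oppr0 scaler0 mem0v.
  by move=> _; rewrite (linopZ _ _ (br_linop_l setup _)) hx scaler0.
by move=> h0; apply/eqP; rewrite -memv0 -h0 memv_line.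
Qed.

Lemma weight_basis : exists (m : nat) (b : m.-tuple g) (be : 'I_m -> wght),
  basis_of fullv b /\ forall p, weight_vec hs br (be p) (tnth b p).
Proof.
pose wl (X : seq g) := forall x, x \in X -> exists mu, weight_vec hs br mu x.
have [X [fX wX sX]] : exists X, [/\ free X, wl X & <<X>>%VS = fullv].
  have step : forall m X, (\dim {:g} - size X < m)%N -> free X -> wl X ->
      exists X, [/\ free X, wl X & <<X>>%VS = fullv].
    elim=> // m IH X lt fX wX.
    have [[x [mu [hx nx]]]|hn] :=
      pselect (exists x mu, weight_vec hs br mu x /\ x \notin <<X>>%VS).
      have fxX : free (x :: X) by rewrite free_cons nx.
      have := dimvS (subvf <<x :: X>>%VS); rewrite (eqP fxX) => dX.
      apply: (IH (x :: X)) => //; first by move: lt dX => /=; lia.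
      by move=> y; rewrite inE => /predU1P[->|/wX //]; exists mu.
    exists X; split=> //; apply/eqP; rewrite eqEsubv subvf /=; apply/subvP => y _.
    apply: (weight_span_ind (Q := fun y => y \in <<X>>%VS) _ _ (root_decomposition setup y)).
      split; first exact: mem0v.
      by move=> c u w hu hw; rewrite memvD ?memvZ.
    move=> mu u _ hu; apply/negPn/negP => nu; apply: hn.
    by exists u, mu.
  apply: (step (\dim {:g}).+1 [::]) => //=; first by rewrite subn0.
  by rewrite nil_free.
have [be hbe] := choice (fun p : 'I_(size X) => wX _ (mem_nth 0 (ltn_ord p))).
exists (size X), (in_tuple X), be; split; first by rewrite /basis_of sX eqxx.
by move=> p; rewrite (tnth_nth 0).
Qed.

(** Let [B] be the trace form on the coroots. Invariance gives [2 B_ij = a_ji B_ii]. Roots take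
    integral values at coroots, so [B] is a sum of squares on real combinations of coroots, and it
    vanishes only on central ones. The symmetrizer [2 / B_ii] is [(alpha_i, alpha_i) / 2] for the
    induced form on weights. *)
Lemma finite_type_cartan (a : 'M[int]_n) : cartan_spec alpha a -> exists d : 'I_n -> R, finite_type a d.
Proof.
case=> ha a2 _.
have [m [b [be [bb hbe]]]] := weight_basis.
have fb := basis_free bb.
(* Basis images are stored as rows, so [rho] reverses products; hence the order of the factors in
   [rho_br]. *)
pose rho (x : g) : 'M[C]_m := \matrix_(p, q) coord b q (br x (tnth b p)).
have rhoE x p : br x (tnth b p) = \sum_q rho x p q *: tnth b q.
  rewrite [LHS](coord_basis bb (memvf _)); apply: eq_bigr => q _.
  by rewrite mxE -tnth_nth.
have tnthb p : tnth b p = b`_p by rewrite (tnth_nth 0).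
have cE c p : coord b p (\sum_q c q *: tnth b q) = c p.
  rewrite linear_sum /= (bigD1 p) //= linearZ /= tnthb coord_free // eqxx mulr1.
  rewrite big1 ?addr0 // => q qp.
  by rewrite linearZ /= tnthb coord_free // (negPf qp) mulr0.
have rho_br x y : rho (br x y) = rho y *m rho x - rho x *m rho y.
  have E : forall x y p, br x (br y (tnth b p)) = \sum_r (rho y *m rho x) p r *: tnth b r.
    move=> {}x {}y p; rewrite rhoE (linop_sum _ _ (br_linr setup x)).
    under eq_bigr do rewrite (linopZ _ _ (br_linr setup x)) rhoE scaler_sumr.
    rewrite exchange_big /=; apply: eq_bigr => r _.
    by rewrite mxE scaler_suml; apply: eq_bigr => q _; rewrite scalerA.
  apply/matrixP => p q; rewrite mxE.
  have -> : br (br x y) (tnth b p) = br x (br y (tnth b p)) - br y (br x (tnth b p)).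
    by rewrite (jacobi setup x y) addrK.
  rewrite !E -sumrB -[RHS](cE (fun q => (rho y *m rho x - rho x *m rho y) p q)).
  congr (coord _ _ _); apply: eq_bigr => r _.
  by rewrite [in RHS]mxE [X in _ = (_ + X) *: _]mxE scalerBl.
have rhoZ c x : rho (c *: x) = c *: rho x.
  by apply/matrixP => p q; rewrite !mxE (linopZ _ _ (br_linop_l setup _)) linearZ.
have rhoh i p q : rho (hs i) p q = be p 0 i *+ (p == q).
  rewrite mxE hbe linearZ /= tnthb coord_free // -val_eqE.
  by rewrite mulr_natr.
have zbe : exists z : 'I_m -> 'I_n -> int, forall p i, be p 0 i = (z p i)%:~R.
  have H p i : exists z : int, be p 0 i = z%:~R.
    have wb : wt hs br (be p).
      by exists (tnth b p); split=> //; apply: (free_not0 fb); apply: mem_tnth.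
    have [z [hz _]] := wt_string setup (br_lie_module setup (fun _ => True)) (fun _ => I)
      (i := i) I I (ad_nilp_e setup i) (ad_nilp_f setup i) wb.
    by exists z.
  have [F hF] := choice (fun q : 'I_m * 'I_n => H q.1 q.2).
  by exists (fun p i => F (p, i)) => p i; apply: (hF (p, i)).
have [z hz] := zbe.
pose B i j : int := \sum_p z p i * z p j.
have BE i j : (B i j)%:~R = \tr (rho (hs i) *m rho (hs j)) :> C.
  rewrite /B rmorph_sum; apply: eq_bigr => p _ /=.
  rewrite mxE (bigD1 p) //= big1 ?addr0 => [|q qp]; last first.
    by rewrite rhoh eq_sym (negPf qp) mul0r.
  by rewrite !rhoh eqxx !hz -rmorphM.
have B2 i j : 2 * B i j = a j i * B i i.
  (* Invariance of the trace: [tr([e_i, f_i] h_k) = tr(e_i [f_i, h_k])] with [[f_i, h_k] =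
     alpha_i(h_k) f_i]. The case [k = i] identifies the trace on the right as [B i i / 2]. *)
  have tE k : (B i k)%:~R = (a k i)%:~R * \tr (rho (e i) *m rho (f i)) :> C.
    rewrite BE; have {1}-> : hs i = br (e i) (f i) by rewrite (br_ef setup) eqxx.
    rewrite rho_br mulmxBl linearB /= -!mulmxA mxtrace_mulC -!mulmxA -linearB /=.
    rewrite -mulmxBr -rho_br (br_anti setup) (root_f setup i k) mxE scaleNr opprK.
    by rewrite rhoZ -scalemxAr linearZ /= ha.
  apply: (@intr_inj C); rewrite !rmorphM /= !tE a2.
  by rewrite mulrCA.
have Bsq (t : 'I_n -> R) : \sum_i \sum_j t i * t j * (B i j)%:~R
    = \sum_p (\sum_i t i * (z p i)%:~R) ^+ 2 :> R.
  under [RHS]eq_bigr => p _.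
    rewrite expr2 mulr_suml.
    under eq_bigr do rewrite mulr_sumr.
    over.
  rewrite [RHS]exchange_big /=; apply: eq_bigr => i _.
  rewrite [RHS]exchange_big /=; apply: eq_bigr => j _.
  rewrite rmorph_sum mulr_sumr; apply: eq_bigr => p _.
  by rewrite rmorphM /=; ring.
have Bpos (t : 'I_n -> R) : (exists i, t i != 0) -> 0 < \sum_i \sum_j t i * t j * (B i j)%:~R :> R.
  move=> [i ti]; rewrite Bsq lt_def sumr_ge0 ?andbT => [|p _]; last exact: sqr_ge0.
  apply/negP; rewrite psumr_eq0 => [/allP s0|p _]; last exact: sqr_ge0.
  (* All squares vanish, so this real combination of coroots acts by 0 on a weight basis; it is
     central, hence 0. *)
  pose x := \sum_j (t j)%:C%C *: hs j.
  have x0 : x = 0.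
    apply: center_eq0 => y; rewrite (coord_basis bb (memvf y)) (linop_sum _ _ (br_linr setup _)).
    apply: big1 => p _; rewrite (linopZ _ _ (br_linr setup _)) -tnth_nth.
    rewrite (linop_sum _ _ (br_linop_l setup _)).
    under eq_bigr do rewrite (linopZ _ _ (br_linop_l setup _)) hbe scalerA hz.
    have := s0 p (mem_index_enum p); rewrite sqrf_eq0 => /eqP sp.
    rewrite -scaler_suml; have -> : \sum_(j < n) (t j)%:C%C * (z p j)%:~R = 0 :> C.
      transitivity ((\sum_i t i * (z p i)%:~R)%:C%C); last by rewrite sp.
      by rewrite rmorph_sum; apply: eq_bigr => j _; rewrite rmorphM /= rmorph_int.
    by rewrite scale0r scaler0.
  have := hs_sum_eq0 setup x0 i => /eqP; rewrite (_ : 0 = 0%:C%C) // (inj_eq (@complexI _)).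
  exact/negP.
have Bii i : 0 < (B i i)%:~R :> R.
  have /Bpos : exists j, (j == i)%:R != 0 :> R by exists i; rewrite eqxx oner_neq0.
  rewrite (bigD1 i) //= [X in _ + X]big1 ?addr0 => [|j /negPf ji]; last first.
    by apply: big1 => k _; rewrite ji !mul0r.
  rewrite (bigD1 i) //= [X in _ + X]big1 ?addr0 => [|j /negPf ji]; last by rewrite ji mulr0 mul0r.
  by rewrite eqxx !mul1r.
have Bs i j : B i j = B j i by apply: eq_bigr => p _; rewrite mulrC.
have aB i j : (a i j)%:~R = 2 * (B i j)%:~R / (B j j)%:~R :> R.
  apply: (mulIf (lt0r_neq0 (Bii j))); rewrite divfK ?lt0r_neq0 //.
  by rewrite -rmorphM /= -B2 rmorphM /= Bs.
exists (fun i => 2 / (B i i)%:~R); split=> [i|i j|k [i ki]].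
- by rewrite divr_gt0.
- rewrite !aB (Bs j i); have := lt0r_neq0 (Bii i); have := lt0r_neq0 (Bii j).
  by move=> h1 h2; field; rewrite h1 h2.
(* Rescaling the coordinates by [2 / B_ii] turns the form [B] into the symmetrized form of [a]. *)
have := @Bpos (fun i => k i * (2 / (B i i)%:~R)).
have -> : \sum_i0 \sum_j k i0 * (2 / (B i0 i0)%:~R) * (k j * (2 / (B j j)%:~R)) * (B i0 j)%:~R
  = \sum_i0 \sum_j 2 / (B i0 i0)%:~R * k i0 * (a i0 j)%:~R * k j :> R.
  apply: eq_bigr => i' _; apply: eq_bigr => j _; rewrite aB.
  have := lt0r_neq0 (Bii i'); have := lt0r_neq0 (Bii j).
  by move=> h1 h2; field; rewrite h1 h2.
apply; exists i; rewrite mulf_neq0 // mulf_neq0 // ?invr_neq0 ?lt0r_neq0 //.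
Qed.

End TraceForm.

(** * Reflections and strings on integer coordinate vectors *)

Section Combinatorics.
Variables (R : realType) (n : nat) (a : 'M[int]_n) (d : 'I_n -> R).
Hypothesis fin : finite_type a d.
Hypothesis a2 : forall i, a i i = 2.

(** Otherwise every term [d_i y_i (a y)_i] is nonpositive, against positive definiteness at [y]. The
    index found is the simple root along which the height inductions below move. *)
Lemma finite_type_pos (y : 'I_n -> int) : (forall i, 0 <= y i) -> (exists i, y i != 0) ->
  exists i, 0 < y i /\ 0 < \sum_j a i j * y j.
Proof.
case: fin => dp _ posd y0 [i0 yi0]; apply: contrapT => hn.
have := posd (fun i => (y i)%:~R) (ex_intro _ i0 _); rewrite intr_eq0 => /(_ yi0).
apply/negP; rewrite -leNgt; apply: sumr_le0 => i _.
have -> : \sum_j d i * (y i)%:~R * (a i j)%:~R * (y j)%:~R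
  = d i * (y i * \sum_j a i j * y j)%:~R :> R.
  rewrite rmorphM rmorph_sum /= mulrA mulr_sumr; apply: eq_bigr => j _.
  by rewrite rmorphM /= !mulrA.
rewrite pmulr_rle0 // lerz0; have := y0 i; rewrite le_eqVlt => /predU1P[<-|yi].
  by rewrite mul0r.
by rewrite pmulr_rle0 // leNgt; apply/negP => s; apply: hn; exists i.
Qed.

Lemma finite_type_indep (t : 'I_n -> R) : (forall i, \sum_j (a i j)%:~R * t j = 0) ->
  forall i, t i = 0.
Proof.
case: fin => dp _ posd ht i; apply/eqP/negPn/negP => ti.
have := posd t (ex_intro _ i ti); rewrite big1 ?ltxx // => l _.
transitivity (d l * t l * \sum_j (a l j)%:~R * t j); last by rewrite ht mulr0.
by rewrite mulr_sumr; apply: eq_bigr => j _; rewrite !mulrA.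
Qed.

Definition upd (k : 'I_n -> int) (i : 'I_n) (t : int) : 'I_n -> int :=
  fun j => k j + t *+ (j == i).

Lemma upd_sum (c : 'I_n -> int) k i t :
  \sum_j c j * upd k i t j = \sum_j c j * k j + c i * t.
Proof.
under eq_bigr do rewrite /upd mulrDr.
rewrite big_split /=; congr (_ + _).
rewrite (bigD1 i) //= eqxx big1 ?addr0 // => j /negPf ->.
by rewrite mulr0n mulr0.
Qed.

Lemma updK k i t : upd (upd k i t) i (- t) = k.
Proof. by apply/funext => j; rewrite /upd mulNrn addrK. Qed.

Definition ht (k : 'I_n -> int) : int := \sum_j k j.

Lemma ht_upd k i t : ht (upd k i t) = ht k + t.
Proof.
have := upd_sum (fun _ => 1) k i t; rewrite mul1r.
by under eq_bigr do rewrite mul1r; under [X in _ = X + _]eq_bigr do rewrite mul1r.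
Qed.

Variables (J : 'I_n -> Prop) (lamJ : 'I_n -> int).

(** [k] stands for the weight [lam - sum_j k_j alpha_j], and [hpair k i] for its value at [h_i] when
    [lamJ i = lam(h_i)]; the reflection [s_i] then reads [upd k i (hpair k i)]. *)
Definition hpair (k : 'I_n -> int) (i : 'I_n) : int := lamJ i - \sum_j a i j * k j.

Lemma pair_upd k i l t : hpair (upd k i t) l = hpair k l - a l i * t.
Proof. by rewrite /hpair upd_sum opprD addrA. Qed.

Definition offJ (k : 'I_n -> int) : 'I_n -> int := fun j => if `[< J j >] then 0 else k j.

Lemma offJ_upd k i t : J i -> offJ (upd k i t) = offJ k.
Proof.
move=> Ji; apply/funext => j; rewrite /offJ /upd; case: eqVneq => [->|]; first by rewrite asboolT.
by rewrite mulr0n addr0.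
Qed.

Definition reflection_closed (X : ('I_n -> int) -> Prop) : Prop :=
  forall k i, X k -> J i -> X (upd k i (hpair k i)).

Definition string_closed (Y : ('I_n -> int) -> Prop) : Prop :=
  forall k i t, Y k -> J i -> (0 <= t <= hpair k i \/ hpair k i <= t <= 0) -> Y (upd k i t).

Lemma string_reflection_closed Y : string_closed Y -> reflection_closed Y.
Proof. by move=> sY k i Yk Ji; apply: sY => //; case: (lerP 0 (hpair k i)); lia. Qed.

(* Reflecting non-dominant elements upwards reduces to dominant [k]; those are
   reached from [offJ k] through [Y], since whenever [k' <= k] differ, finite
   type provides [i] with [hpair k' i > hpair k i >= 0] and [k' i < k i]. *)
Lemma reflection_string_incl X Y : reflection_closed X -> string_closed Y ->
  (forall k, X k -> (forall j, 0 <= k j) /\ Y (offJ k)) ->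
  forall k, X k -> Y k.
Proof.
move=> rX sY hX k Xk.
have [m] := ubnP `|ht k|; elim: m k Xk => // m IH k Xk hm.
have [k0 Yo] := hX k Xk.
have [[i [Ji pi]]|dom] := pselect (exists i, J i /\ hpair k i < 0).
  have Xk' := rX _ _ Xk Ji; set k' := upd k i (hpair k i) in Xk'.
  have [k0' _] := hX _ Xk'.
  have htk' : ht k' = ht k + hpair k i by rewrite ht_upd.
  have h0 : 0 <= ht k' by apply: sumr_ge0.
  have Yk' : Y k' by apply: IH => //; lia.
  have pk' : hpair k' i = - hpair k i by rewrite pair_upd a2; lia.
  by have := string_reflection_closed sY Yk' Ji; rewrite pk' updK.
have {}dom i : J i -> 0 <= hpair k i.
  by move=> Ji; rewrite leNgt; apply/negP => pi; apply: dom; exists i.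
suff step : forall r k', `|ht k - ht k'|%N = r -> Y k' -> (forall j, k' j <= k j) ->
    offJ k' = offJ k -> Y k.
  apply: (step _ (offJ k) erefl Yo); last first.
    by apply/funext => j; rewrite /offJ; case: asbool.
  by move=> j; rewrite /offJ; case: asbool.
elim=> [|r IHr] k' hr Yk' kk' ok'.
  suff -> : k = k' by [].
  apply/funext => j; apply/eqP; rewrite -subr_eq0; apply/eqP.
  have /eqP : \sum_j (k j - k' j) = 0 by rewrite sumrB -!/(ht _); lia.
  rewrite psumr_eq0 => [/allP/(_ j (mem_index_enum j))/eqP //|l _].
  by rewrite subr_ge0.
have [||i [yi si]] := @finite_type_pos (fun j => k j - k' j).
- by move=> j; rewrite subr_ge0.
- apply: contrapT => hn; suff : ht k = ht k' by lia.
  apply: eq_bigr => j _; apply/eqP; rewrite -subr_eq0; apply/negPn/negP => nj.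
  by apply: hn; exists j.
have Ji : J i.
  apply: contrapT => nJ; have := congr1 (fun F => F i) ok'.
  by rewrite /offJ asboolF // => eqk; move: yi; rewrite eqk subrr.
have pk' : 0 < hpair k' i.
  have -> : hpair k' i = hpair k i + \sum_j a i j * (k j - k' j).
    under eq_bigr do rewrite mulrBr.
    by rewrite sumrB /hpair addrA subrK.
  exact: ltr_wpDl (dom i Ji) si.
apply: (IHr (upd k' i 1)).
- have : 0 <= ht k - ht (upd k' i 1).
    rewrite -sumrB; apply: sumr_ge0 => j _; rewrite /upd.
    by have := kk' j; case: eqVneq => [->|_]; lia.
  by rewrite ht_upd; lia.
- by apply: sY => //; left; lia.
- by move=> j; rewrite /upd; have := kk' j; case: eqVneq => [->|_]; lia.
by rewrite offJ_upd.
Qed.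

(* The quadratic function [q x - 2 l x] is invariant under reflections and
   nonpositive on dominant elements, so its sublevel set bounds [k]. *)
Lemma reflection_closed_bounded X nu : reflection_closed X ->
  (forall k, X k -> forall j, 0 <= k j) ->
  exists B : nat, forall k, X k -> offJ k = nu -> ht k <= B%:Z.
Proof.
move=> rX X0; have [dp ds posd] := fin.
pose G : 'M[R]_n := \matrix_(i, j) (d i * (a i j)%:~R).
pose b (x y : 'rV[R]_n) : R := (x *m G *m y^T) 0 0.
have GT : G^T = G by apply/matrixP => i j; rewrite !mxE ds.
have bC x y : b x y = b y x.
  by rewrite /b -[x *m G *m y^T]trmxK mxE !trmx_mul trmxK GT mulmxA.
have bDl x y z : b (x + y) z = b x z + b y z by rewrite /b !mulmxDl mxE.
have bZl c x z : b (c *: x) z = c * b x z by rewrite /b -!scalemxAl mxE.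
have bDr x y z : b z (x + y) = b z x + b z y by rewrite bC bDl !(bC z).
have bZr c x z : b z (c *: x) = c * b z x by rewrite bC bZl (bC z).
have bE x y : b x y = \sum_i \sum_j d i * x 0 i * (a i j)%:~R * y 0 j.
  rewrite /b mxE exchange_big /=; apply: eq_bigr => j _; rewrite mxE mulr_suml.
  by apply: eq_bigr => i _; rewrite !mxE; ring.
have qp x : x != 0 -> 0 < b x x.
  move=> x0; rewrite bE; apply: posd.
  by case/rV0Pn: x0 => i xi; exists i.
have q0 x : 0 <= b x x.
  by have [->|/qp/ltW //] := eqVneq x 0; rewrite /b !mul0mx mxE.
have uG : G \in unitmx.
  rewrite -row_free_unit; apply/inj_row_free => x xG.
  by apply/eqP/negPn/negP => /qp; rewrite /b xG mul0mx mxE ltxx.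
pose x k : 'rV[R]_n := \row_j (k j - nu j)%:~R.
pose p i : R := (if `[< J i >] then hpair nu i else 0)%:~R.
(* The vector that represents the linear form [l] with respect to [b]; it is the centre of the
   ellipsoid to which the points [x k] will be confined. *)
pose ka : 'rV[R]_n := (\row_i (d i * p i)) *m invmx G.
have kaE y : b ka y = \sum_i d i * p i * y 0 i.
  by rewrite /b mulmxKV // mxE; apply: eq_bigr => i _; rewrite !mxE.
have yE i y : b (delta_mx 0 i *m invmx G) y = y 0 i.
  rewrite /b mulmxKV // mxE (bigD1 i) //= !mxE !eqxx mul1r big1 ?addr0 // => j ji.
  by rewrite !mxE (negPf ji) mul0r.
have deltaE i y : b (delta_mx 0 i) y = d i * \sum_j (a i j)%:~R * y 0 j.
  rewrite bE (bigD1 i) //= [X in _ + X]big1 ?addr0 => [|l li]; last first.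
    by apply: big1 => j _; rewrite !mxE (negPf li) mulr0 !mul0r.
  by rewrite mulr_sumr; apply: eq_bigr => j _; rewrite !mxE !eqxx mulr1 mulrA.
have xJ k i : offJ k = nu -> ~ J i -> x k 0 i = 0.
  by move=> ok nJ; rewrite mxE -ok /offJ asboolF // subrr.
have pairE k i : offJ k = nu -> J i -> (hpair k i)%:~R = p i - \sum_j (a i j)%:~R * x k 0 j.
  move=> ok Ji; rewrite /p asboolT // /hpair.
  rewrite [X in _ = _ - X](_ : _ = (\sum_j a i j * (k j - nu j))%:~R); last first.
    by rewrite rmorph_sum; apply: eq_bigr => j _; rewrite mxE rmorphM.
  rewrite -rmorphB; congr (_%:~R); under [X in _ = _ - X]eq_bigr do rewrite mulrBr.
  by rewrite sumrB opprB addrA subrK.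
have key k : X k -> offJ k = nu -> b (x k) (x k) <= 2 * b ka (x k).
  have [m] := ubnP `|ht k|; elim: m k => // m IH k hm Xk ok.
  have [[i [Ji pi]]|dom] := pselect (exists i, J i /\ hpair k i < 0).
    have Xk' := rX _ _ Xk Ji; set k' := upd k i (hpair k i) in Xk'.
    have htk' : ht k' = ht k + hpair k i by rewrite ht_upd.
    have h0 : 0 <= ht k' by apply: sumr_ge0 => j _; apply: X0.
    have h0' : 0 <= ht k by apply: sumr_ge0 => j _; apply: X0.
    have ok' : offJ k' = nu by rewrite offJ_upd.
    have hlt : (`|ht k'| < m)%N by lia.
    have := IH k' hlt Xk' ok'.
    have -> : x k' = x k + (hpair k i)%:~R *: delta_mx 0 i.
      apply/rowP => j; rewrite !mxE /k' /upd /= addrAC rmorphD /=; congr (_ + _).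
      by case: (j == i); rewrite ?mulr1 ?mulr0.
    rewrite !bDl !bDr !bZl !bZr (bC (x k) (delta_mx 0 i)) !deltaE !kaE.
    have -> : \sum_j (a i j)%:~R * (delta_mx 0 i : 'rV[R]_n) 0 j = 2.
      rewrite (bigD1 i) //= big1 ?addr0 => [|j ji]; last first.
        by rewrite !mxE (negPf ji) mulr0.
      by rewrite !mxE !eqxx a2 mulr1.
    have -> : \sum_i0 d i0 * p i0 * (delta_mx 0 i : 'rV[R]_n) 0 i0 = d i * p i.
      rewrite (bigD1 i) //= big1 ?addr0 => [|j ji]; last first.
        by rewrite !mxE (negPf ji) mulr0.
      by rewrite !mxE !eqxx mulr1.
    rewrite (pairE _ _ ok Ji); set s := \sum_j _; set l := \sum_i0 _.
    by set q := b _ _; set D := d i; set P := p i; nra.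
  have {}dom i : J i -> 0 <= hpair k i.
    by move=> Ji; rewrite leNgt; apply/negP => pi; apply: dom; exists i.
  have : 0 <= b ka (x k) - b (x k) (x k).
    rewrite kaE bE -sumrB; apply: sumr_ge0 => i _.
    have -> : d i * p i * x k 0 i - \sum_j d i * x k 0 i * (a i j)%:~R * x k 0 j
       = d i * x k 0 i * (p i - \sum_j (a i j)%:~R * x k 0 j).
      rewrite mulrBr mulr_sumr; congr (_ - _); first by ring.
      by apply: eq_bigr => j _; rewrite !mulrA.
    have [Ji|nJ] := pselect (J i); last by rewrite (xJ _ _ ok nJ) mulr0 mul0r.
    rewrite -pairE // mulr_ge0 ?ler0z ?dom // mulr_ge0 ?(ltW (dp i)) //.
    by rewrite mxE ler0z -ok /offJ asboolT // subr0 X0.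
  by have := q0 (x k); lra.
(* The vector [y = delta_mx 0 i *m invmx G] represents the [i]-th coordinate, and [key] says that
   [b] is at most [b ka ka] on [x - ka]. Expanding [0 <= b z z] for [z = y - (x - ka)] then bounds
   [x_i] by this number. *)
pose c i : R := ka 0 i + (b (delta_mx 0 i *m invmx G) (delta_mx 0 i *m invmx G) + b ka ka) / 2.
have xc k i : X k -> offJ k = nu -> x k 0 i <= c i.
  move=> Xk ok; have := key k Xk ok.
  pose y : 'rV[R]_n := delta_mx 0 i *m invmx G.
  have := q0 (y - (x k - ka)).
  have := yE i (x k); have := yE i ka; rewrite -/y /c -/y.
  rewrite -!scaleN1r !bDl !bDr !bZl !bZr !bDl !bDr !bZl !bZr.
  rewrite (bC (x k) y) (bC ka y) (bC (x k) ka).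
  by set q1 := b y y; set q2 := b ka ka; set q3 := b (x k) (x k) => -> ->; nra.
pose D : R := \sum_i `|c i| + `|(ht nu)%:~R|.
exists (Num.bound D) => k Xk ok.
have D0 : 0 <= D by rewrite addr_ge0 // sumr_ge0.
have := archi_boundP D0; rewrite pmulrn => /ltW hB.
have : (ht k)%:~R <= D.
  have -> : (ht k)%:~R = \sum_i x k 0 i + (ht nu)%:~R :> R.
    rewrite !rmorph_sum -big_split /=; apply: eq_bigr => i _.
    by rewrite mxE rmorphB /= subrK.
  by rewrite lerD ?ler_norm // ler_sum // => i _; apply: le_trans (xc _ _ Xk ok) (ler_norm _).
by move=> /le_trans/(_ hB); rewrite ler_int.
Qed.

End Combinatorics.

(** * The root lattice, generation of [g], and highest weight modules *)

Section RootLattice.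
Variables (R : realType) (n : nat) (g : vectType (complex R)).
Local Notation C := (complex R).
Local Notation wght := 'rV[C]_n.
Variables (br : g -> g -> g) (hs e f : 'I_n -> g) (alpha : 'I_n -> wght).
Hypothesis setup : chevalley_setup br hs e f alpha.
Variables (a : 'M[int]_n) (d : 'I_n -> R).
Hypothesis cart : cartan_spec alpha a.
Hypothesis fin : finite_type a d.

Definition wtk (k : 'I_n -> int) : wght := \sum_j alpha j *~ k j.

Definition nonneg (k : 'I_n -> int) : Prop := forall j, 0 <= k j.

Lemma mulrz_row (x : wght) z i : (x *~ z) 0 i = x 0 i *~ z.
Proof. by case: z => z; rewrite ?NegzE ?mulrNz -?pmulrn ?mxE mulmxnE. Qed.

Lemma wtk_coord k i : wtk k 0 i = (\sum_j a i j * k j)%:~R.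
Proof.
case: cart => ha _ _; rewrite summxE rmorph_sum; apply: eq_bigr => j _.
by rewrite mulrz_row ha rmorphM /= mulrzr.
Qed.

(** Weights are recorded by their values at the coroots, so independence of the simple roots amounts
    to nonsingularity of [a], a consequence of finite type. *)
Lemma wtk_inj k k' : wtk k = wtk k' -> k = k'.
Proof.
move=> h; apply/funext => j; apply/eqP; rewrite -subr_eq0 -(intr_eq0 R); apply/eqP.
apply: (finite_type_indep fin (t := fun j => (k j - k' j)%:~R)) => i.
have /(@intr_inj C) E : (\sum_j a i j * k j)%:~R = (\sum_j a i j * k' j)%:~R :> C.
  by rewrite -!wtk_coord h.
transitivity ((\sum_j a i j * (k j - k' j))%:~R : R).
  by rewrite rmorph_sum; apply: eq_bigr => l _; rewrite rmorphM.
by under eq_bigr do rewrite mulrBr; rewrite sumrB E subrr.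
Qed.

Lemma wtk_upd k i t : wtk (upd k i t) = wtk k + alpha i *~ t.
Proof.
rewrite /wtk; under eq_bigr do rewrite /upd mulrzDr.
rewrite big_split /=; congr (_ + _).
by rewrite (bigD1 i) //= eqxx big1 ?addr0 // => j /negPf ->; rewrite mulr0n mulr0z.
Qed.

Lemma wtkD k k' : wtk (fun j => k j + k' j) = wtk k + wtk k'.
Proof. by rewrite -big_split; apply: eq_bigr => j _; rewrite mulrzDr. Qed.

Lemma wtkN k : wtk (fun j => - k j) = - wtk k.
Proof. by rewrite -sumrN; apply: eq_bigr => j _; rewrite mulrNz. Qed.

Lemma wtk0 : wtk (fun _ => 0) = 0.
Proof. by apply: big1 => j _; rewrite mulr0z. Qed.

Lemma wtk_delta i : wtk (upd (fun _ => 0) i 1) = alpha i.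
Proof. by rewrite wtk_upd wtk0 add0r mulr1z. Qed.

Lemma wtkZ k z : wtk (fun j => z * k j) = wtk k *~ z.
Proof.
rewrite /wtk mulrz_suml; apply: eq_bigr => j _.
by rewrite -mulrzA mulrC.
Qed.

Lemma natcombP (J : 'I_n -> Prop) mu : natcomb (simple_root_in alpha J) mu <->
  exists k, [/\ nonneg k, (forall j, ~ J j -> k j = 0) & mu = wtk k].
Proof.
split=> [[s [hs_ ->]]|[k [k0 kJ ->]]].
  elim: s hs_ => [|p s IH] hs_.
    by exists (fun _ => 0); rewrite big_nil wtk0.
  have [|k [k0 kJ ek]] := IH; first by move=> q qs; apply: hs_; rewrite inE qs orbT.
  have [i Ji ei] := hs_ p (mem_head _ _).
  exists (upd k i p.1%:Z); split=> [j|j nJ|].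
  - by rewrite /upd addr_ge0 // mulrn_wge0.
  - rewrite /upd kJ // add0r; case: eqVneq => [ji|]; last by rewrite mulr0n.
    by rewrite ji in nJ.
  by rewrite wtk_upd big_cons ek ei addrC scaler_nat -pmulrn.
exists [seq (`|k j|%N, alpha j) | j <- enum 'I_n & `[< J j >]]; split.
  move=> p /mapP[j]; rewrite mem_filter => /andP[/asboolP Jj _] ->.
  by exists j.
rewrite big_map big_filter big_enum_cond /= /wtk (bigID (fun j => `[< J j >])) /=.
rewrite [X in _ + X]big1 ?addr0 => [|j /asboolPn/kJ ->]; last by rewrite mulr0z.
apply: eq_bigr => j _; rewrite scaler_nat pmulrn; congr (_ *~ _).
by rewrite gez0_abs.
Qed.

Lemma intcombP (J : 'I_n -> Prop) mu : intcomb (simple_root_in alpha J) mu <->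
  exists k, (forall j, ~ J j -> k j = 0) /\ mu = wtk k.
Proof.
split=> [[s [hs_ ->]]|[k [kJ ->]]].
  elim: s hs_ => [|p s IH] hs_.
    by exists (fun _ => 0); rewrite big_nil wtk0.
  have [|k [kJ ek]] := IH; first by move=> q qs; apply: hs_; rewrite inE qs orbT.
  have [i Ji ei] := hs_ p (mem_head _ _).
  exists (upd k i p.1); split=> [j nJ|].
    rewrite /upd kJ // add0r; case: eqVneq => [ji|]; last by rewrite mulr0n.
    by rewrite ji in nJ.
  by rewrite wtk_upd big_cons ek ei addrC scaler_int.
exists [seq (k j, alpha j) | j <- enum 'I_n & `[< J j >]]; split.
  move=> p /mapP[j]; rewrite mem_filter => /andP[/asboolP Jj _] ->.
  by exists j.
rewrite big_map big_filter big_enum_cond /= /wtk (bigID (fun j => `[< J j >])) /=.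
rewrite [X in _ + X]big1 ?addr0 => [|j /asboolPn/kJ ->]; last by rewrite mulr0z.
by apply: eq_bigr => j _; rewrite scaler_int.
Qed.

Lemma root_wtk mu x : x != 0 -> weight_vec hs br mu x ->
  exists k, mu = wtk k /\ (nonneg k \/ nonneg (fun j => - k j)).
Proof.
move=> x0 hx; have [->|m0] := eqVneq mu 0.
  by exists (fun _ => 0); rewrite wtk0; split=> //; left.
have : is_root br hs mu by split=> //; exists x.
case/(root_sign setup) => /natcombP[k [k0 _ ek]]; first by exists k; split=> //; left.
exists (fun j => - k j); rewrite wtkN -ek opprK; split=> //; right=> j.
by rewrite opprK.
Qed.

Lemma hspaceP x : x \in hspace hs -> exists c : 'I_n -> C, x = \sum_i c i *: hs i.
Proof.
move=> /memv_sumP[u hu ->].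
have /choice[c hc] : forall i, exists k, u i = k *: hs i.
  by move=> i; apply/vlineP; apply: hu.
by exists c; apply: eq_bigr => i _.
Qed.

Lemma ht_eq0 k : nonneg k -> ht k = 0 -> k = fun _ => 0.
Proof.
move=> k0 /eqP; rewrite psumr_eq0 => [/allP h|j _]; last exact: k0.
by apply/funext => j; apply/eqP/h/mem_index_enum.
Qed.

(* A root vector outside the subalgebra [P] could be moved, inside [g / P], along
   simple root strings to weight [0]; but the zero weight space lies in [P]. *)
Lemma lie_generated (P : g -> Prop) : subspace P ->
  (forall x y, P x -> P y -> P (br x y)) -> (forall i, P (e i) /\ P (f i)) ->
  forall x, P x.
Proof.
move=> sP Pbr Pef x; have [ha a2 _] := cart.
have Ph i : P (hs i).
  by have [Pe Pf] := Pef i; have := Pbr _ _ Pe Pf; rewrite (br_ef setup) eqxx.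
have P0 : P 0 by case: sP.
have Pz w : weight_vec hs br 0 w -> P w.
  move=> hw; have /hspaceP[c ->] : w \in hspace hs.
    by apply: (centralizer_hs setup) => i; rewrite hw mxE scale0r.
  by apply: subspace_sum => // i _; apply: subspaceZ.
have str i mu w : ~ P w -> weight_vec hs br mu w ->
  exists z : int, mu 0 i = z%:~R /\ forall t : int, 0 <= t <= z \/ z <= t <= 0 ->
    exists w', weight_vec hs br (mu - alpha i *~ t) w' /\ ~ P w'.
  have [Pe Pf] := Pef i.
  apply: (wt_string_mod setup (br_lie_module setup (fun _ => True))) => //.
  - by move=> u; apply: Pbr.
  - by move=> u; apply: Pbr.
  - by move=> u; have [N hN] := ad_nilp_e setup i u; exists N; rewrite hN.
  - by move=> u; have [N hN] := ad_nilp_f setup i u; exists N; rewrite hN.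
(* The Boolean [s] is the sign of the root, so that both halves share one induction on the
   height. *)
have pos (s : bool) (m : nat) : forall k w, nonneg k -> ht k = m ->
    weight_vec hs br (if s then wtk k else - wtk k) w -> P w.
  elim: m => [|m IH] k w k0 hk hw.
    apply: Pz; move: hw; rewrite (ht_eq0 k0 hk) wtk0 oppr0.
    by case: s.
  apply: contrapT => nP.
  have [|i [ki si]] := finite_type_pos fin k0.
    apply: contrapT => hn; have : ht k = 0; last by rewrite hk.
    by apply: big1 => j _; apply/eqP/negPn/negP => kj; apply: hn; exists j.
  have [z [hz hstr]] := str i _ w nP hw.
  have ez : z = (if s then 1 else -1) * \sum_j a i j * k j.
    apply: (@intr_inj C); rewrite -hz; destruct s.
      by rewrite wtk_coord mul1r.
    by rewrite mxE wtk_coord mulN1r rmorphN.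
  have [|w' [hw' nP']] := hstr (if s then 1 else -1).
    by rewrite ez; destruct s; lia.
  apply: nP'; apply: (IH (upd k i (-1)) w').
  - by move=> j; rewrite /upd; have := k0 j; case: eqVneq => [->|]; lia.
  - by rewrite ht_upd hk; lia.
  move: hw'; rewrite wtk_upd mulrN1z; destruct s => //.
  by rewrite mulrN1z opprK opprB addrC.
apply: (weight_span_ind sP _ (root_decomposition setup x)) => mu w _ hw.
have [->|w0] := eqVneq w 0; first by [].
have [k [ek [k0|k0]]] := root_wtk w0 hw.
  apply: (pos true `|ht k|%N k) => //; last by rewrite -ek.
  by rewrite gez0_abs // sumr_ge0.
apply: (pos false `|ht (fun j => - k j)|%N (fun j => - k j)) => //.
  by rewrite gez0_abs // sumr_ge0.
by rewrite wtkN opprK -ek.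
Qed.

Section HighestWeight.
Variables (V : lmodType C) (act : g -> V -> V) (S : g -> Prop) (J : 'I_n -> Prop).
Hypothesis Hm : lie_module br act S.
Hypothesis Sh : forall i, S (hs i).
Hypothesis Se : forall i, J i -> S (e i).
Hypothesis Sf : forall i, J i -> S (f i).

(** This is [U(n^-_J) v0], written as the intersection of all subspaces that contain [v0] and are
    stable under the [f_j], so that induction on words in the [f_j] is plain application. *)
Definition fspan (v0 : V) (u : V) : Prop :=
  forall P, subspace P -> P v0 -> (forall j u, J j -> P u -> P (act (f j) u)) -> P u.

Lemma fspan_subspace v0 : subspace (fspan v0).
Proof.
split=> [P [] //|b u w hu hw P sP Pv Pf].
by have [_ lin] := sP; apply: lin; [exact: hu | exact: hw].
Qed.

Lemma fspan_v0 v0 : fspan v0 v0.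
Proof. by move=> P. Qed.

Lemma fspan_f v0 j u : J j -> fspan v0 u -> fspan v0 (act (f j) u).
Proof. by move=> Jj hu P sP Pv Pf; exact: (Pf _ _ Jj (hu P sP Pv Pf)). Qed.

(** Moving [h_i] or [e_i] past [f_j] leaves a multiple of [f_j u] or of [h_i u], so membership of
    [u], of the [h_i u] and of the [e_i u] is carried through a single induction. *)
Lemma fspan_he v0 nu0 u : weight_vec hs act nu0 v0 ->
  (forall j, J j -> act (e j) v0 = 0) -> fspan v0 u ->
  (forall i, fspan v0 (act (hs i) u)) /\ (forall i, J i -> fspan v0 (act (e i) u)).
Proof.
move=> hv ev hu; have sF := fspan_subspace v0.
pose P w := fspan v0 w /\
  ((forall i, fspan v0 (act (hs i) w)) /\ (forall i, J i -> fspan v0 (act (e i) w))).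
suff [] : P u by [].
apply: hu => {u}.
- have F0 := subspace_mem0 sF.
  split; first by split=> //; split=> i *; rewrite (linop0 (act_linop Hm _)).
  move=> b u w [u1 [u2 u3]] [w1 [w2 w3]]; split; first exact: (subspace_lin b sF u1 w1).
  by split=> i *; rewrite (act_linop Hm); apply: (subspace_lin _ sF); auto.
- split; first exact: fspan_v0.
  split=> i; first by rewrite hv; apply: (subspaceZ _ sF); apply: fspan_v0.
  by move=> Ji; rewrite ev //; apply: (subspace_mem0 sF).
move=> j u Jj [u1 [u2 u3]]; split; first exact: fspan_f.
split=> i.
  rewrite (act_br Hm _ (Sh i) (Sf Jj)) (root_f setup) (actZl Hm).
  by apply: (subspaceD sF); [apply: (subspaceZ _ sF) |]; apply: fspan_f.
move=> Ji; rewrite (act_br Hm _ (Se Ji) (Sf Jj)) (br_ef setup).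
apply: (subspaceD sF); last by apply: (fspan_f Jj); apply: u3.
by case: ifP => _ //; rewrite (act0l Hm); apply: (subspace_mem0 sF).
Qed.

Lemma fspan_weight v0 nu0 u : weight_vec hs act nu0 v0 -> fspan v0 u ->
  weight_span hs act
    (fun mu => exists k, [/\ nonneg k, (forall j, ~ J j -> k j = 0) & mu = nu0 - wtk k]) u.
Proof.
move=> hv; apply.
- by apply: weight_span_subspace => i; apply: act_linop Hm _.
- apply: (weight_span1 hv); exists (fun _ => 0).
  by rewrite wtk0 subr0.
move=> j w Jj [s [hs_ ->]].
rewrite (linop_sum _ _ (act_linop Hm _)).
apply: subspace_sum.
  by apply: weight_span_subspace => i; apply: act_linop Hm _.
move=> p /hs_[hp [k [k0 kJ ek]]].
apply: (weight_span1 (weight_act Hm Sh (Sf Jj) (root_f setup j) hp)).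
exists (upd k j 1); split=> [l|l nJ|].
- by rewrite /upd; have := k0 l; case: eqP; lia.
- rewrite /upd kJ // add0r; case: eqVneq => [lj|]; last by rewrite mulr0n.
  by rewrite lj in nJ.
by rewrite wtk_upd mulr1z opprD addrA ek.
Qed.

End HighestWeight.

Section StringClosed.
Variables (V : lmodType C) (act : g -> V -> V) (S : g -> Prop) (J : 'I_n -> Prop).
Hypothesis Hm : lie_module br act S.
Hypothesis Sh : forall i, S (hs i).
Hypothesis Se : forall i, J i -> S (e i).
Hypothesis Sf : forall i, J i -> S (f i).

(** [e_i] lowers the coordinate [k_i] by one while weights of the module have nonnegative
    coordinates; [k_i + 1] applications therefore give 0. *)
Lemma e_nilp_cone v0 nu0 : weight_vec hs act nu0 v0 -> (forall u, fspan act J v0 u) ->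
  forall i, J i -> forall u, exists N, iter N (act (e i)) u = 0.
Proof.
move=> hv hF i Ji u.
have sp u' := fspan_weight Hm Sh Sf hv (hF u').
apply: (weight_span_ind (Q := fun u => exists N, iter N (act (e i)) u = 0) _ _ (sp u)).
  apply: (nilp_subspace (Q := fun u => u = 0)) (subspace0 V) (act_linop Hm _) _.
  by move=> w ->; rewrite (linop0 (act_linop Hm _)).
move=> mu w [k [k0 kJ ->]] hw; pose N := absz (k i + 1); exists N.
apply: (weight_span_notin (fun j => act_linop Hm (hs j)) (sp _)
  (weight_iter_act Hm Sh N (Se Ji) (root_e setup i) hw)).
move=> [k' [k0' _ ek]].
have : wtk (upd k i (- N%:Z)) = wtk k'.
  rewrite wtk_upd mulrNz -pmulrn; apply: oppr_inj.
  by rewrite opprB; apply: (addrI nu0); rewrite -ek addrAC addrA.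
move=> /wtk_inj/(congr1 (fun F => F i)) /=; have := k0' i; rewrite /upd eqxx.
by have := k0 i; rewrite /N; lia.
Qed.

Lemma wt_string_closed (lam : wght) (lamJ : 'I_n -> int) :
  (forall i, J i -> lam 0 i = (lamJ i)%:~R) ->
  (forall i, J i -> forall u, exists N, iter N (act (e i)) u = 0) ->
  (forall i, J i -> forall u, exists N, iter N (act (f i)) u = 0) ->
  string_closed a J lamJ (fun k => wt hs act (lam - wtk k)).
Proof.
move=> hl ne nf k i t wk Ji ht.
have [z [hz hstr]] := wt_string setup Hm Sh (Se Ji) (Sf Ji) (ne i Ji) (nf i Ji) wk.
have ez : z = hpair a lamJ k i.
  apply: (@intr_inj C); rewrite -hz mxE [X in _ + X]mxE wtk_coord hl //.
  by rewrite /hpair rmorphB.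
rewrite wtk_upd opprD addrA; apply: hstr.
by rewrite ez.
Qed.

End StringClosed.

Section VermaQuotient.
Variables (V : lmodType C) (act : g -> V -> V) (lam : wght) (v : V).
Hypothesis vq : verma_quotient br hs e act lam v.

Lemma verma_module : lie_module br act (fun _ => True).
Proof. by case: vq. Qed.

Lemma submodule_subspace Q : submodule act Q -> subspace Q.
Proof. by case. Qed.

(** The elements of [g] that preserve the span form a Lie subalgebra containing all [e_i] and [f_i],
    hence all of [g]; the span is then a submodule containing the generator. *)
Lemma verma_fspan u : fspan act (fun _ => True) v u.
Proof.
have Hm := verma_module; case: vq => _ v0 [hv ev] gen.
have sF := fspan_subspace act (fun _ => True) v.
apply: gen; last exact: fspan_v0.
split; [by case: sF | by case: sF |].
apply: lie_generated.
- split=> [w _|b x y hx hy w hw]; first by rewrite (act0l Hm); apply: (subspace_mem0 sF).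
  by rewrite (act_linl Hm); apply: (subspace_lin _ sF); auto.
- move=> x y hx hy w hw; have := act_br Hm w (x := x) (y := y) I I.
  move=> /eqP; rewrite -subr_eq => /eqP <-.
  by apply: (subspaceB sF); auto.
move=> i; split=> w hw; last exact: fspan_f.
have [_] := fspan_he (J := fun _ => True) Hm (fun _ => I) (fun _ _ => I) (fun _ _ => I) hv (fun j _ => ev j) hw.
exact.
Qed.

Lemma verma_weight_span u :
  weight_span hs act (fun mu => exists k, nonneg k /\ mu = lam - wtk k) u.
Proof.
case: vq => Hm v0 [hv ev] gen.
have := fspan_weight (S := fun _ => True) Hm (fun _ => I) (fun _ _ => I) hv (verma_fspan u).
by apply: weight_span_mono => mu [k [? _ ?]]; exists k.
Qed.

Lemma verma_wt mu : wt hs act mu -> exists k, nonneg k /\ mu = lam - wtk k.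
Proof.
exact: (wt_weight_span (Om := fun mu => exists k, nonneg k /\ mu = lam - wtk k)
  (fun i => act_linop verma_module _) verma_weight_span).
Qed.

Lemma verma_e_nilp i u : exists N, iter N (act (e i)) u = 0.
Proof.
case: vq => Hm v0 [hv ev] gen.
exact: (e_nilp_cone (S := fun _ => True) (J := fun _ => True) Hm (fun _ => I)
  (fun _ _ => I) (fun _ _ => I) hv verma_fspan).
Qed.

(* Moving [f i] across [x] costs at most the nilpotency order of [ad (f i)] on [x]. *)
Lemma submodule_f_torsion (Q : V -> Prop) i : submodule act Q ->
  submodule act (fun u => exists N, Q (iter N (act (f i)) u)).
Proof.
have Hm := verma_module; move=> mQ; have sQ := submodule_subspace mQ.
have Qact x u : Q u -> Q (act x u) by case: mQ => _ _; apply.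
have [s0 s1] := nilp_subspace sQ (act_linop Hm (f i)) (Qact (f i)).
split=> // x u [N QN].
(* With [f = f_i], [f^(N+p) x u = f^(N+p-1) [f, x] u + f^(N+p-1) x (f u)]: the first term lowers
   [p], the second lowers [N]. *)
have key p : forall x, iter p (br (f i)) x = 0 -> forall N u,
    Q (iter N (act (f i)) u) -> Q (iter (N + p) (act (f i)) (act x u)).
  elim: p => [|p IHp] {QN}x.
    move=> /= -> N' u' _; rewrite (act0l Hm).
    by apply: stable_iter (Qact (f i)) _; case: sQ.
  move=> hx; elim=> [|N' IHN] u' QN.
    by apply: stable_iter (Qact (f i)) _; apply: Qact.
  rewrite addSn iterSr (act_br Hm _ I I) (linopD _ _ (linop_iter _ (act_linop Hm _))).
  apply: subspaceD => //; last by apply: IHN; rewrite -iterSr.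
  by rewrite -addSnnS; apply: IHp => //; rewrite -iterSr.
have [p hp] := ad_nilp_f setup i x.
by exists (N + p)%N; apply: key.
Qed.

(** The vectors killed by a power of [f_i] form a submodule, and for [i] in [J] it contains the
    generator. *)
Lemma verma_f_nilp i u : J_of f act lam v i -> exists N, iter N (act (f i)) u = 0.
Proof.
have Hm := verma_module; case: (vq) => _ v0 [hv ev] gen [k [_ hk]].
have m0 : submodule act (fun u => u = 0).
  have [s0 s1] := subspace0 V; split=> // x w ->.
  by rewrite (linop0 (act_linop Hm _)).
by apply: (gen _ (submodule_f_torsion i m0)); exists k.+1.
Qed.

End VermaQuotient.

End RootLattice.

(** * Nonzero monomials by way of torsion submodules *)

Section MonomialWeights.
Variables (R : realType) (n : nat) (g : vectType (complex R)).
Local Notation C := (complex R).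
Local Notation wght := 'rV[C]_n.
Variables (br : g -> g -> g) (hs e f : 'I_n -> g) (alpha : 'I_n -> wght).
Hypothesis setup : chevalley_setup br hs e f alpha.
Variables (V : lmodType C) (act : g -> V -> V) (lam : wght) (v : V).
Hypothesis vq : verma_quotient br hs e act lam v.

Definition fmon (act' : g -> V -> V) (l : seq 'I_n) (k : 'I_n -> int) (u : V) : V :=
  foldr (fun i u => iter (absz (k i)) (act' (f i)) u) u l.

Lemma fmon_weight l k : nonneg k ->
  weight_vec hs act (lam - \sum_(i <- l) alpha i *~ k i) (fmon act l k v).
Proof.
have Hm := verma_module vq; case: vq => _ _ [hv _] _ k0; elim: l => [|i l IH] /=.
  by rewrite big_nil subr0.
have := weight_iter_act Hm (fun _ => I) (absz (k i)) I (root_f setup i) IH.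
by rewrite big_cons opprD [- _ + _]addrC addrA mulNrn pmulrn gez0_abs.
Qed.

Lemma fmon_wt l k : nonneg k -> \sum_(i <- l) alpha i *~ k i = wtk alpha k ->
  fmon act l k v != 0 -> wt hs act (lam - wtk alpha k).
Proof. by move=> k0 <- nz; exists (fmon act l k v); split=> //; apply: fmon_weight. Qed.

(** No factor [(k+1)(lam(h_i) - k)] vanishes when [lam(h_i)] is not a natural number. *)
Lemma hw_notin_f_torsion Q i : submodule act Q -> ~ Q v -> ~ J_lambda lam i ->
  ~ (exists N, Q (iter N (act (f i)) v)).
Proof.
have Hm := verma_module vq; case: vq => _ _ [hv ev] _ mQ nQ nJ [N QN].
have sQ := submodule_subspace mQ; have [_ _ Qact] := mQ.
apply: (sl2_iter_f_notin (sl2_act setup Hm (fun _ => I) I I) sQ (Qact _) (Qact _) nQ _ (hv i)) QN.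
  by rewrite ev; apply: subspace_mem0.
by move=> j _; apply/eqP => hj; apply: nJ; exists j.
Qed.

(** Stripping the outermost power of [f_i] replaces [Q] by its [f_i]-torsion submodule, which still
    misses [v]; hence the induction on [l] treats all submodules [Q] at once. *)
Lemma fmon_notin l k : forall Q, submodule act Q -> ~ Q v ->
  (forall i, i \in l -> ~ J_lambda lam i) -> ~ Q (fmon act l k v).
Proof.
elim: l => [//|i l IH] Q mQ nQ hl /= Ql.
apply: (IH _ (submodule_f_torsion setup vq i mQ)).
- by apply: hw_notin_f_torsion => //; apply: hl; rewrite mem_head.
- by move=> j jl; apply: hl; rewrite inE jl orbT.
by exists (absz (k i)).
Qed.

(** For [lam(h_i) = k], the vector [f_i^(k+1) v] is nonzero and again killed by [e_i]. Its
    eigenvalue [-k-2] is not a natural number, so no further power of [f_i] kills it. *)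
Lemma f_iter_neq0 i N : J_lambda lam i -> ~ J_of f act lam v i -> iter N (act (f i)) v != 0.
Proof.
have Hm := verma_module vq; case: vq => _ v0 [hv ev] _ [k hk] nJ; apply/eqP => hN.
have sl := sl2_act setup Hm (fun _ => I) (i := i) I I.
have st x u : u = 0 -> act x u = 0 by move=> ->; rewrite (linop0 (act_linop Hm _)).
have s0 := subspace0 V.
pose w := iter k.+1 (act (f i)) v.
have w0 : w <> 0 by move=> w0; apply: nJ; exists k.
have hw : act (hs i) w = (lam 0 i - (2 * k.+1)%:R) *: w by apply: (sl2_h_iter_f sl _ (hv i)).
have ew : act (e i) w = 0.
  have := sl2_e_iter_f (Q := fun u => u = 0) sl (st _) k (ev i) (hv i).
  by rewrite hk subrr mulr0 scale0r subr0.
apply: (sl2_iter_f_notin sl s0 (st _) (st _) w0 ew hw (k := N)).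
  move=> j _; apply/eqP => /eqP; rewrite hk subr_eq -natrD eqr_nat => /eqP.
  by lia.
by rewrite /w -iterD addnC iterD hN; apply: (stable_iter (Q := fun u => u = 0)) => //; apply: st.
Qed.

Lemma sum_filter_wtk (P : pred 'I_n) k : (forall i, ~~ P i -> k i = 0) ->
  \sum_(i <- enum P) alpha i *~ k i = wtk alpha k.
Proof.
move=> hk; rewrite /wtk big_enum /= [RHS](bigID P) /=.
by rewrite [X in _ = _ + X]big1 ?addr0 // => i /hk ->; rewrite mulr0z.
Qed.

(* [f i] for the one possible [i] in [J_lambda \ J] is applied last: the vector
   reached by the other letters avoids the [f i]-torsion submodule. *)
Lemma wt_off_J_le1 k :
  (forall i j, J_lambda lam i -> ~ J_of f act lam v i ->
               J_lambda lam j -> ~ J_of f act lam v j -> i = j) ->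
  nonneg k -> (forall j, J_of f act lam v j -> k j = 0) ->
  wt hs act (lam - wtk alpha k).
Proof.
have Hm := verma_module vq; move=> le1 k0 kJ.
have m0 : submodule act (fun u => u = 0).
  have [s0 s1] := subspace0 V; split=> // x w ->.
  by rewrite (linop0 (act_linop Hm _)).
have v0 : v <> 0 by case: vq => _ /eqP.
have [[i0 [Ji0 nJi0]]|hn] := pselect (exists i, J_lambda lam i /\ ~ J_of f act lam v i).
  pose P := [pred i | `[< ~ J_lambda lam i >]].
  apply: (@fmon_wt (i0 :: enum P)) => //.
    rewrite big_cons -(sum_filter_wtk (P := [predU1 i0 & P])); last first.
      move=> i; rewrite !inE negb_or => /andP[ii0 /asboolPn/contrapT Ji].
      apply: kJ; apply: contrapT => nJi; move: ii0; rewrite (le1 i i0) //.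
      by rewrite eqxx.
    rewrite !big_enum [RHS](bigD1 i0) /=; last by rewrite !inE eqxx.
    congr (_ + _); apply: eq_bigl => i; rewrite !inE.
    case: eqVneq => [->|_]; rewrite ?andbF ?andbT //.
    by apply/negbTE/asboolPn; apply.
  apply/eqP => hz.
  apply: (@fmon_notin (enum P) k _ (submodule_f_torsion setup vq i0 m0)).
  - by move=> [N /eqP]; rewrite (negPf (f_iter_neq0 N Ji0 nJi0)).
  - by move=> i; rewrite mem_enum => /asboolP.
  by exists (absz (k i0)).
pose P := [pred i | `[< ~ J_lambda lam i >]].
apply: (@fmon_wt (enum P)) => //.
  apply: sum_filter_wtk => i; rewrite inE => /asboolPn/contrapT Ji.
  by apply: kJ; apply: contrapT => nJi; apply: hn; exists i.
apply/eqP; apply: (@fmon_notin (enum P) k _ m0 v0).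
by move=> i; rewrite mem_enum => /asboolP.
Qed.

End MonomialWeights.

(** * Triangular decomposition from Chevalley generators; bracket laws are assumed on [good]
    elements *)

Section Triangular.
Variables (F0 : fieldType) (K : lmodType F0) (kb : K -> K -> K) (good : K -> Prop).
Hypothesis good_sub : subspace good.
Hypothesis good_kb : forall x y, good x -> good y -> good (kb x y).
Hypothesis kb_anti : forall x y, kb x y = - kb y x.
Hypothesis kb_linr : forall x, good x -> linop (kb x).
Hypothesis kb_jac : forall x y z, good x -> good y -> good z ->
  kb x (kb y z) = kb (kb x y) z + kb y (kb x z).
Variables (n : nat) (E F H : 'I_n -> K) (s : 'I_n -> 'I_n -> F0).
Hypothesis gE : forall i, good (E i).
Hypothesis gF : forall i, good (F i).
Hypothesis gH : forall i, good (H i).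
Hypothesis HE : forall i j, kb (H i) (E j) = s i j *: E j.
Hypothesis HF : forall i j, kb (H i) (F j) = - s i j *: F j.
Hypothesis EF : forall i j, kb (E i) (F j) = if i == j then H i else 0.

Definition lie_closed (P : K -> Prop) : Prop :=
  subspace P /\ forall x y, P x -> P y -> P (kb x y).

Definition lie_gen (G : K -> Prop) (x : K) : Prop :=
  forall P, lie_closed P -> (forall y, G y -> P y) -> P x.

Lemma lie_gen_closed G : lie_closed (lie_gen G).
Proof.
split; first split=> [P [[]] //|c x y hx hy P cP GP].
  by apply: subspace_lin (hx P cP GP) (hy P cP GP); case: cP.
by move=> x y hx hy P cP GP; have [_ hP] := cP; apply: (hP _ _ (hx P cP GP) (hy P cP GP)).
Qed.

Lemma lie_gen_sub G : subspace (lie_gen G).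
Proof. by case: (lie_gen_closed G). Qed.

Lemma lie_gen_kb G x y : lie_gen G x -> lie_gen G y -> lie_gen G (kb x y).
Proof. by case: (lie_gen_closed G) => _; apply. Qed.

Lemma lie_gen_in (G : K -> Prop) x : G x -> lie_gen G x.
Proof. by move=> Gx P _; apply. Qed.

Lemma lie_gen_good G x : (forall y, G y -> good y) -> lie_gen G x -> good x.
Proof. by move=> Gg hx; apply: (hx good). Qed.

Lemma kb_linl x : good x -> linop (kb^~ x).
Proof.
by move=> gx c y z; rewrite /= kb_anti kb_linr // (kb_anti y) (kb_anti z) opprD scalerN.
Qed.

(** [ad D] is a derivation, so its values on generators govern the rest. The summand [N] survives
    linear combinations but not brackets, because [N] normalizes the subalgebra. For [D = e_i] and
    [G] the set of the [f_j], [N] is the Cartan part. *)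
Lemma ad_lie_gen (G N : K -> Prop) D : good D -> subspace N ->
  (forall y, G y -> good y) -> (forall y, N y -> good y) ->
  (forall x y, lie_gen G x -> N y -> lie_gen G (kb x y)) ->
  (forall y, G y -> exists p q, [/\ lie_gen G p, N q & kb D y = p + q]) ->
  forall x, lie_gen G x -> exists p q, [/\ lie_gen G p, N q & kb D x = p + q].
Proof.
move=> gD sN Gg Ng GN hG x hx.
pose P x := lie_gen G x /\ exists p q, [/\ lie_gen G p, N q & kb D x = p + q].
have sG := lie_gen_sub G.
suff [] : P x by [].
apply: hx => [|y Gy]; last by split; [exact: lie_gen_in | exact: hG].
split; first split.
- split; first exact: (subspace_mem0 sG).
  exists 0, 0; rewrite (linop0 (kb_linr gD)) addr0.
  by split=> //; [exact: (subspace_mem0 sG) | exact: (subspace_mem0 sN)].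
- move=> c u w [u1 [p [q [hp hq e1]]]] [w1 [p' [q' [hp' hq' e2]]]].
  split; first exact: (subspace_lin c sG u1 w1).
  exists (c *: p + p'), (c *: q + q'); split.
  + exact: (subspace_lin c sG hp hp').
  + exact: (subspace_lin c sN hq hq').
  by rewrite kb_linr // e1 e2 scalerDr addrACA.
move=> u w [u1 [p [q [hp hq e1]]]] [w1 [p' [q' [hp' hq' e2]]]].
split; first exact: lie_gen_kb.
have gu := lie_gen_good Gg u1; have gw := lie_gen_good Gg w1.
exists (kb (kb D u) w + kb u (kb D w)), 0; split; last by rewrite addr0 kb_jac.
  rewrite e1 e2 (linopD _ _ (kb_linl gw)) (linopD _ _ (kb_linr gu)) (kb_anti q).
  have gk := @lie_gen_kb G.
  by do !apply: (subspaceD sG); rewrite -?scaleN1r; auto; apply: (subspaceZ _ sG); auto.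
exact: subspace_mem0.
Qed.

Definition spanH (x : K) : Prop := exists c : 'I_n -> F0, x = \sum_i c i *: H i.

Lemma spanH_sub : subspace spanH.
Proof.
split; first by exists (fun _ => 0); rewrite big1 // => i _; rewrite scale0r.
move=> c x y [p ->] [q ->]; exists (fun i => c * p i + q i).
rewrite scaler_sumr -big_split; apply: eq_bigr => i _.
by rewrite scalerDl scalerA.
Qed.

Lemma spanH_H i : spanH (H i).
Proof.
exists (fun j => (j == i)%:R); rewrite (bigD1 i) //= eqxx scale1r big1 ?addr0 // => j /negPf ->.
by rewrite scale0r.
Qed.

Lemma spanH_good x : spanH x -> good x.
Proof. by case=> c ->; apply: subspace_sum => // i _; apply: subspaceZ. Qed.

Definition gensE (x : K) : Prop := exists i, x = E i.
Definition gensF (x : K) : Prop := exists i, x = F i.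
Definition gensEF (x : K) : Prop := gensE x \/ gensF x.

Lemma gensE_good y : gensE y -> good y. Proof. by case=> i ->. Qed.
Lemma gensF_good y : gensF y -> good y. Proof. by case=> i ->. Qed.

Lemma ad_H_gen (G : K -> Prop) i : (forall y, G y -> good y) ->
  (forall y, G y -> exists c, kb (H i) y = c *: y) ->
  forall x, lie_gen G x -> lie_gen G (kb (H i) x).
Proof.
move=> Gg hG x hx.
have [|||p [q [hp -> ->]]] := @ad_lie_gen G (fun y => y = 0) (H i) (gH i) (subspace0 K) Gg _ _ _ x hx.
- by move=> y ->; case: good_sub.
- move=> {hx}x y hx ->; rewrite (linop0 (kb_linr (lie_gen_good Gg hx))).
  exact: (subspace_mem0 (lie_gen_sub G)).
- move=> y Gy; have [c ->] := hG y Gy; exists (c *: y), 0; rewrite addr0; split=> //.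
  by apply: (subspaceZ _ (lie_gen_sub G)); apply: lie_gen_in.
by rewrite addr0.
Qed.

Lemma kb_gen_spanH (G : K -> Prop) : (forall y, G y -> good y) ->
  (forall i y, G y -> exists c, kb (H i) y = c *: y) ->
  forall x y, lie_gen G x -> spanH y -> lie_gen G (kb x y).
Proof.
move=> Gg hG x _ hx [c ->]; have sG := lie_gen_sub G.
rewrite (linop_sum _ _ (kb_linr (lie_gen_good Gg hx))); apply: subspace_sum => // i _.
rewrite (linopZ _ _ (kb_linr (lie_gen_good Gg hx))) kb_anti; apply: (subspaceZ _ sG).
by apply: (subspaceN sG); apply: ad_H_gen => // y Gy; apply: hG.
Qed.

Lemma gensE_H i y : gensE y -> exists c, kb (H i) y = c *: y.
Proof. by case=> j ->; exists (s i j). Qed.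

Lemma gensF_H i y : gensF y -> exists c, kb (H i) y = c *: y.
Proof. by case=> j ->; exists (- s i j). Qed.

Definition tri (x : K) : Prop := exists p q r,
  [/\ lie_gen gensF p, spanH q, lie_gen gensE r & x = p + q + r].

Lemma tri_sub : subspace tri.
Proof.
have sE := lie_gen_sub gensE; have sF := lie_gen_sub gensF; have sH := spanH_sub.
split.
  exists 0, 0, 0; rewrite !addr0; split=> //; exact: subspace_mem0.
move=> c _ _ [p [q [r [hp hq hr ->]]]] [p' [q' [r' [hp' hq' hr' ->]]]].
exists (c *: p + p'), (c *: q + q'), (c *: r + r'); split.
- exact: (subspace_lin c sF hp hp').
- exact: (subspace_lin c sH hq hq').
- exact: (subspace_lin c sE hr hr').
by rewrite !scalerDr addrACA; congr (_ + _); rewrite addrACA.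
Qed.

Lemma tri_F p : lie_gen gensF p -> tri p.
Proof.
move=> hp; exists p, 0, 0; rewrite !addr0; split=> //; apply: subspace_mem0.
  exact: spanH_sub.
exact: lie_gen_sub.
Qed.

Lemma tri_E p : lie_gen gensE p -> tri p.
Proof.
move=> hp; exists 0, 0, p; rewrite !add0r; split=> //; apply: subspace_mem0.
  exact: lie_gen_sub.
exact: spanH_sub.
Qed.

Lemma tri_H p : spanH p -> tri p.
Proof.
by move=> hp; exists 0, p, 0; rewrite add0r addr0; split=> //; apply: subspace_mem0; apply: lie_gen_sub.
Qed.

Lemma tri_good x : tri x -> good x.
Proof.
move=> [p [q [r [hp hq hr ->]]]].
have := lie_gen_good gensF_good hp; have := lie_gen_good gensE_good hr; have := spanH_good hq.
by move=> ? ? ?; do !apply: subspaceD.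
Qed.

Lemma ad_E_tri i x : tri x -> tri (kb (E i) x).
Proof.
move=> [p [q [r [hp hq hr ->]]]]; have sT := tri_sub.
rewrite !(linopD _ _ (kb_linr (gE i))); do !apply: (subspaceD sT).
- have [|p' [q' [hp' hq' ->]]] := ad_lie_gen (gE i) spanH_sub gensF_good spanH_good
    (kb_gen_spanH gensF_good gensF_H) _ hp.
    move=> _ [j ->]; exists 0, (kb (E i) (F j)); rewrite add0r; split=> //.
      exact: (subspace_mem0 (lie_gen_sub gensF)).
    by rewrite EF; case: ifP => _; [exact: spanH_H | exact: (subspace_mem0 spanH_sub)].
  by apply: (subspaceD sT); [exact: tri_F | exact: tri_H].
- apply: tri_E; apply: (kb_gen_spanH gensE_good gensE_H _ hq).
  by apply: lie_gen_in; exists i.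
by apply: tri_E; apply: lie_gen_kb => //; apply: lie_gen_in; exists i.
Qed.

Lemma ad_F_tri i x : tri x -> tri (kb (F i) x).
Proof.
move=> [p [q [r [hp hq hr ->]]]]; have sT := tri_sub.
rewrite !(linopD _ _ (kb_linr (gF i))); do !apply: (subspaceD sT).
- by apply: tri_F; apply: lie_gen_kb => //; apply: lie_gen_in; exists i.
- apply: tri_F; apply: (kb_gen_spanH gensF_good gensF_H _ hq).
  by apply: lie_gen_in; exists i.
have [|p' [q' [hp' hq' ->]]] := ad_lie_gen (gF i) spanH_sub gensE_good spanH_good
    (kb_gen_spanH gensE_good gensE_H) _ hr.
  move=> _ [j ->]; exists 0, (kb (F i) (E j)); rewrite add0r; split=> //.
    exact: (subspace_mem0 (lie_gen_sub gensE)).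
  rewrite kb_anti EF; apply: (subspaceN spanH_sub).
  by case: ifP => _; [exact: spanH_H | exact: (subspace_mem0 spanH_sub)].
by apply: (subspaceD sT); [exact: tri_E | exact: tri_H].
Qed.

(** The elements [y] whose [ad y] preserves [tri] form a Lie subalgebra containing the generators;
    hence the generated elements that lie in [tri] are closed under brackets. *)
Lemma triangular x : lie_gen gensEF x -> tri x.
Proof.
move=> hx; have sT := tri_sub.
have gEF y : gensEF y -> good y by case; [exact: gensE_good | exact: gensF_good].
have adT y : lie_gen gensEF y -> forall x, tri x -> tri (kb y x).
  move=> hy; have gy := lie_gen_good gEF hy.
  suff [] : good y /\ forall x, tri x -> tri (kb y x) by [].
  apply: (hy (fun y => good y /\ forall x, tri x -> tri (kb y x))).
    split; first split.
    - split; first by case: good_sub.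
      move=> z tz; rewrite (linop0 (kb_linl (tri_good tz))).
      exact: (subspace_mem0 sT).
    - move=> c u w [gu hu] [gw hw]; split; first exact: subspace_lin.
      move=> z tz; rewrite (kb_linl (tri_good tz)); apply: (subspace_lin c sT); auto.
    move=> u w [gu hu] [gw hw]; split; first exact: good_kb.
    move=> z tz; have := kb_jac gu gw (tri_good tz) => /eqP; rewrite -subr_eq => /eqP <-.
    by apply: (subspaceB sT); auto.
  move=> z; case=> [[i ->]|[i ->]]; split=> //; [exact: ad_E_tri | exact: ad_F_tri].
suff [] : lie_gen gensEF x /\ tri x by [].
apply: (hx (fun x => lie_gen gensEF x /\ tri x)).
  split; first split.
  - by split; [exact: (subspace_mem0 (lie_gen_sub gensEF)) | exact: subspace_mem0].
  - move=> c u w [u1 u2] [w1 w2].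
    by split; [exact: (subspace_lin c (lie_gen_sub gensEF)) | exact: subspace_lin].
  by move=> u w [u1 u2] [w1 w2]; split; [exact: lie_gen_kb | exact: adT].
move=> y Gy; split; first exact: lie_gen_in.
by case: Gy => hy; [apply: tri_E | apply: tri_F]; apply: lie_gen_in.
Qed.

End Triangular.

(** * The dual of the enveloping algebra as a module *)

Section DualEnveloping.
Variables (F : fieldType) (g : lmodType F) (br : g -> g -> g).

Definition ug_dual : {pred seq g -> F^o} := fun Psi => `[<
  (forall s t c x y, Psi (s ++ c *: x + y :: t) = c * Psi (s ++ x :: t) + Psi (s ++ y :: t)) /\
  (forall s t x y, Psi (s ++ br x y :: t) = Psi (s ++ x :: y :: t) - Psi (s ++ y :: x :: t)) >].

Lemma ug_dual_submod : submod_closed ug_dual.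
Proof.
split; first by apply/asboolP; split=> *; rewrite /= ?mulr0 ?addr0 ?subr0.
move=> c u w /asboolP[u1 u2] /asboolP[w1 w2]; apply/asboolP; split=> * /=.
  rewrite -[LHS]/(c * u _ + w _) -[X in _ = _ * X + _]/(c * u _ + w _).
  by rewrite -[X in _ = _ + X]/(c * u _ + w _) u1 w1; ring.
rewrite -[LHS]/(c * u _ + w _) -[X in _ = X - _]/(c * u _ + w _).
by rewrite -[X in _ = _ - X]/(c * u _ + w _) u2 w2; ring.
Qed.

HB.instance Definition _ := GRing.isSubmodClosed.Build F (seq g -> F^o) ug_dual ug_dual_submod.

(* The full linear dual of the enveloping algebra [U g]: functionals on words in [g]
   compatible with linearity and with the relations [x y - y x = br x y]. *)
Record ugd := Ugd { ugd_val :> seq g -> F^o; _ : ugd_val \in ug_dual }.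

HB.instance Definition _ := [isSub for ugd_val].
HB.instance Definition _ := [Choice of ugd by <:].
HB.instance Definition _ := [SubChoice_isSubLmodule of ugd by <:].

Lemma ugd_lin (w : ugd) s t c x y :
  w (s ++ c *: x + y :: t) = c * w (s ++ x :: t) + w (s ++ y :: t).
Proof. by case: w => w /= /asboolP[]. Qed.

Lemma ugd_br (w : ugd) s t x y :
  w (s ++ br x y :: t) = w (s ++ x :: y :: t) - w (s ++ y :: x :: t).
Proof. by case: w => w /= /asboolP[]. Qed.

Lemma ugd_act_subproof x (w : ugd) : (fun s => w (rcons s x)) \in ug_dual.
Proof.
by apply/asboolP; split=> *; rewrite !rcons_cat /= ?ugd_lin ?ugd_br.
Qed.

(** The transpose of right multiplication on [U g]. Acting by [y] and then by [x] evaluates at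
    [s x y], the order required of a left module. *)
Definition ugd_act x (w : ugd) : ugd := Ugd (ugd_act_subproof x w).

Lemma ugd_ext (u w : ugd) : (forall s, u s = w s) -> u = w.
Proof. by move=> h; apply: val_inj; apply/funext. Qed.

Lemma ugd_linE c (u w : ugd) s : (c *: u + w) s = c * u s + w s.
Proof. by []. Qed.

End DualEnveloping.

Lemma ugd_module (R : realType) (g : vectType (complex R)) (br : g -> g -> g) :
  lie_module br (@ugd_act _ g br) (fun _ => True).
Proof.
split=> [c x y w|x c u w|x y w _ _]; apply: ugd_ext => s //.
  by rewrite ugd_linE /= -!cats1 ugd_lin.
rewrite -[RHS]/(w (rcons (rcons s x) y) - w (rcons (rcons s y) x)) /=.
by rewrite -!cats1 ugd_br -!catA.
Qed.

Lemma comm_jacobi_add (V : zmodType) (x1 x2 x3 x4 x5 x6 : V) :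
  x1 - x2 + (x4 - x3) = x1 - x5 + (x4 - x6) + (x5 - x3 + (x6 - x2)).
Proof.
rewrite [RHS]addrACA (addrA (x1 - x5)) subrK (addrA (x4 - x6)) subrK.
rewrite [LHS]addrACA [RHS]addrACA; congr (_ + _); exact: addrC.
Qed.

Lemma sum3_eq0_isolate (V : zmodType) (p q r y z : V) : 0 = p + q + r ->
  z = - (p - (z + y)) - y - q - r.
Proof.
move=> h; by rewrite opprB (addrAC (z + y)) addrK -!addrA -!opprD addrA -h subr0.
Qed.

Section PairFun.
Variables (F : fieldType) (U V : lmodType F) (X : Type).
Implicit Types (p q : U * (X -> V)).

Lemma pair_fun_ext p q : p.1 = q.1 -> (forall x, p.2 x = q.2 x) -> p = q.
Proof. by case: p q => [x A] [y B] /= -> h; congr (_, _); apply/funext. Qed.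

Lemma pair_linE c p q : (c *: p + q).1 = c *: p.1 + q.1.
Proof. by []. Qed.

Lemma pair_addE p q : (p + q).1 = p.1 + q.1.
Proof. by []. Qed.

Lemma pair_fun_linE c p q x : (c *: p + q).2 x = c *: p.2 x + q.2 x.
Proof. by []. Qed.

Lemma pair_fun_addE p q x : (p + q).2 x = p.2 x + q.2 x.
Proof. by []. Qed.

Lemma pair_fun_oppE p x : (- p).2 x = - p.2 x.
Proof. by []. Qed.

Lemma pair_fun_scaleE c p x : (c *: p).2 x = c *: p.2 x.
Proof. by []. Qed.

Lemma pair_fun0E x : (0 : U * (X -> V)).2 x = 0.
Proof. by []. Qed.

Lemma pair_sumE (I : Type) (l : seq I) (G : I -> U * (X -> V)) :
  (\sum_(i <- l) G i).1 = \sum_(i <- l) (G i).1.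
Proof. by elim: l => [|i l IH]; rewrite ?big_nil ?big_cons // -IH. Qed.

Lemma pair_fun_sumE (I : Type) (l : seq I) (G : I -> U * (X -> V)) x :
  (\sum_(i <- l) G i).2 x = \sum_(i <- l) (G i).2 x.
Proof. by elim: l => [|i l IH]; rewrite ?big_nil ?big_cons // -IH. Qed.

End PairFun.

(** * The free Verma module, its character, and the resulting functional on [U g] *)

Section FreeVerma.
Variables (R : realType) (n : nat) (g : vectType (complex R)).
Local Notation C := (complex R).
Local Notation wght := 'rV[C]_n.
Variables (br : g -> g -> g) (hs e f : 'I_n -> g) (alpha : 'I_n -> wght).
Hypothesis setup : chevalley_setup br hs e f alpha.
Variables (a : 'M[int]_n) (d : 'I_n -> R).
Hypothesis cart : cartan_spec alpha a.
Hypothesis fin : finite_type a d.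
Variables (lam : wght) (J' : 'I_n -> Prop).

(* [T] is the (completed) tensor algebra on the letters [f i], i.e. the Verma module
   of the Lie algebra with the same Chevalley generators and no Serre relations;
   [Phi w] is the coefficient of the word [w]. *)
Local Notation T := (seq 'I_n -> C^o).

(** The value at [h_i] of the weight of the word [w]; the base value [s] is a parameter because
    removing a letter shifts it. *)
Definition cw (s : C) (i : 'I_n) (w : seq 'I_n) : C := s - \sum_(l <- w) alpha l 0 i.

Definition hh (i : 'I_n) (Phi : T) : T := fun w => cw (lam 0 i) i w * Phi w.

Definition fh (i : 'I_n) (Phi : T) : T :=
  fun w => if w is j :: w' then (i == j)%:R * Phi w' else 0.

(** By [e_i f_j = f_j e_i + delta_ij h_i], [e_i] deletes one letter [i] from a word and contributes
    the value of [h_i] on the weight of the suffix after it. Read on coefficients, this is a sum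
    over all ways to insert [i] into [w]. *)
Fixpoint ehw (i : 'I_n) (w : seq 'I_n) (Phi : T) : C :=
  if w is j :: w' then
    cw (lam 0 i) i w * Phi (i :: w) + ehw i w' (fun u => Phi (j :: u))
  else cw (lam 0 i) i [::] * Phi [:: i].

Definition eh (i : 'I_n) (Phi : T) : T := fun w => ehw i w Phi.

Definition vac : T := fun w => (nilp w)%:R.

Lemma hh_linop i : linop (hh i).
Proof.
move=> c u w; apply/funext => s; rewrite /hh.
by rewrite -[LHS]/(_ * (c * _ + _)) -[RHS]/(c * (_ * _) + _ * _); ring.
Qed.

Lemma fh_linop i : linop (fh i).
Proof.
move=> c u w; apply/funext => s; case: s => [|j s].
  by rewrite -[LHS]/(0 : C) -[RHS]/(c * 0 + 0); ring.
by rewrite -[LHS]/(_ * (c * _ + _)) -[RHS]/(c * (_ * _) + _ * _); ring.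
Qed.

Lemma ehw_lin i w c (u u' : T) : ehw i w (c *: u + u') = c * ehw i w u + ehw i w u'.
Proof.
elim: w u u' => [|j w IH] u u' /=.
  by rewrite -[X in _ * X = _]/(c * _ + _); ring.
rewrite -[(c *: u + u') _]/(c * u _ + u' _).
rewrite -[fun u0 => _]/(c *: (fun u0 => u (j :: u0)) + (fun u0 => u' (j :: u0))) IH.
by ring.
Qed.

Lemma eh_linop i : linop (eh i).
Proof. by move=> c u u'; apply/funext => w; rewrite -[RHS]/(c * _ + _) -ehw_lin. Qed.

Lemma eh_fh i j u : eh i (fh j u) = fh j (eh i u) + (i == j)%:R *: hh i u.
Proof.
apply/funext => w; rewrite -[RHS]/(fh j (eh i u) w + (i == j)%:R * hh i u w) /eh /hh.
case: w => [|l w] /=; first by rewrite (eq_sym j); ring.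
rewrite (eq_sym j i) addrC; congr (_ + _); last by ring.
rewrite -[fun u0 : seq 'I_n => _]/((j == l)%:R *: u).
by have := ehw_lin i w ((j == l)%:R) u 0; rewrite addr0 => ->; have := linop0 (eh_linop i) => /(congr1 (fun F => F w)); rewrite /eh => ->; rewrite addr0.
Qed.

Lemma hh_fh i j u : hh i (fh j u) = fh j (hh i u) - alpha j 0 i *: fh j u.
Proof.
apply/funext => w; rewrite -[RHS]/(fh j (hh i u) w - alpha j 0 i * fh j u w) /hh.
case: w => [|l w] /=; first by rewrite !mulr0 subr0.
rewrite /cw big_cons; case: eqVneq => [->|_]; last by rewrite !mul0r !mulr0 subr0.
by rewrite !mul1r; ring.
Qed.

(** Every word in the sum is [w] with one letter [j] inserted, so its weight differs from that of
    [w] by [alpha_j]. *)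
Lemma ehw_cw i j s w (u : T) :
  ehw j w (fun x => cw s i x * u x) = (cw s i w - alpha j 0 i) * ehw j w u.
Proof.
elim: w s u => [|l w IH] s u /=.
  by rewrite /cw !big_cons !big_nil; ring.
have -> : (fun u0 => cw s i (l :: u0) * u (l :: u0))
  = (fun u0 => cw (s - alpha l 0 i) i u0 * u (l :: u0)).
  by apply/funext => x; rewrite /cw big_cons; congr (_ * _); ring.
by rewrite (IH _ (fun u0 => u (l :: u0))) /cw !big_cons; ring.
Qed.

Lemma hh_eh i j u : hh i (eh j u) = eh j (hh i u) + alpha j 0 i *: eh j u.
Proof.
apply/funext => w; rewrite -[RHS]/(ehw j w (hh i u) + alpha j 0 i * ehw j w u).
by rewrite /hh /eh ehw_cw; ring.
Qed.

Lemma ehw0 i w : ehw i w 0 = 0.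
Proof. by elim: w => [|j w IH] /=; rewrite mulr0 // add0r. Qed.

Lemma eh_vac i : eh i vac = 0.
Proof.
apply/funext => -[|j w]; rewrite /eh /= /vac /= !mulr0 // add0r.
exact: ehw0.
Qed.

Lemma hh_vac i : hh i vac = lam 0 i *: vac.
Proof.
apply/funext => -[|j w]; rewrite -[RHS]/(_ * _) /hh /vac /= ?mulr0 //.
by rewrite /cw big_nil subr0.
Qed.

Local Notation K := (g * (T -> T))%type.

Definition kb (p q : K) : K := (br p.1 q.1, fun u => p.2 (q.2 u) - q.2 (p.2 u)).
Lemma kb_fun p q u : (kb p q).2 u = p.2 (q.2 u) - q.2 (p.2 u).
Proof. by []. Qed.

Definition good (p : K) : Prop := linop p.2.
Definition kE i : K := (e i, eh i).
Definition kF i : K := (f i, fh i).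
Definition kH i : K := (hs i, hh i).

Lemma good_sub : subspace good.
Proof.
split; first by move=> c u w; rewrite !pair_fun0E scaler0 addr0.
move=> c p q gp gq b u w; rewrite !pair_fun_linE.
by rewrite gp gq !scalerDr !scalerA addrACA (mulrC b).
Qed.

Lemma good_kb p q : good p -> good q -> good (kb p q).
Proof. by move=> gp gq c u w; rewrite /= !(gp, gq) scalerBr opprD addrACA. Qed.

Lemma kb_anti p q : kb p q = - kb q p.
Proof.
apply: pair_fun_ext => [|u]; first exact: (br_anti setup).
by rewrite pair_fun_oppE /= opprB.
Qed.

Lemma kb_linr p : good p -> linop (kb p).
Proof.
move=> gp c q r; apply: pair_fun_ext => [|u].
  by rewrite pair_linE -(br_linr setup).
by rewrite pair_fun_linE !kb_fun !pair_fun_linE gp scalerBr opprD addrACA.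
Qed.

Lemma kb_jac p q r : good p -> good q -> good r ->
  kb p (kb q r) = kb (kb p q) r + kb q (kb p r).
Proof.
move=> gp gq gr; apply: pair_fun_ext => [|u]; first exact: (jacobi setup).
rewrite pair_fun_addE /=.
rewrite !(linopB _ _ gp) !(linopB _ _ gq) !(linopB _ _ gr) !opprB.
exact: comm_jacobi_add.
Qed.

Lemma kHE i j : kb (kH i) (kE j) = alpha j 0 i *: kE j.
Proof.
apply: pair_fun_ext => [|u]; first exact: (root_e setup).
by rewrite pair_fun_scaleE /= hh_eh addrC addKr.
Qed.

Lemma kHF i j : kb (kH i) (kF j) = - alpha j 0 i *: kF j.
Proof.
apply: pair_fun_ext => [|u]; first by rewrite /= (root_f setup) mxE.
by rewrite pair_fun_scaleE /= hh_fh addrC addKr scaleNr.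
Qed.

Lemma kEF i j : kb (kE i) (kF j) = if i == j then kH i else 0.
Proof.
apply: pair_fun_ext => [|u]; first by rewrite /= (br_ef setup); case: ifP.
rewrite /= eh_fh addrC addKr; case: ifP => _; first by rewrite scale1r.
by rewrite scale0r.
Qed.

(** The algebra without Serre relations, seen inside [g] times the operators on [T]. The operators
    need not satisfy the Serre relations, so the second component is not determined by the first;
    the ambiguity consists of the defect operators [B] with [GL (0, B)]. *)
Definition GL (p : K) : Prop := lie_gen kb (gensEF kE kF) p.

Lemma GL_sub : subspace GL.
Proof. exact: lie_gen_sub. Qed.

Lemma GL_kb p q : GL p -> GL q -> GL (kb p q).
Proof. exact: lie_gen_kb. Qed.

Lemma GL_E i : GL (kE i).
Proof. by apply: lie_gen_in; left; exists i. Qed.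

Lemma GL_F i : GL (kF i).
Proof. by apply: lie_gen_in; right; exists i. Qed.

Lemma GL_H i : GL (kH i).
Proof. by have := GL_kb (GL_E i) (GL_F i); rewrite kEF eqxx. Qed.

Lemma gens_good y : gensEF kE kF y -> good y.
Proof. by case=> -[i ->]; [exact: eh_linop | exact: fh_linop]. Qed.

Lemma GL_linop p : GL p -> linop p.2.
Proof. exact: (lie_gen_good good_sub good_kb gens_good). Qed.

Definition lspan (v0 u : T) : Prop :=
  forall P, subspace P -> P v0 -> (forall i u, P u -> P (fh i u)) -> P u.

Lemma lspan_sub v0 : subspace (lspan v0).
Proof.
split=> [P [] //|b u w hu hw P sP Pv Pf].
exact: (subspace_lin b sP (hu P sP Pv Pf) (hw P sP Pv Pf)).
Qed.

Lemma lspan_f v0 i u : lspan v0 u -> lspan v0 (fh i u).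
Proof. by move=> hu P sP Pv Pf; exact: (Pf _ _ (hu P sP Pv Pf)). Qed.

Lemma lspan_v0 v0 : lspan v0 v0. Proof. by move=> P. Qed.

(** Stated for any singular [v0] because it serves both [vac] and the vectors [f_i^(k+1) vac] of the
    parabolic relations. *)
Lemma lspan_stable v0 p u : (forall i, exists c, hh i v0 = c *: v0) -> (forall i, eh i v0 = 0) ->
  GL p -> lspan v0 u -> lspan v0 (p.2 u).
Proof.
move=> hv ev Gp; have sL := lspan_sub v0.
have L0 := subspace_mem0 sL.
have eL i u' : lspan v0 u' -> lspan v0 (eh i u').
  move=> hu; pose P w := lspan v0 w /\
    ((forall i, lspan v0 (hh i w)) /\ (forall i, lspan v0 (eh i w))).
  suff [_ []] : P u' by [].
  apply: hu => {u'}.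
  - split; first by split=> //; split=> j; rewrite ?(linop0 (hh_linop _)) ?(linop0 (eh_linop _)).
    move=> b x y [x1 [x2 x3]] [y1 [y2 y3]]; split; first exact: (subspace_lin b sL).
    by split=> j; rewrite ?hh_linop ?eh_linop; apply: (subspace_lin b sL).
  - split; first exact: lspan_v0.
    split=> j; last by rewrite ev.
    by have [c ->] := hv j; apply: (subspaceZ _ sL); apply: lspan_v0.
  move=> j x [x1 [x2 x3]]; split; first exact: lspan_f.
  split=> l.
    by rewrite hh_fh; apply: (subspaceB sL); [|apply: (subspaceZ _ sL)]; apply: lspan_f.
  rewrite eh_fh; apply: (subspaceD sL); first exact: lspan_f.
  exact: (subspaceZ _ sL).
move: u; suff : good p /\ forall u, lspan v0 u -> lspan v0 (p.2 u) by case.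
apply: (Gp (fun p => good p /\ forall u, lspan v0 u -> lspan v0 (p.2 u))).
  split; first split.
  - by split=> [|u _ //]; exact: (subspace_mem0 good_sub).
  - move=> c x y [gx hx] [gy hy]; split; first exact: (subspace_lin c good_sub).
    by move=> u hu; rewrite pair_fun_linE; apply: (subspace_lin c sL); auto.
  move=> x y [gx hx] [gy hy]; split; first exact: good_kb.
  by move=> u hu /=; apply: (subspaceB sL); auto.
move=> y Gy; split; first exact: gens_good.
by case: Gy => -[i ->] u hu /=; [exact: eL | exact: lspan_f].
Qed.

Lemma vac_stable p u : GL p -> lspan vac u -> lspan vac (p.2 u).
Proof.
apply: lspan_stable => i; last exact: eh_vac.
by exists (lam 0 i); apply: hh_vac.
Qed.

Definition off_char (i : 'I_n) : C := if `[< J' i >] then 0 else 1.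

(* On words this is the character of the tensor algebra sending [f i] to [off_char i], graded by
   [m]; in particular it vanishes on commutators. *)
Fixpoint theta (m : nat) (Phi : T) : C :=
  if m is m'.+1 then \sum_j off_char j * theta m' (fun w => Phi (j :: w)) else Phi [::].

Lemma theta_lin m c (u w : T) : theta m (c *: u + w) = c * theta m u + theta m w.
Proof.
elim: m u w => [//|m IH] u w /=; rewrite mulr_sumr -big_split; apply: eq_bigr => j _ /=.
rewrite -[fun w0 => _]/(c *: (fun w0 => u (j :: w0)) + (fun w0 => w (j :: w0))) IH.
by ring.
Qed.

Lemma theta0 m : theta m 0 = 0.
Proof. by have := theta_lin m (-1) 0 0; rewrite scaler0 addr0 => {1}->; ring. Qed.

Lemma thetaB m u w : theta m (u - w) = theta m u - theta m w.
Proof. by rewrite addrC -scaleN1r theta_lin; ring. Qed.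

Lemma theta_fh m i u : theta m.+1 (fh i u) = off_char i * theta m u.
Proof.
rewrite /= (bigD1 i) //= big1 ?addr0 => [|j ji]; last first.
  rewrite (_ : (fun w => _) = 0) ?theta0 ?mulr0 //.
  by apply/funext => w; rewrite eq_sym (negPf ji) mul0r.
by congr (_ * theta m _); apply/funext => w; rewrite eqxx mul1r.
Qed.

Definition deep (mu : wght) : Prop := exists k, [/\ nonneg k, 2 <= ht k & mu = - wtk alpha k].

Lemma br_weight_span (O1 O2 O3 : wght -> Prop) x y :
  (forall mu nu, O1 mu -> O2 nu -> O3 (mu + nu)) ->
  weight_span hs br O1 x -> weight_span hs br O2 y -> weight_span hs br O3 (br x y).
Proof.
move=> h [s [hs1 ->]] [t [ht1 ->]].
have sW : subspace (weight_span hs br O3).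
  by apply: weight_span_subspace => i; apply: br_linr setup _.
rewrite (linop_sum _ _ (br_linop_l setup _)); apply: subspace_sum => // p /hs1[p1 p2].
rewrite (linop_sum _ _ (br_linr setup _)); apply: subspace_sum => // q /ht1[q1 q2].
apply: (weight_span1 (mu := q.1 + p.1)); last by rewrite addrC; apply: h.
exact: (weight_act (br_lie_module setup (fun _ => True)) (fun _ => I) I p1 q1).
Qed.

(** A bracket has no component along the [f_i], and [theta] after it is 0 because scalars commute.
    So [theta] sees only the linear part [c] of [p], and [c] can be read off [p.1] by weights. *)
Lemma neg_theta p : lie_gen kb (gensF kF) p -> exists c : 'I_n -> C,
  [/\ weight_span hs br deep (p.1 - \sum_i c i *: f i),
      forall u, theta 0 (p.2 u) = 0 &
      forall m u, theta m.+1 (p.2 u) = \sum_i c i * off_char i * theta m u].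
Proof.
have sD : subspace (weight_span hs br deep).
  by apply: weight_span_subspace => i; apply: br_linr setup _.
move=> hp; apply: (hp (fun p => exists c : 'I_n -> C,
  [/\ weight_span hs br deep (p.1 - \sum_i c i *: f i),
      forall u, theta 0 (p.2 u) = 0 &
      forall m u, theta m.+1 (p.2 u) = \sum_i c i * off_char i * theta m u])) => {hp p}.
  split; first split.
  - exists (fun _ => 0); split=> // [|m u].
      by rewrite big1 ?subr0 => [|i _]; [exact: subspace_mem0 | rewrite scale0r].
    by rewrite pair_fun0E theta0 big1 // => i _; rewrite !mul0r.
  - move=> b p q [c [c1 c2 c3]] [c' [c1' c2' c3']].
    exists (fun i => b * c i + c' i); split=> [|u|m u].
    + rewrite (_ : _ - _ = b *: (p.1 - \sum_i c i *: f i) + (q.1 - \sum_i c' i *: f i)).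
        exact: subspace_lin.
      rewrite pair_linE scalerBr addrACA -opprD scaler_sumr -big_split.
      by congr (_ - _); apply: eq_bigr => i _ /=; rewrite scalerDl scalerA.
    + by rewrite pair_fun_linE (theta_lin 0) c2 c2' mulr0 addr0.
    rewrite pair_fun_linE (theta_lin m.+1) c3 c3' mulr_sumr -big_split; apply: eq_bigr => i _ /=.
    by ring.
  move=> p q [c [c1 c2 c3]] [c' [c1' c2' c3']].
  exists (fun _ => 0); split=> [|u|m u].
  - rewrite big1 ?subr0 => [|i _]; last by rewrite scale0r.
    pose O (mu : wght) := exists k, [/\ nonneg k, 1 <= ht k & mu = - wtk alpha k].
    have sO : subspace (weight_span hs br O).
      by apply: weight_span_subspace => i; apply: br_linr setup _.
    have wO x (b : 'I_n -> C) : weight_span hs br deep (x - \sum_i b i *: f i) -> weight_span hs br O x.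
      move=> h; rewrite -(subrK (\sum_i b i *: f i) x); apply: (subspaceD sO).
        apply: weight_span_mono h => mu [k [k0 hk ->]].
        by exists k; split=> //; apply: le_trans hk.
      apply: subspace_sum => // i _; apply: subspaceZ => //.
      apply: (weight_span1 (root_f setup i)); exists (upd (fun _ => 0) i 1).
      split; last by rewrite wtk_delta.
        by move=> j; rewrite /upd add0r mulrn_wge0.
      by rewrite ht_upd /ht big1.
    apply: (br_weight_span _ (wO _ _ c1) (wO _ _ c1')).
    move=> _ _ [k [k0 hk ->]] [k' [k0' hk' ->]]; exists (fun j => k j + k' j); split.
    + by move=> j; apply: addr_ge0.
    + have -> : ht (fun j => k j + k' j) = ht k + ht k' by rewrite -big_split.
      by lia.
    by rewrite wtkD opprD.
  - by rewrite kb_fun (thetaB 0) c2 c2' subrr.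
  rewrite kb_fun thetaB c3 c3'.
  rewrite [RHS]big1 => [|i _]; last by rewrite !mul0r.
  case: m => [|m].
    by rewrite c2 c2' !big1 ?subrr // => i _; rewrite mulr0.
  rewrite c3 c3' -!mulr_suml; ring.
move=> _ [i ->]; exists (fun j => (j == i)%:R); split=> [|//|m u].
  rewrite (bigD1 i) //= eqxx scale1r big1 ?addr0 => [|j /negPf ->]; last by rewrite scale0r.
  by rewrite subrr; exact: subspace_mem0.
rewrite theta_fh (bigD1 i) //= eqxx mul1r big1 ?addr0 // => j /negPf ->.
by rewrite !mul0r.
Qed.

Lemma pos_vac p : lie_gen kb (gensE kE) p ->
  p.2 vac = 0 /\
  weight_span hs br (fun mu => exists k, [/\ nonneg k, 1 <= ht k & mu = wtk alpha k]) p.1.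
Proof.
set O := fun mu : wght => _.
have sO : subspace (weight_span hs br O).
  by apply: weight_span_subspace => i; apply: br_linr setup _.
move=> hp; suff [_] : good p /\ (p.2 vac = 0 /\ weight_span hs br O p.1) by [].
apply: (hp (fun p => good p /\ (p.2 vac = 0 /\ weight_span hs br O p.1))) => {hp p}.
  split; first split.
  - split; first exact: (subspace_mem0 good_sub).
    by split=> //; exact: (subspace_mem0 sO).
  - move=> c x y [gx [x1 x2]] [gy [y1 y2]]; split; first exact: (subspace_lin c good_sub).
    split; last exact: (subspace_lin c sO).
    by rewrite pair_fun_linE x1 y1 scaler0 addr0.
  move=> x y [gx [x1 x2]] [gy [y1 y2]]; split; first exact: good_kb.
  split; first by rewrite /= x1 y1 (linop0 gx) (linop0 gy) subrr.
  apply: (br_weight_span _ x2 y2).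
  move=> _ _ [k [k0 hk ->]] [k' [k0' hk' ->]]; exists (fun j => k j + k' j); split.
  - by move=> j; apply: addr_ge0.
  - have -> : ht (fun j => k j + k' j) = ht k + ht k' by rewrite -big_split.
    by lia.
  by rewrite wtkD.
move=> _ [i ->]; split; first exact: eh_linop.
split; first exact: eh_vac.
apply: (weight_span1 (root_e setup i)); exists (upd (fun _ => 0) i 1).
split; last by rewrite wtk_delta.
  by move=> j; rewrite /upd add0r mulrn_wge0.
by rewrite ht_upd /ht big1.
Qed.

(** Write [(0, B) = p + q + r] by the triangular decomposition. The first components sum to 0, and
    comparing weights makes the coefficients of [p] along the [f_i] and of [q] along the [h_i]
    vanish. Finally [r] kills [vac], and [theta] sees only the vanished coefficients of [p]. *)
Lemma ker_theta B m : GL (0, B) -> theta m (B vac) = 0.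
Proof.
move=> hB.
have [p [q [r [hp [c hq] hr E]]]] := triangular good_sub good_kb kb_anti kb_linr kb_jac
  (E := kE) (F := kF) (H := kH) eh_linop fh_linop hh_linop kHE kHF kEF hB.
have E1 : 0 = p.1 + q.1 + r.1 by have := congr1 fst E; rewrite !pair_addE.
have E2 : B vac = p.2 vac + q.2 vac + r.2 vac.
  by have := congr1 (fun x : K => x.2 vac) E; rewrite !pair_fun_addE.
have q1E : q.1 = \sum_i c i *: hs i by rewrite hq pair_sumE.
have q2E : q.2 vac = \sum_i c i *: hh i vac by rewrite hq pair_fun_sumE.
have [b [b1 b2 b3]] := neg_theta hp.
have [r2 r1] := pos_vac hr.
have lh i : linop (br (hs i)) by apply: (br_linr setup).
have sO O := @weight_span_subspace R n g hs g br O lh.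
have wq mu : mu <> 0 -> weight_span hs br (fun nu => nu <> mu) q.1.
  move=> mu0; rewrite q1E; apply: subspace_sum => // i _; apply: subspaceZ => //.
  by apply: (weight_span1 (root_hs setup i)) => h0; apply: mu0.
have deepN k : nonneg k -> 1 <= ht k -> - wtk alpha k <> 0.
  move=> k0 hk; rewrite -wtkN -(wtk0 alpha) => /(wtk_inj cart fin) h.
  have : ht (fun j => - k j) = 0 by rewrite h /ht big1.
  by rewrite /ht sumrN -/(ht k); lia.
have a0 i : alpha i <> 0.
  move=> h; have := alpha_ii setup i; rewrite h mxE => /eqP.
  by rewrite eq_sym pnatr_eq0.
have b0 i : b i = 0.
  have hdelta j : ht (upd (fun _ => 0) j 1) = 1 by rewrite ht_upd /ht big1.
  suff : b i *: f i = 0 by move/eqP; rewrite scaler_eq0 (negPf (f_neq0 setup i)) orbF => /eqP.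
  have wi : weight_vec hs br (- alpha i) (b i *: f i).
    by move=> j; rewrite (linopZ _ _ (lh j)) (root_f setup) !scalerA mulrC.
  apply: (weight_span_notin (Om := fun nu => nu <> - alpha i) lh _ wi) => //.
  (* All terms on the right avoid the weight [- alpha_i]. *)
  have -> : b i *: f i = - (p.1 - \sum_j b j *: f j) - \sum_(j | j != i) b j *: f j - q.1 - r.1.
    by rewrite [X in - (_ - X)](bigD1 i) //=; apply: sum3_eq0_isolate.
  have S := sO (fun nu => nu <> - alpha i).
  do !apply: (subspaceB S); first apply: (subspaceN S).
  - apply: weight_span_mono b1 => mu [k [k0 hk ->]] /oppr_inj.
    rewrite -(wtk_delta alpha i) => /(wtk_inj cart fin) h; move: hk.
    by rewrite h hdelta.
  - rewrite big_mkcond /=; apply: subspace_sum => // j _; case: ifP => ji; last first.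
      exact: (subspace_mem0 S).
    apply: (subspaceZ _ S); apply: (weight_span1 (root_f setup j)) => /oppr_inj.
    rewrite -(wtk_delta alpha i) -(wtk_delta alpha j) => /(wtk_inj cart fin).
    move=> /(congr1 (fun F => F j)); rewrite /upd eqxx (negPf (negbT (negbTE ji))).
    by rewrite add0r mulr0n.
  - by apply: wq => h; apply: (a0 i); rewrite -[alpha i]opprK h oppr0.
  apply: weight_span_mono r1 => mu [k [k0 hk ->]].
  rewrite -(wtk_delta alpha i) -wtkN => /(wtk_inj cart fin) h.
  have : ht k = -1 by rewrite h /ht sumrN -/(ht _) hdelta.
  by move=> hk'; move: hk; rewrite hk'.
have q10 : q.1 = 0.
  have wz : weight_vec hs br 0 q.1.
    move=> j; rewrite mxE scale0r q1E (linop_sum _ _ (lh j)) big1 // => i _.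
    by rewrite (linopZ _ _ (lh j)) (br_hs setup) scaler0.
  apply: (weight_span_notin (Om := fun nu => nu <> 0) lh _ wz) => //.
  have -> : q.1 = - (p.1 - \sum_j b j *: f j) - r.1.
    rewrite (big1 _ _ (fun j => b j *: f j)) ?subr0 => [|j _]; last by rewrite b0 scale0r.
    by apply/eqP; rewrite -opprD -addr_eq0 addrCA addrA -E1.
  have S := sO (fun nu : wght => nu <> 0).
  apply: (subspaceB S); first apply: (subspaceN S).
    apply: weight_span_mono b1 => mu [k [k0 hk ->]].
    by apply: deepN => //; apply: le_trans hk.
  apply: weight_span_mono r1 => mu [k [k0 hk ->]] h.
  by apply: (deepN k) => //; rewrite h oppr0.
have c0 := hs_sum_eq0 setup (etrans (esym q1E) q10).
have q20 : q.2 vac = 0 by rewrite q2E big1 // => i _; rewrite c0 scale0r.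
rewrite E2 r2 q20 !addr0; case: m => [|m]; first exact: b2.
by rewrite b3 big1 // => i _; rewrite b0 !mul0r.
Qed.

(** The defect operators applied to [vac], closed up under the [f_i]. Elements of [GL] over the same
    [x] in [g] differ by a defect operator, so modulo [Qker] the span of [vac] is a [g]-module, and
    [theta] descends to it. *)
Definition Qker (u : T) : Prop := forall P, subspace P ->
  (forall B, GL (0, B) -> P (B vac)) -> (forall i u, P u -> P (fh i u)) -> P u.

Lemma Qker_sub : subspace Qker.
Proof.
split=> [P [] //|b u w hu hw P sP Pv Pf].
exact: (subspace_lin b sP (hu P sP Pv Pf) (hw P sP Pv Pf)).
Qed.

Lemma Qker_f i u : Qker u -> Qker (fh i u).
Proof. by move=> hu P sP Pv Pf; exact: (Pf _ _ (hu P sP Pv Pf)). Qed.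

Lemma Qker_vac B : GL (0, B) -> Qker (B vac).
Proof. by move=> hB P sP Pv Pf; apply: Pv. Qed.

Lemma Qker_theta m u : Qker u -> theta m u = 0.
Proof.
move=> hu; move: m; apply: (hu (fun u => forall m, theta m u = 0)).
- split=> [m|c x y hx hy m]; first exact: theta0.
  by rewrite theta_lin hx hy mulr0 addr0.
- by move=> B hB m; apply: ker_theta.
by move=> i x hx [|m] //; rewrite theta_fh hx mulr0.
Qed.

Lemma GL_comm0l B p : GL (0, B) -> GL p -> GL (0, fun u => B (p.2 u) - p.2 (B u)).
Proof.
move=> hB hp; have := GL_kb hB hp.
by rewrite /kb /= (linop0 (br_linop_l setup _)).
Qed.

Lemma GL_comm0r B p : GL (0, B) -> GL p -> GL (0, fun u => p.2 (B u) - B (p.2 u)).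
Proof.
move=> hB hp; have := GL_kb hp hB.
by rewrite /kb /= (linop0 (br_linr setup _)).
Qed.

(** The commutator of a defect operator with [f_i] is again a defect operator, so [B] can be moved
    to the right until it meets [vac]. *)
Lemma Qker_lspan B u : GL (0, B) -> lspan vac u -> Qker (B u).
Proof.
move=> hB hu; move: B hB; apply: (hu (fun u => forall B, GL (0, B) -> Qker (B u))) => {u hu}.
- split=> [B hB|c x y hx hy B hB].
    have lB : linop B := GL_linop hB; rewrite (linop0 lB); exact: (subspace_mem0 Qker_sub).
  have lB : linop B := GL_linop hB.
  by rewrite lB; apply: (subspace_lin c Qker_sub); auto.
- exact: Qker_vac.
move=> i u hu B hB; rewrite -(subrK (fh i (B u)) (B (fh i u))).
apply: (subspaceD Qker_sub); last by apply: Qker_f; apply: hu.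
exact: (hu _ (GL_comm0l hB (GL_F i))).
Qed.

Lemma Qker_stable p u : GL p -> Qker u -> Qker (p.2 u).
Proof.
move=> hp hu; move: p hp; apply: (hu (fun u => forall p, GL p -> Qker (p.2 u))) => {u hu}.
- split=> [p hp|c x y hx hy p hp].
    by rewrite (linop0 (GL_linop hp)); exact: (subspace_mem0 Qker_sub).
  by rewrite (GL_linop hp); apply: (subspace_lin c Qker_sub); auto.
- move=> B hB p hp; rewrite -(subrK (B (p.2 vac)) (p.2 (B vac))).
  apply: (subspaceD Qker_sub); first exact: (Qker_vac (GL_comm0r hB hp)).
  by apply: Qker_lspan => //; apply: vac_stable => //; apply: lspan_v0.
move=> i u hu p hp; rewrite -(subrK (fh i (p.2 u)) (p.2 (fh i u))).
apply: (subspaceD Qker_sub); last by apply: Qker_f; apply: hu.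
by have := hu _ (GL_kb hp (GL_F i)).
Qed.

(** The projection of [GL] to [g] is onto, since its image is a subalgebra containing the
    generators; lifting a basis gives a linear section. It respects brackets only up to defect
    operators. *)
Lemma lift_exists : exists L : g -> T -> T,
  (forall x, GL (x, L x)) /\ (forall c x y u, L (c *: x + y) u = c *: L x u + L y u).
Proof.
have ex x : exists A, GL (x, A).
  apply: (lie_generated setup cart fin (P := fun x => exists A, GL (x, A))).
  - split; first by exists (fun _ => 0); exact: (subspace_mem0 GL_sub).
    move=> c y z [A hA] [B hB]; exists (fun u => c *: A u + B u).
    exact: (subspace_lin c GL_sub hA hB).
  - by move=> y z [A hA] [B hB]; exists (fun u => A (B u) - B (A u)); exact: (GL_kb hA hB).
  by move=> i; split; [exists (eh i); exact: GL_E | exists (fh i); exact: GL_F].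
have [A hA] := choice ex.
pose b := vbasis {:g}.
exists (fun x u => \sum_p coord b p x *: A (tnth b p) u); split=> [x|c x y u].
  have -> : (x, fun u => \sum_p coord b p x *: A (tnth b p) u)
     = \sum_p coord b p x *: (tnth b p, A (tnth b p)).
    apply: pair_fun_ext => [|u]; rewrite ?pair_sumE ?pair_fun_sumE //=.
    rewrite {1}(coord_vbasis (memvf x)); apply: eq_bigr => p _.
    by rewrite (tnth_nth 0).
  by apply: subspace_sum => [|p _]; [exact: GL_sub | apply: (subspaceZ _ GL_sub)].
rewrite scaler_sumr -big_split; apply: eq_bigr => p _ /=.
by rewrite linearP scalerDl scalerA.
Qed.

Lemma theta_word js : (forall j, j \in js -> ~ J' j) ->
  theta (size js) (foldr fh vac js) = 1.
Proof.
elim: js => [//|j js IH] hj; rewrite -[size _]/((size js).+1) -[foldr _ _ _]/(fh j (foldr fh vac js)).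
rewrite theta_fh IH; last by move=> l ljs; apply: hj; rewrite inE ljs orbT.
by rewrite /off_char asboolF ?mulr1 //; apply: hj; rewrite mem_head.
Qed.

Lemma sl2_free i : sl2_triple (eh i) (fh i) (hh i).
Proof.
split; first by split; [exact: eh_linop | exact: fh_linop].
- exact: hh_linop.
- by move=> u; rewrite eh_fh eqxx scale1r.
- by move=> u; rewrite hh_eh (alpha_ii setup).
- by move=> u; rewrite hh_fh (alpha_ii setup).
Qed.

(** For [j = i] the factor [lam(h_i) - k] vanishes; for [j != i], [e_j] commutes with [f_i]. *)
Lemma singular_word i (k : nat) : lam 0 i = k%:R ->
  (forall j, exists c, hh j (iter k.+1 (fh i) vac) = c *: iter k.+1 (fh i) vac) /\
  (forall j, eh j (iter k.+1 (fh i) vac) = 0).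
Proof.
move=> hk; split=> j.
  elim: (k.+1) => [|m [c IH]]; first by exists (lam 0 j); apply: hh_vac.
  exists (c - alpha i 0 j); rewrite iterS hh_fh IH (linopZ _ _ (fh_linop i)).
  by rewrite -scalerBl.
have [->|ji] := eqVneq j i.
  have st u : u = 0 -> fh i u = 0 by move=> ->; rewrite (linop0 (fh_linop i)).
  have := sl2_e_iter_f (Q := fun u => u = 0) (sl2_free i) st k (eh_vac i) (hh_vac i).
  by rewrite hk subrr mulr0 scale0r subr0.
elim: (k.+1) => [|m IH]; first exact: eh_vac.
by rewrite iterS eh_fh IH (negPf ji) scale0r addr0 (linop0 (fh_linop i)).
Qed.

(** Every word of this span contains the letter [i], on which the character is 0. *)
Lemma lspan_theta i (k : nat) u m : J' i -> lspan (iter k.+1 (fh i) vac) u -> theta m u = 0.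
Proof.
move=> Ji hu; move: m; apply: (hu (fun u => forall m, theta m u = 0)).
- split=> [m|c x y hx hy m]; first exact: theta0.
  by rewrite theta_lin hx hy mulr0 addr0.
- by case=> [|m] //; rewrite iterS theta_fh /off_char asboolT // mul0r.
by move=> j x hx [|m] //; rewrite theta_fh hx mulr0.
Qed.

Lemma foldr_ugd_act (w : ugd br) js s :
  foldr (fun i => ugd_act (f i)) w js s = w (s ++ map f js).
Proof.
elim: js s => [|j js IH] s; first by rewrite cats0.
by rewrite /= IH cat_rcons.
Qed.

(** The vector is the matrix coefficient sending a word [s] to [theta (L s vac)], with the lift [L]
    extended to words. Since [theta] vanishes on [Qker], it is a functional on [U g], and identities
    for [vac] modulo [Qker] become identities for its right translates. *)
Lemma parabolic_witness js : (forall j, j \in js -> ~ J' j) -> exists w : ugd br,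
  [/\ hw_vector hs e (@ugd_act _ g br) lam w, parabolic_rel f (@ugd_act _ g br) J' lam w &
      foldr (fun i => ugd_act (f i)) w js != 0].
Proof.
move=> hjs; have [L [GLL Llin]] := lift_exists.
pose op (s : seq g) (u : T) : T := foldr L u s.
have opcat s t u : op (s ++ t) u = op s (op t u) by rewrite /op foldr_cat.
have Llinop x : linop (L x) := GL_linop (GLL x).
have oplin s : linop (op s).
  by elim: s => [|x s IH] c u w //=; rewrite /op /= -!/(op _ _) IH Llinop.
have opQ s u : Qker u -> Qker (op s u).
  by elim: s => [//|x s IH] hu /=; apply: (Qker_stable (GLL x)); apply: IH.
have opL v0 s u : (forall i, exists c, hh i v0 = c *: v0) -> (forall i, eh i v0 = 0) ->
    lspan v0 u -> lspan v0 (op s u).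
  move=> h1 h2 hu; elim: s => [//|x s IH].
  exact: (lspan_stable h1 h2 (GLL x) IH).
have vL s : lspan vac (op s vac).
  apply: opL; [|exact: eh_vac | exact: lspan_v0].
  by move=> i; exists (lam 0 i); apply: hh_vac.
(* [theta M] reads only words of length [M], the degree in which the monomial [js] has value 1. *)
pose M := size js.
pose Psi (s : seq g) : C^o := theta M (op s vac).
have congQ s u u' : Qker (u - u') -> theta M (op s u) = theta M (op s u').
  move=> hq; apply/eqP; rewrite -subr_eq0 -thetaB -(linopB _ _ (oplin s)).
  by rewrite (Qker_theta M (opQ s _ hq)).
have diffQ x A u : GL (x, A) -> lspan vac u -> Qker (L x u - A u).
  move=> hA hu; apply: (Qker_lspan (B := fun u => L x u - A u)) => //.
  have := subspaceB GL_sub (GLL x) hA.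
  by rewrite (_ : _ - _ = (0, fun u => L x u - A u)) // -[LHS]/(x - x, _) subrr.
have PsiP : Psi \in ug_dual br.
  apply/asboolP; split=> [s t c x y|s t x y]; rewrite /Psi.
    rewrite !opcat -[op (_ :: _) _]/(L _ (op t vac)) Llin (oplin s) theta_lin.
    by [].
  rewrite !opcat -thetaB -(linopB _ _ (oplin s)).
  apply: congQ; exact: (diffQ _ _ _ (GL_kb (GLL x) (GLL y)) (vL t)).
exists (Ugd PsiP).
have fword ks : Qker (op (map f ks) vac - foldr fh vac ks) /\ lspan vac (foldr fh vac ks).
  elim: ks => [|j ks [IH1 IH2]].
    by rewrite subrr; split; [exact: (subspace_mem0 Qker_sub) | exact: lspan_v0].
  split; last exact: lspan_f.
  rewrite -[op _ _]/(L (f j) (op (map f ks) vac)) -[foldr _ _ _]/(fh j (foldr fh vac ks)).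
  rewrite -(subrK (L (f j) (foldr fh vac ks)) (L (f j) (op _ _))) -addrA.
  apply: (subspaceD Qker_sub); last exact: (diffQ _ _ _ (GL_F j) IH2).
  rewrite -(linopB _ _ (Llinop (f j))).
  exact: (Qker_stable (GLL (f j)) IH1).
have PsiE s t : Psi (s ++ t) = theta M (op s (op t vac)) by rewrite /Psi opcat.
split.
- split=> i; apply: ugd_ext => s.
    rewrite -[RHS]/(lam 0 i * Psi s) -[LHS]/(Psi (rcons s (hs i))) -cats1 PsiE.
    rewrite (congQ s _ (hh i vac)); last exact: (diffQ (hs i) (hh i) vac (GL_H i) (@lspan_v0 vac)).
    rewrite hh_vac (linopZ _ _ (oplin s)).
    by have := theta_lin M (lam 0 i) (op s vac) 0; rewrite addr0 theta0 addr0.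
  rewrite -[RHS]/(0 : C) -[LHS]/(Psi (rcons s (e i))) -cats1 PsiE.
  rewrite (congQ s _ (eh i vac)); last exact: (diffQ (e i) (eh i) vac (GL_E i) (@lspan_v0 vac)).
  by rewrite eh_vac (linop0 (oplin s)) theta0.
- move=> i Ji k hk.
  have -> : iter k.+1 (ugd_act (f i)) (Ugd PsiP)
    = foldr (fun i => ugd_act (f i)) (Ugd PsiP) (nseq k.+1 i).
    by elim: (k.+1) => //= m ->.
  apply: ugd_ext => s; rewrite foldr_ugd_act -[RHS]/(0 : C).
  rewrite -[LHS]/(Psi (s ++ map f (nseq k.+1 i))) PsiE.
  have [hq _] := fword (nseq k.+1 i).
  rewrite (congQ s _ _ hq).
  have -> : foldr fh vac (nseq k.+1 i) = iter k.+1 (fh i) vac by elim: (k.+1) => //= m ->.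
  have [h1 h2] := singular_word hk.
  by apply: (lspan_theta _ Ji (k := k)); apply: opL => //; apply: lspan_v0.
apply/eqP => /(congr1 (fun w : ugd br => w [::])); rewrite foldr_ugd_act.
rewrite -[RHS]/(0 : C) -[LHS]/(Psi ([::] ++ map f js)) PsiE.
have [hq _] := fword js.
rewrite (congQ [::] _ _ hq) -[op _ _]/(foldr fh vac js) theta_word //.
by apply/eqP; rewrite oner_neq0.
Qed.

End FreeVerma.

Lemma subr_subr (V : zmodType) (x y z : V) : x - y - (x - z) = z - y.
Proof. by rewrite opprB addrC addrA subrK. Qed.

Lemma subrBACA (V : zmodType) (x y z t : V) : x - y - (z - t) = x - z - (y - t).
Proof. by rewrite !opprB [LHS]addrACA [RHS]addrACA [- y - z]addrC. Qed.

(** * Nonzero monomials in parabolic Verma modules *)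

Section ParabolicWeights.
Variables (R : realType) (n : nat) (g : vectType (complex R)).
Local Notation C := (complex R).
Local Notation wght := 'rV[C]_n.
Variables (br : g -> g -> g) (hs e f : 'I_n -> g) (alpha : 'I_n -> wght).
Hypothesis setup : chevalley_setup br hs e f alpha.
Variables (a : 'M[int]_n) (d : 'I_n -> R).
Hypothesis cart : cartan_spec alpha a.
Hypothesis fin : finite_type a d.

Lemma fmon_letters (V : lmodType C) (act : g -> V -> V) l k u :
  fmon f act l k u
  = foldr (fun i => act (f i)) u (flatten [seq nseq (absz (k i)) i | i <- l]).
Proof.
elim: l => [//|i l IH] /=; rewrite foldr_cat -IH.
by elim: (absz (k i)) => //= m ->.
Qed.

(** The universal property sends the monomial applied to [v] to the same monomial applied to the
    witness, which is nonzero. *)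
Lemma wt_off_J_parabolic (V : lmodType C) (act : g -> V -> V) (lam : wght) (v : V) J' k :
  verma_quotient br hs e act lam v -> (forall i, J' i -> J_lambda lam i) ->
  is_parabolic_verma br hs e f act J' lam v ->
  nonneg k -> (forall j, J_of f act lam v j -> k j = 0) ->
  wt hs act (lam - wtk alpha k).
Proof.
move=> vq J'l [rel univ] k0 kJ.
apply: (fmon_wt setup vq (l := enum 'I_n) k0); first by rewrite big_enum.
rewrite fmon_letters; set js := flatten _.
(* Indices of [J'] lie in [J] by the defining relations, so their exponents in [k] are 0. *)
have hjs j : j \in js -> ~ J' j.
  move=> /flattenP[x /mapP[i _ ->]]; rewrite mem_nseq => /andP[ki /eqP ->] Ji.
  have [c hc] := J'l i Ji.
  move: ki; rewrite kJ //; exists c; split=> //; exact: rel.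
have [w [hw relw nz]] := parabolic_witness setup cart fin lam hjs.
have [phi [[phil phia] phiv]] := univ _ _ _ (ugd_module br) hw relw.
apply/eqP => h0; move/eqP: nz; apply.
have -> : foldr (fun i => ugd_act (f i)) w js = phi (foldr (fun i => act (f i)) v js).
  by elim: (js) => [|j ks IH] /=; [rewrite phiv | rewrite IH phia].
rewrite h0; have := phil (-1) 0 0; rewrite scaler0 addr0 => {1}->.
by rewrite scaleN1r addNr.
Qed.

End ParabolicWeights.

(** * The Levi subalgebra and simple subquotients over it *)

Section Levi.
Variables (R : realType) (n : nat) (g : vectType (complex R)).
Local Notation C := (complex R).
Local Notation wght := 'rV[C]_n.
Variables (br : g -> g -> g) (hs e f : 'I_n -> g) (alpha : 'I_n -> wght).
Hypothesis setup : chevalley_setup br hs e f alpha.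
Variable J : 'I_n -> Prop.
Local Notation gJ := (in_gJ br e f J).
Local Notation gJh := (in_gJh br hs e f J).

Lemma in_gJ_sub : subspace gJ.
Proof.
split=> [U _ _|c x y hx hy U U1 U2]; first exact: mem0v.
by rewrite memvD ?memvZ ?hx ?hy.
Qed.

Lemma in_gJ_br x y : gJ x -> gJ y -> gJ (br x y).
Proof. by move=> hx hy U U1 U2; exact: (U1 _ _ (hx U U1 U2) (hy U U1 U2)). Qed.

Lemma in_gJ_e j : J j -> gJ (e j).
Proof. by move=> Jj U _ U2; have [] := U2 j Jj. Qed.

Lemma in_gJ_f j : J j -> gJ (f j).
Proof. by move=> Jj U _ U2; have [] := U2 j Jj. Qed.

(** [in_gJ] is an intersection of vspaces, so [P] is first cut down to [g_J] and turned into a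
    vspace; the cut also supplies membership in [g_J] in the bracket case. *)
Lemma in_gJ_ind (P : g -> Prop) : subspace P ->
  (forall x y, gJ x -> gJ y -> P x -> P y -> P (br x y)) ->
  (forall j, J j -> P (e j) /\ P (f j)) -> forall x, gJ x -> P x.
Proof.
move=> sP Pbr Pg x hx.
have sQ : subspace (fun x => gJ x /\ P x).
  split; first by split; [exact: (subspace_mem0 in_gJ_sub) | exact: subspace_mem0].
  move=> c u w [u1 u2] [w1 w2].
  by split; [exact: (subspace_lin c in_gJ_sub u1 w1) | exact: subspace_lin].
have [U hU] := subspace_vspace sQ.
suff /hU[] : x \in U by [].
apply: hx => [y z /hU[y1 y2] /hU[z1 z2]|j Jj].
  by apply/hU; split; [exact: in_gJ_br | exact: Pbr].
have [Pe Pf] := Pg j Jj.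
by split; apply/hU; split=> //; [exact: in_gJ_e | exact: in_gJ_f].
Qed.

Lemma in_gJ_hs i x : gJ x -> gJ (br (hs i) x).
Proof.
apply: (in_gJ_ind (P := fun x => gJ (br (hs i) x))).
- split; first by rewrite (linop0 (br_linr setup _)); exact: (subspace_mem0 in_gJ_sub).
  by move=> c u w hu hw; rewrite (br_linr setup); apply: (subspace_lin c in_gJ_sub).
- move=> y z hy hz Py Pz; rewrite (jacobi setup); apply: (subspaceD in_gJ_sub); exact: in_gJ_br.
move=> j Jj; split; [rewrite (root_e setup) | rewrite (root_f setup)].
  by apply: (subspaceZ _ in_gJ_sub); exact: in_gJ_e.
by apply: (subspaceZ _ in_gJ_sub); exact: in_gJ_f.
Qed.

Lemma in_gJh_gJ x : gJ x -> gJh x.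
Proof. by move=> hx; exists x, 0; rewrite addr0 mem0v. Qed.

Lemma in_gJh_hspace x : x \in hspace hs -> gJh x.
Proof. by move=> hx; exists 0, x; rewrite add0r; split=> //; exact: (subspace_mem0 in_gJ_sub). Qed.

Lemma in_gJh_hs i : gJh (hs i).
Proof. by apply: in_gJh_hspace; rewrite /hspace (bigD1 i) //= (subvP (addvSl _ _)) // memv_line. Qed.

Lemma in_gJh_sub : subspace gJh.
Proof.
split; first by apply: in_gJh_gJ; exact: (subspace_mem0 in_gJ_sub).
move=> c x y [x1 [x2 [hx1 hx2 ->]]] [y1 [y2 [hy1 hy2 ->]]].
exists (c *: x1 + y1), (c *: x2 + y2); split.
- exact: (subspace_lin c in_gJ_sub).
- by rewrite memvD ?memvZ.
by rewrite scalerDr addrACA.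
Qed.

Lemma in_gJh_br x y : gJh x -> gJh y -> gJh (br x y).
Proof.
move=> [x1 [x2 [hx1 /hspaceP[c ->] ->]]] [y1 [y2 [hy1 /hspaceP[b ->] ->]]].
have S := in_gJh_sub.
rewrite !(linopD _ _ (br_linr setup _)) !(linopD _ _ (br_linop_l setup _)).
have hh i z : gJ z -> gJh (br (hs i) z) by move=> hz; apply: in_gJh_gJ; exact: in_gJ_hs.
do !apply: (subspaceD S).
- by apply: in_gJh_gJ; exact: in_gJ_br.
- rewrite (linop_sum _ _ (br_linop_l setup _)); apply: subspace_sum => // i _.
  by rewrite (linopZ _ _ (br_linop_l setup _)); apply: (subspaceZ _ S); apply: hh.
- rewrite (linop_sum _ _ (br_linr setup _)); apply: subspace_sum => // i _.
  rewrite (linopZ _ _ (br_linr setup _)) (br_anti setup); apply: (subspaceZ _ S).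
  by apply: (subspaceN S); apply: hh.
rewrite (linop_sum _ _ (br_linr setup _)); apply: subspace_sum => // i _.
rewrite (linopZ _ _ (br_linr setup _)) (linop_sum _ _ (br_linop_l setup _)).
apply: (subspaceZ _ S); apply: subspace_sum => // j _.
by rewrite (linopZ _ _ (br_linop_l setup _)) (br_hs setup) scaler0; exact: (subspace_mem0 S).
Qed.

Lemma gJh_stable (V : lmodType C) (act : g -> V -> V) (S : g -> Prop) (U : V -> Prop) :
  lie_module br act S -> (forall x, gJh x -> S x) -> subspace U ->
  (forall i u, U u -> U (act (hs i) u)) ->
  (forall j u, J j -> U u -> U (act (e j) u)) ->
  (forall j u, J j -> U u -> U (act (f j) u)) ->
  forall x u, gJh x -> U u -> U (act x u).
Proof.
move=> Hm hS sU Uh Ue Uf x u [y [z [hy /hspaceP[c ->] ->]]] Uu.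
rewrite (actDl Hm) (act_suml Hm); apply: (subspaceD sU); last first.
  by apply: subspace_sum => // i _; rewrite (actZl Hm); apply: (subspaceZ _ sU); apply: Uh.
move: u Uu; apply: (in_gJ_ind (P := fun y => forall u, U u -> U (act y u)) _ _ _ hy).
- split=> [w _|b p q hp hq w Uw]; first by rewrite (act0l Hm); exact: subspace_mem0.
  by rewrite (act_linl Hm); apply: (subspace_lin b sU); auto.
- move=> p q hp hq Up Uq w Uw.
  have := act_br Hm w (hS _ (in_gJh_gJ hp)) (hS _ (in_gJh_gJ hq)).
  move=> /eqP; rewrite -subr_eq => /eqP <-.
  by apply: (subspaceB sU); auto.
by move=> j Jj; split=> w; [apply: Ue | apply: Uf].
Qed.

Section SimpleExists.
Variables (V : lmodType C) (act : g -> V -> V) (v0 : V) (nu0 : wght).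
Hypothesis Hm : lie_module br act (fun _ => True).
Hypothesis hv0 : weight_vec hs act nu0 v0.
Hypothesis ev0 : forall j, J j -> act (e j) v0 = 0.

Definition comb m (s : 'I_m -> V) (u : 'rV[C]_m) : V := \sum_i u 0 i *: s i.

Lemma comb_lin m (s : 'I_m -> V) c u w : comb s (c *: u + w) = c *: comb s u + comb s w.
Proof.
rewrite /comb scaler_sumr -big_split; apply: eq_bigr => i _ /=.
by rewrite !mxE scalerDl scalerA.
Qed.

Lemma comb0 m (s : 'I_m -> V) : comb s 0 = 0.
Proof. by apply: big1 => i _; rewrite mxE scale0r. Qed.

Lemma combD m (s : 'I_m -> V) u w : comb s (u + w) = comb s u + comb s w.
Proof. by rewrite -{1}(scale1r u) comb_lin scale1r. Qed.

Lemma combZ m (s : 'I_m -> V) c u : comb s (c *: u) = c *: comb s u.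
Proof. by rewrite -(addr0 (c *: u)) comb_lin comb0 addr0. Qed.

Lemma combB m (s : 'I_m -> V) u w : comb s (u - w) = comb s u - comb s w.
Proof. by rewrite combD -(scaleN1r w) combZ scaleN1r. Qed.

Lemma comb_sum m (s : 'I_m -> V) (I : Type) (l : seq I) (G : I -> 'rV[C]_m) :
  comb s (\sum_(i <- l) G i) = \sum_(i <- l) comb s (G i).
Proof. by elim: l => [|i l IH]; rewrite ?big_nil ?big_cons ?comb0 // combD IH. Qed.

(* [span s + A] and [A] are submodules and [v0] lies in the former but not in the
   latter; for minimal [m] the quotient is simple with basis [s]. *)
Definition subquotient m (s : 'I_m -> V) (A : V -> Prop) : Prop :=
  [/\ subspace A, (forall x u, gJh x -> A u -> A (act x u)), ~ A v0,
      (forall x u, gJh x -> exists w, A (act x (comb s u) - comb s w)) &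
      exists u, A (v0 - comb s u)].

Definition restr m (s : 'I_m -> V) (U : {vspace 'rV[C]_m}) (i : 'I_(\dim U)) : V :=
  comb s (tnth (vbasis U) i).

Lemma comb_restr m (s : 'I_m -> V) (U : {vspace 'rV[C]_m}) c :
  exists2 u, u \in U & comb (@restr m s U) c = comb s u.
Proof.
exists (\sum_i c 0 i *: tnth (vbasis U) i).
  by apply: memv_suml => i _; rewrite memvZ // (vbasis_mem (mem_tnth _ _)).
by rewrite comb_sum; apply: eq_bigr => i _; rewrite combZ.
Qed.

Lemma restr_comb m (s : 'I_m -> V) (U : {vspace 'rV[C]_m}) u : u \in U ->
  exists c, comb s u = comb (@restr m s U) c.
Proof.
move=> Uu; exists (\row_i coord (vbasis U) i u).
rewrite {1}(coord_vbasis Uu) /comb /restr.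
transitivity (comb s (\sum_i coord (vbasis U) i u *: (vbasis U)`_i)) => //.
rewrite comb_sum; apply: eq_bigr => i _.
by rewrite combZ mxE (tnth_nth 0).
Qed.

(** Minimality of [m] makes [s] independent modulo [A]. It also excludes a nonzero proper stable
    [U]: if [v0] lies in [U] plus [A], restricting to [U] is smaller; otherwise [U] can be absorbed
    into [A]. *)
Lemma simple_exists m0 (s0 : 'I_m0 -> V) : subquotient s0 (fun u => u = 0) ->
  exists (W : vectType C) (actW : g -> W -> W),
    [/\ lie_module br actW gJh,
        (forall U : {vspace W},
            (forall x u, gJh x -> u \in U -> actW x u \in U) -> U = 0%VS \/ U = fullv) &
        (exists w, [/\ w != 0, weight_vec hs actW nu0 w &
                       forall j, J j -> actW (e j) w = 0])].
Proof.
move=> sq0.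
pose P m := `[< exists (s : 'I_m -> V) A, subquotient s A >].
have exP : exists m, P m by exists m0; apply/asboolP; exists s0, (fun u => u = 0).
case: (ex_minnP exP) => m /asboolP[s [A [sA Ast nAv sst [u0 hu0]]]] minm.
have dimm : \dim {:'rV[C]_m} = m by rewrite dimvf /dim /= mul1n.
have dec (U : {vspace 'rV[C]_m}) u : exists2 p, p \in U & exists2 q, q \in (U^C)%VS & u = p + q.
  by have := memvf u; rewrite -(addv_complf U) => /memv_addP[p Up [q Uq ->]]; exists p => //; exists q.
have inj u : A (comb s u) -> u = 0.
  have sK : subspace (fun u => A (comb s u)).
    split; first by rewrite comb0; exact: subspace_mem0.
    by move=> c x y hx hy; rewrite comb_lin; apply: subspace_lin.
  have [K hK] := subspace_vspace sK.
  move=> Au; suff K0 : K = 0%VS by apply/eqP; rewrite -memv0 -K0; apply/hK.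
  have /minm : P (\dim (K^C)%VS).
    apply/asboolP; exists (@restr m s (K^C)%VS), A; split=> //.
      move=> x c gx; have [p _ ->] := comb_restr s c.
      have [w hw] := sst x p gx; have [k Kk [k' Kk' ew]] := dec K w.
      have [c' hc'] := restr_comb s Kk'; exists c'; rewrite -hc'.
      have -> : act x (comb s p) - comb s k' = (act x (comb s p) - comb s w) + comb s k.
        by rewrite ew combD opprD addrA addrAC addrNK.
      by apply: subspaceD => //; apply/hK.
    have [k Kk [k' Kk' ew]] := dec K u0.
    have [c' hc'] := restr_comb s Kk'; exists c'; rewrite -hc'.
    have -> : v0 - comb s k' = (v0 - comb s u0) + comb s k.
      by rewrite ew combD opprD addrA addrAC addrNK.
    by apply: subspaceD => //; apply/hK.
  rewrite dimv_compl dimm => le; apply/eqP; rewrite -dimv_eq0.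
  by have := dimvS (subvf K); rewrite dimm; lia.
have uniq u w : A (comb s u - comb s w) -> u = w.
  by rewrite -combB => /inj/eqP; rewrite subr_eq0 => /eqP.
have [GH hGH] := subspace_vspace in_gJh_sub.
(* The action has to be linear on all of [g], while brackets are respected on [g_J + h]; elements
   are first projected there. *)
pose pr : 'End(g) := projv GH.
have prG x : gJh (pr x) by apply/hGH; apply: memv_proj.
have pr_id x : gJh x -> pr x = x by move=> /hGH; apply: projv_id.
have exA (xu : g * 'rV[C]_m) : exists w, A (act (pr xu.1) (comb s xu.2) - comb s w).
  exact: sst.
have [F hF] := choice exA.
pose actW x u := F (x, u).
have hW x u : A (act (pr x) (comb s u) - comb s (actW x u)) by exact: (hF (x, u)).
have hW' x u : gJh x -> A (act x (comb s u) - comb s (actW x u)).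
  by move=> gx; have := hW x u; rewrite pr_id.
have uniqW x u w : gJh x -> A (act x (comb s u) - comb s w) -> actW x u = w.
  move=> gx hw; apply: uniq.
  have := subspaceB sA hw (hW' x u gx); rewrite subr_subr.
  by [].
exists ('rV[C]_m : vectType C), actW; split.
- split.
  + move=> c x y u; apply: uniq; rewrite comb_lin.
    have := subspaceB sA (subspace_lin c sA (hW x u) (hW y u)) (hW (c *: x + y) u).
    rewrite linearP (act_linl Hm) scalerBr addrACA -opprD subr_subr.
    by [].
  + move=> x c u w; apply: uniq; rewrite comb_lin.
    have := subspaceB sA (subspace_lin c sA (hW x u) (hW x w)) (hW x (c *: u + w)).
    rewrite comb_lin (act_linop Hm) scalerBr addrACA -opprD subr_subr.
    by [].
  move=> x y u gx gy; apply: (uniqW _ _ _ (in_gJh_br gx gy)).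
  have hxy p q : gJh p -> gJh q -> A (act p (act q (comb s u)) - comb s (actW p (actW q u))).
    move=> gp gq; have := Ast p _ gp (hW' q u gq).
    rewrite (linopB _ _ (act_linop Hm p)) => h1.
    by have := subspaceD sA h1 (hW' p (actW q u) gp); rewrite addrA subrK.
  have := subspaceB sA (hxy x y gx gy) (hxy y x gy gx).
  by rewrite combB subrBACA; have [_ _ ->] := Hm.
- move=> U Ust; apply: contrapT => hn.
  have U0 : (0 < \dim U)%N.
    by rewrite lt0n dimv_eq0; apply/eqP => h0; apply: hn; left.
  have Um : (\dim U < m)%N.
    have := dimvS (subvf U); rewrite dimm leq_eqVlt => /predU1P[hd|//].
    by case: hn; right; apply/eqP; rewrite eqEdim subvf /= hd dimm.
  have [[u1 Uu1 hu1]|hnU] := pselect (exists2 u, u \in U & A (v0 - comb s u)).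
    have /minm : P (\dim U); last by rewrite leqNgt Um.
    apply/asboolP; exists (@restr m s U), A; split=> //.
      move=> x c gx; have [p Up ->] := comb_restr s c.
      have [c' hc'] := restr_comb s (Ust x p gx Up); exists c'; rewrite -hc'.
      exact: hW'.
    by have [c' hc'] := restr_comb s Uu1; exists c'; rewrite -hc'.
  have /minm : P (\dim (U^C)%VS); last by rewrite dimv_compl dimm; lia.
  pose A' y := exists2 u, u \in U & A (y - comb s u).
  apply/asboolP; exists (@restr m s (U^C)%VS), A'.
  have AA' y : A y -> A' y by move=> Ay; exists 0; rewrite ?mem0v // comb0 subr0.
  have sA' : subspace A'.
    split; first by apply: AA'; exact: subspace_mem0.
    move=> c x y [p Up hp] [q Uq hq]; exists (c *: p + q); first by rewrite memvD ?memvZ.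
    by have := subspace_lin c sA hp hq; rewrite comb_lin scalerBr addrACA -opprD.
  have redU w : exists c, A' (comb s w - comb (@restr m s (U^C)%VS) c).
    have [k Kk [k' Kk' ew]] := dec U w.
    have [c' hc'] := restr_comb s Kk'; exists c'; rewrite -hc' ew combD addrK.
    by exists k => //; rewrite subrr; exact: subspace_mem0.
  split=> //.
  + move=> x y gx [p Up hp]; exists (actW x p); first exact: Ust.
    have := subspaceD sA (Ast x _ gx hp) (hW' x p gx).
    by rewrite (linopB _ _ (act_linop Hm x)) addrA subrK.
  + move=> x c gx; have [p Up ->] := comb_restr s c.
    have [w hw] := sst x p gx; have [c' hc'] := redU w; exists c'.
    by have := subspaceD sA' (AA' _ hw) hc'; rewrite addrA subrK.
  have [c' hc'] := redU u0; exists c'.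
  by have := subspaceD sA' (AA' _ hu0) hc'; rewrite addrA subrK.
have eqv x : gJh x -> A (act x v0 - comb s (actW x u0)).
  move=> gx; have := subspaceD sA (Ast x _ gx hu0) (hW' x u0 gx).
  by rewrite (linopB _ _ (act_linop Hm x)) addrA subrK.
exists u0; split.
- by apply/eqP => h0; apply: nAv; move: hu0; rewrite h0 comb0 subr0.
- move=> i; apply: uniq; rewrite combZ.
  have := subspaceB sA (subspaceZ (nu0 0 i) sA hu0) (eqv _ (in_gJh_hs i)).
  by rewrite hv0 scalerBr subr_subr.
move=> j Jj; apply: inj.
have := eqv _ (in_gJh_gJ (in_gJ_e Jj)); rewrite ev0 // sub0r => /(subspaceN sA).
by rewrite opprK.
Qed.

End SimpleExists.
End Levi.

(** * Reflections of weights and roots of the nilradical *)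

Section Reflections.
Variables (R : realType) (n : nat) (g : vectType (complex R)).
Local Notation C := (complex R).
Local Notation wght := 'rV[C]_n.
Variables (br : g -> g -> g) (hs e f : 'I_n -> g) (alpha : 'I_n -> wght).
Hypothesis setup : chevalley_setup br hs e f alpha.
Variables (a : 'M[int]_n) (d : 'I_n -> R).
Hypothesis cart : cartan_spec alpha a.
Hypothesis fin : finite_type a d.

Definition refl (i : 'I_n) (b : wght) : wght := b - b 0 i *: alpha i.

Lemma refl_lin i c x y : refl i (c *: x + y) = c *: refl i x + refl i y.
Proof.
by rewrite /refl !mxE scalerDl -scalerA opprD scalerBr addrACA.
Qed.

Lemma refl0 i : refl i 0 = 0.
Proof. by rewrite /refl mxE scale0r subr0. Qed.

Lemma reflN i x : refl i (- x) = - refl i x.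
Proof. by rewrite -scaleN1r -[X in refl i X]addr0 refl_lin refl0 addr0 scaleN1r. Qed.

Lemma reflB i x y : refl i (x - y) = refl i x - refl i y.
Proof. by rewrite addrC -scaleN1r refl_lin scaleN1r addrC. Qed.

Lemma refl_sum i (I : Type) (s : seq I) (c : I -> C) (G : I -> wght) :
  refl i (\sum_(p <- s) c p *: G p) = \sum_(p <- s) c p *: refl i (G p).
Proof.
elim: s => [|p s IH]; first by rewrite !big_nil refl0.
by rewrite !big_cons refl_lin IH.
Qed.

Lemma refl_wtk i k : refl i (wtk alpha k) = wtk alpha (upd k i (- \sum_j a i j * k j)).
Proof. by rewrite /refl (wtk_coord cart) wtk_upd mulrNz scaler_int. Qed.

Lemma refl_lam_wtk (J : 'I_n -> Prop) (lam : wght) (lamJ : 'I_n -> int) k i : J i ->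
  (forall i, J i -> lam 0 i = (lamJ i)%:~R) ->
  refl i (lam - wtk alpha k) = lam - wtk alpha (upd k i (hpair a lamJ k i)).
Proof.
move=> Ji hl; rewrite /refl wtk_upd opprD addrA; congr (_ - _).
by rewrite mxE hl // [X in _ + X]mxE (wtk_coord cart) -rmorphB scaler_int.
Qed.

Lemma wt_refl_adjoint i mu : wt hs br mu -> wt hs br (refl i mu).
Proof.
move=> w; have [z [hz hstr]] := wt_string setup (br_lie_module setup (fun _ => True)) (fun _ => I)
  (i := i) I I (ad_nilp_e setup i) (ad_nilp_f setup i) w.
rewrite /refl hz scaler_int; apply: hstr.
by case: (lerP 0 z); lia.
Qed.

(** Choose [i] with [k_i > 0] and [z = (a k)_i > 0], and lower [k_i] by [z]. If the result is still
    nonnegative, induction on the height applies and [s_i] leads back. Otherwise it is nonpositive,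
    so [k] is concentrated at [i] and [s_i] itself exchanges the two weights. *)
Lemma wt_adjoint_opp k : nonneg k -> wt hs br (- wtk alpha k) -> wt hs br (wtk alpha k).
Proof.
have [_ a2 _] := cart.
have [m] := ubnP `|ht k|; elim: m k => // m IH k hm k0 wk.
have [[i ki]|hn] := pselect (exists i, k i != 0); last first.
  have ek : k = fun _ => 0.
    by apply/funext => j; apply/eqP/negPn/negP => kj; apply: hn; exists j.
  by move: wk; rewrite ek wtk0 oppr0.
have {ki} [{}i [ki zi]] := finite_type_pos fin k0 (ex_intro _ i ki).
set z := \sum_j _ in zi.
have wk' := wt_refl_adjoint i wk; rewrite reflN refl_wtk -/z in wk'.
set k' := upd k i (- z) in wk'.
have h0 : 0 <= ht k by apply: sumr_ge0 => j _.
have hk' : ht k' = ht k - z by rewrite ht_upd.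
have [x [x0 hx]] := wk'.
have [c [ec sc]] := root_wtk setup x0 hx.
have {ec} ec : (fun j => - k' j) = c by apply: (wtk_inj cart fin); rewrite wtkN.
have [k0'|kn] : nonneg k' \/ nonneg (fun j => - k' j).
- by rewrite ec; case: sc => sc; [right | left=> j; have := sc j; rewrite -ec opprK].
- have h0' : 0 <= ht k' by apply: sumr_ge0 => j _.
  have := wt_refl_adjoint i (IH k' ltac:(lia) k0' wk').
  rewrite refl_wtk (_ : - _ = z) ?updK ?opprK.
    by rewrite /k' -{2}(opprK z) updK.
  by rewrite /k' upd_sum a2 -/z; lia.
have -> : wtk alpha k = refl i (- wtk alpha k).
  rewrite reflN refl_wtk -/z -wtkN; congr wtk; apply/funext => j.
  have := kn j; have := k0 j; rewrite /k' /upd; case: eqVneq => [->|_] /=; last by lia.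
  have kz j' : j' != i -> k j' = 0.
    by move=> /negPf ji; have := kn j'; have := k0 j'; rewrite /k' /upd ji; lia.
  have : z = 2 * k i; last by lia.
  rewrite /z (bigD1 i) //= a2 big1 ?addr0 // => j' ji.
  by rewrite kz // mulr0.
exact: wt_refl_adjoint.
Qed.

Section NilradicalRoots.
Variable J : 'I_n -> Prop.

Definition nil_root (b : wght) : Prop := pos_root br hs alpha b /\ ~ pos_root_J br hs alpha J b.

Lemma nil_rootP b : nil_root b <-> wt hs br b /\
  exists k, [/\ nonneg k, b = wtk alpha k & exists2 j, ~ J j & 0 < k j].
Proof.
split=> [[pr npr]|[wb [k [k0 eb [j nJ kj]]]]].
  have [[b0 [x [x0 hx]]] /natcombP[k [k0 _ ek]]] := pr.
  split; first by exists x.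
  exists k; split=> //; apply: contrapT => hn; apply: npr; split=> //.
  apply/intcombP; exists k; split=> // j nJ; apply/eqP; apply: contrapT => kj.
  by apply: hn; exists j => //; rewrite lt_def k0 andbT; apply/negP.
have pr : pos_root br hs alpha b.
  split; last by apply/natcombP; exists k; split.
  split; last by case: wb => x [x0 hx]; exists x.
  apply/eqP => b0; move: eb; rewrite b0 -(wtk0 alpha) => /(wtk_inj cart fin) ek.
  by move: kj; rewrite -ek.
split=> //; case=> _ /intcombP[k' [kJ ek]]; move: kj.
by rewrite (wtk_inj cart fin (etrans (esym eb) ek)) kJ.
Qed.

(** For [i] in [J], [s_i] changes only the coefficient of [alpha_i]; the positive coefficient off
    [J] survives and forces the reflected root to be positive. *)
Lemma nil_root_refl i b : J i -> nil_root b -> nil_root (refl i b).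
Proof.
move=> Ji /nil_rootP[wb [k [k0 eb [j nJ kj]]]]; apply/nil_rootP.
have wb' := wt_refl_adjoint i wb; split=> //.
have ji : j == i = false by apply/eqP => h; rewrite h in nJ.
move: wb'; rewrite eb refl_wtk; set k' := upd _ _ _ => -[x [x0 hx]].
have kj' : 0 < k' j by rewrite /k' /upd ji addr0.
exists k'; split=> //; last by exists j.
have [c [/(wtk_inj cart fin) <- [//|cn]]] := root_wtk setup x0 hx.
by have := cn j; move: kj'; lia.
Qed.

Lemma natcomb_refl i be : J i -> natcomb nil_root be -> natcomb nil_root (refl i be).
Proof.
move=> Ji [s [hs_ ->]]; exists [seq (p.1, refl i p.2) | p <- s]; split.
  by move=> p /mapP[q /hs_ hq ->] /=; apply: nil_root_refl.
by rewrite (refl_sum i s (fun p => p.1%:R) (fun p => p.2)) big_map.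
Qed.

Lemma natcomb_nil_root_wtk be : natcomb nil_root be -> exists k, nonneg k /\ be = wtk alpha k.
Proof.
move=> [s [hs_ ->]]; elim: s hs_ => [|p s IH] hs_.
  by exists (fun _ => 0); rewrite big_nil wtk0.
have [|k [k0 ek]] := IH; first by move=> q qs; apply: hs_; rewrite inE qs orbT.
have /nil_rootP[_ [k' [k0' ek' _]]] := hs_ p (mem_head _ _).
exists (fun j => p.1%:Z * k' j + k j); split.
  by move=> j; rewrite addr_ge0 // mulr_ge0.
by rewrite big_cons wtkD wtkZ ek ek' -pmulrn scaler_nat.
Qed.

End NilradicalRoots.
End Reflections.

(** * Comparison of the weight sets *)

Section WeightsOfQuotients.
Variables (R : realType) (n : nat) (g : vectType (complex R)).
Local Notation C := (complex R).
Local Notation wght := 'rV[C]_n.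
Variables (br : g -> g -> g) (hs e f : 'I_n -> g) (alpha : 'I_n -> wght).
Hypothesis setup : chevalley_setup br hs e f alpha.
Variables (a : 'M[int]_n) (d : 'I_n -> R).
Hypothesis cart : cartan_spec alpha a.
Hypothesis fin : finite_type a d.
Local Notation wtk := (wtk alpha).

Section SimpleLevi.
Variables (J : 'I_n -> Prop) (lam : wght) (lamJ : 'I_n -> int).
Hypothesis hlamJ : forall i, J i -> lam 0 i = (lamJ i)%:~R.
Variables (W : vectType C) (actW : g -> W -> W) (w : W) (nu : 'I_n -> int).
Local Notation gJh := (in_gJh br hs e f J).
Hypothesis HW : lie_module br actW gJh.
Hypothesis simpleW : forall U : {vspace W},
  (forall x u, gJh x -> u \in U -> actW x u \in U) -> U = 0%VS \/ U = fullv.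
Hypothesis w0 : w != 0.
Hypothesis hw : weight_vec hs actW (lam - wtk nu) w.
Hypothesis ew : forall j, J j -> actW (e j) w = 0.

Let Sh i : gJh (hs i). Proof. exact: in_gJh_hs. Qed.
Let Se i : J i -> gJh (e i). Proof. by move=> Ji; apply: in_gJh_gJ; apply: in_gJ_e. Qed.
Let Sf i : J i -> gJh (f i). Proof. by move=> Ji; apply: in_gJh_gJ; apply: in_gJ_f. Qed.

Lemma simple_fspan u : fspan f actW J w u.
Proof.
have sF := fspan_subspace f actW J w.
have [U hU] := subspace_vspace sF.
have he u' := fspan_he setup HW Sh Se Sf hw ew (u := u').
have [x u' gx Uu'|U0|Uf] := simpleW (U := U).
- apply/hU; apply: (gJh_stable HW (fun x gx => gx) sF _ _ _ gx); last exact/hU.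
  + by move=> i y /he[+ _]; apply.
  + by move=> j y Jj /he[_]; apply.
  by move=> j y Jj; apply: fspan_f.
- have /hU : fspan f actW J w w by [].
  by rewrite U0 memv0 (negPf w0).
by apply/hU; rewrite Uf memvf.
Qed.

Lemma simple_string_closed : string_closed a J lamJ (fun k => wt hs actW (lam - wtk k)).
Proof.
apply: (wt_string_closed setup cart HW Sh Se Sf hlamJ).
  exact: (e_nilp_cone setup cart fin HW Sh Se Sf hw simple_fspan).
move=> i Ji u.
apply: (weight_span_ind (Q := fun u => exists N, iter N (actW (f i)) u = 0) _ _
  (fspan_weight setup HW Sh Sf hw (simple_fspan u))).
  apply: (nilp_subspace (Q := fun u => u = 0)) (subspace0 W) (act_linop HW _) _.
  by move=> x ->; rewrite (linop0 (act_linop HW _)).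
move=> mu x _ hx; apply: (fd_weight_nilp HW Sh (Sf Ji) (root_f setup i) (i := i) _ hx).
by rewrite mxE (alpha_ii setup) oppr_eq0 pnatr_eq0.
Qed.

(** Within [L_J(lam - nu)] only coordinates in [J] move, so [nu] is recovered from a weight as its
    part off [J]; disjointness of the union rests on this. *)
Lemma simple_wt mu : (forall j, J j -> nu j = 0) -> wt hs actW mu ->
  exists k, [/\ (nonneg nu -> nonneg k), offJ J k = nu & mu = lam - wtk k].
Proof.
move=> nuJ /(wt_weight_span (fun i => act_linop HW _)
  (fun u => fspan_weight setup HW Sh Sf hw (simple_fspan u)))[k [k0 kJ ->]].
exists (fun j => nu j + k j); split.
- by move=> nu0 j; apply: addr_ge0.
- apply/funext => j; rewrite /offJ; case: (boolP (`[< J j >])) => [/asboolP Jj|/asboolPn nJ].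
    by rewrite nuJ.
  by rewrite kJ // addr0.
by rewrite wtkD opprD addrA.
Qed.

End SimpleLevi.

Section Quotient.
Variables (V : lmodType C) (act : g -> V -> V) (lam : wght) (v : V).
Hypothesis vq : verma_quotient br hs e act lam v.
Local Notation J := (J_of f act lam v).
Hypothesis offJ_wt : forall k, nonneg k -> (forall j, J j -> k j = 0) -> wt hs act (lam - wtk k).
Variable lamJ : 'I_n -> int.
Hypothesis hlamJ : forall i, J i -> lam 0 i = (lamJ i)%:~R.
Let Hm : lie_module br act (fun _ => True) := verma_module vq.

Lemma verma_string_closed : string_closed a J lamJ (fun k => wt hs act (lam - wtk k)).
Proof.
apply: (wt_string_closed setup cart Hm (fun _ => I) (fun _ _ => I) (fun _ _ => I) hlamJ).
  by move=> i _; apply: (verma_e_nilp setup cart fin vq).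
by move=> i Ji u; apply: (verma_f_nilp setup vq).
Qed.

Lemma offJ_J k j : J j -> offJ J k j = 0.
Proof. by move=> Jj; rewrite /offJ asboolT. Qed.

Lemma offJ_nonneg k : nonneg k -> nonneg (offJ J k).
Proof. by move=> k0 j; rewrite /offJ; case: asbool. Qed.

(** The starting points of the strings are weights of [V] by [offJ_wt]. Each inclusion into [wt V]
    below is an instance with its own [X]. *)
Lemma reflection_closed_wt X k : reflection_closed a J lamJ X ->
  (forall k, X k -> nonneg k) -> X k -> wt hs act (lam - wtk k).
Proof.
move=> rX X0; have [_ a2 _] := cart.
apply: (reflection_string_incl fin a2 rX verma_string_closed) => {}k Xk.
split; first exact: X0.
by apply: offJ_wt; [apply: offJ_nonneg; apply: X0 | move=> j; apply: offJ_J].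
Qed.

Lemma verma_wt_nonneg k : wt hs act (lam - wtk k) -> nonneg k.
Proof.
move=> /(verma_wt setup cart fin vq)[k' [k0 /addrI/oppr_inj/(wtk_inj cart fin) ->]].
exact: k0.
Qed.

Definition all_words (B : nat) : seq (seq 'I_n) :=
  flatten [seq [seq tval t | t <- enum {: k.-tuple 'I_n}] | k <- iota 0 B.+1].

Lemma mem_all_words B js : (size js <= B)%N -> js \in all_words B.
Proof.
move=> szB; apply/flattenP; exists [seq tval t | t <- enum {: (size js).-tuple 'I_n}].
  by apply/mapP; exists (size js) => //; rewrite mem_iota /= ltnS.
by apply/mapP; exists (in_tuple js) => //; rewrite mem_enum.
Qed.

(** A vector [v0] of weight [lam - nu] in [V] is singular for [J], since raising it would give a
    coordinate [-1]. Heights of weights with off-[J] part [nu] are bounded, so finitely many words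
    in the [f_j] applied to [v0] span a module over [g_J + h], to which [simple_exists] applies. *)
Lemma simple_levi_exists nu : nonneg nu -> (forall j, J j -> nu j = 0) ->
  exists (W : vectType C) (actW : g -> W -> W),
    [/\ lie_module br actW (in_gJh br hs e f J),
        (forall U : {vspace W},
            (forall x u, in_gJh br hs e f J x -> u \in U -> actW x u \in U) ->
            U = 0%VS \/ U = fullv) &
        (exists w, [/\ w != 0, weight_vec hs actW (lam - wtk nu) w &
                       forall j, J j -> actW (e j) w = 0])].
Proof.
move=> nu0 nuJ; have [v0 [nz hv0]] := offJ_wt nu0 nuJ.
have lh i : linop (act (hs i)) by exact: act_linop Hm _.
have ev0 j : J j -> act (e j) v0 = 0.
  move=> Jj; apply: (weight_span_notin lh (verma_weight_span setup cart fin vq _)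
    (weight_act Hm (fun _ => I) I (root_e setup j) hv0)).
  move=> [k [k0 ek]].
  have : wtk (upd nu j (-1)) = wtk k.
    by rewrite wtk_upd mulrN1z; apply: oppr_inj; rewrite opprB; apply: (addrI lam);
       rewrite -ek addrAC addrA.
  move=> /(wtk_inj cart fin)/(congr1 (fun F => F j)) /=; have := k0 j.
  by rewrite /upd eqxx nuJ //; lia.
have [_ a2 _] := cart.
have [B hB] := reflection_closed_bounded fin a2 nu
  (string_reflection_closed verma_string_closed) verma_wt_nonneg.
pose fw js := foldr (fun i => act (f i)) v0 js.
pose allJ js := all (fun j => `[< J j >]) js.
(* Each letter raises the height by one, so a nonzero word longer than [B] would give a weight
   beyond the bound. *)
have fwz js : allJ js -> (B < size js)%N -> fw js = 0.
  move=> aJ sz; apply: contrapT => nzf.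
  have [k [k0 ek hk wk]] : exists k, [/\ nonneg k, offJ J k = nu, ht k = ht nu + (size js)%:Z &
      weight_vec hs act (lam - wtk k) (fw js)].
    elim: js aJ {sz nzf} => [|j js IH] /= => [_|/andP[/asboolP Jj aJ]].
      exists nu; rewrite addr0; split=> //.
      by apply/funext => j; rewrite /offJ; case: asboolP => // /nuJ ->.
    have [k [k0 ek hk wk]] := IH aJ; exists (upd k j 1); split.
    - by move=> l; rewrite /upd addr_ge0 // mulrn_wge0.
    - by rewrite offJ_upd.
    - by rewrite ht_upd hk -addrA; congr (_ + _); lia.
    rewrite wtk_upd mulr1z opprD addrA.
    exact: (weight_act Hm (fun _ => I) I (root_f setup j) wk).
  have := hB k (ex_intro _ _ (conj (introN eqP nzf) wk)) ek.
  have : 0 <= ht nu by apply: sumr_ge0.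
  by rewrite hk; lia.
pose l := [seq fw js | js <- all_words B & allJ js].
pose s0 (i : 'I_(size l)) : V := l`_i.
have sS : subspace (fun u => exists c, u = comb s0 c).
  split; first by exists 0; rewrite comb0.
  by move=> b _ _ [x ->] [y ->]; exists (b *: x + y); rewrite comb_lin.
have fwS js : allJ js -> exists c, fw js = comb s0 c.
  move=> aJ; have [sz|sz] := leqP (size js) B; last first.
    by exists 0; rewrite comb0 fwz.
  have il : (index (fw js) l < size l)%N.
    by rewrite index_mem; apply/mapP; exists js => //; rewrite mem_filter aJ mem_all_words.
  exists (delta_mx 0 (Ordinal il)); rewrite /comb (bigD1 (Ordinal il)) //= mxE !eqxx scale1r.
  rewrite big1 ?addr0 => [|i /negPf ii]; last by rewrite mxE ii scale0r.
  by rewrite /s0 /= nth_index // -index_mem.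
pose FS := fspan f act J v0.
have sF : subspace FS := fspan_subspace f act J v0.
have he u := fspan_he (S := fun _ => True) (J := J) setup Hm (fun _ => I) (fun _ _ => I) (fun _ _ => I) hv0 ev0 (u := u).
have FS_S u : FS u -> exists c, u = comb s0 c.
  move=> Fu; pose WS u := forall Q, subspace Q -> (forall js, allJ js -> Q (fw js)) -> Q u.
  suff hW : WS u by exact: (hW _ sS fwS).
  apply: (Fu WS).
  - split=> [Q [] //|b x y hx hy Q sQ hQ].
    exact: (subspace_lin b sQ (hx Q sQ hQ) (hy Q sQ hQ)).
  - by move=> Q sQ hQ; apply: (hQ [::]).
  move=> j x Jj hx Q sQ hQ; apply: (hx (fun x => Q (act (f j) x))).
    split; first by rewrite (linop0 (act_linop Hm _)); exact: subspace_mem0.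
    by move=> b y z Qy Qz; rewrite (act_linop Hm); apply: subspace_lin.
  by move=> js aJ; apply: (hQ (j :: js)); rewrite /allJ /= asboolT.
have fw_FS js : allJ js -> FS (fw js).
  elim: js => [_|j js IH] /=; first by move=> P.
  by move=> /andP[/asboolP Jj aJ]; apply: fspan_f => //; apply: IH.
have S_FS c : FS (comb s0 c).
  apply: (subspace_sum sF) => i _; apply: (subspaceZ _ sF).
  have /mapP[js] := mem_nth 0 (ltn_ord i); rewrite mem_filter => /andP[aJ _].
  by rewrite /s0 => ->; apply: fw_FS.
apply: (simple_exists setup Hm hv0 ev0 (s0 := s0)); split.
- exact: subspace0.
- by move=> x u _ ->; rewrite (linop0 (act_linop Hm _)).
- exact/eqP.
- move=> x u gx; have [|c ->] := FS_S (act x (comb s0 u)); last by exists c; rewrite subrr.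
  apply: (gJh_stable Hm (fun _ _ => I) sF _ _ _ gx (S_FS u)).
  + by move=> i y /he[+ _]; apply.
  + by move=> j y Jj /he[_]; apply.
  by move=> j y Jj; apply: fspan_f.
by have [c ->] := FS_S v0 (fspan_v0 (v0 := v0)); exists c; rewrite subrr.
Qed.

Local Notation wtL := (wt_L br hs e f J).

Lemma wtL_wt nu mu : (forall j, J j -> nu j = 0) -> wtL (lam - wtk nu) mu ->
  exists k, [/\ (nonneg nu -> nonneg k), offJ J k = nu & mu = lam - wtk k].
Proof.
move=> nuJ [W [actW [HW sW [w [w0 hw ew]] wW]]].
exact: (simple_wt HW sW w0 hw ew nuJ wW).
Qed.

Lemma wtL_reflection_closed nu : (forall j, J j -> nu j = 0) ->
  reflection_closed a J lamJ (fun k => wtL (lam - wtk nu) (lam - wtk k)).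
Proof.
move=> nuJ k i [W [actW [HW sW [w [w0 hw ew]] wW]]] Ji.
exists W, actW; split=> //; first by exists w.
exact: (string_reflection_closed (simple_string_closed hlamJ HW sW w0 hw ew) wW Ji).
Qed.

Lemma wtL_sub_wt nu k : nonneg nu -> (forall j, J j -> nu j = 0) ->
  wtL (lam - wtk nu) (lam - wtk k) -> wt hs act (lam - wtk k).
Proof.
move=> nu0 nuJ; apply: (reflection_closed_wt (X := fun k => wtL (lam - wtk nu) (lam - wtk k))).
  exact: wtL_reflection_closed.
move=> k' /(wtL_wt nuJ)[k'' [k0 _ /addrI/oppr_inj/(wtk_inj cart fin) ->]].
exact: k0.
Qed.

(** The same comparison with roles exchanged: [X] consists of the weights of [V] with off-[J] part
    [nu], and strings are taken in the simple module. *)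
Lemma wt_sub_wtL k : wt hs act (lam - wtk k) -> wtL (lam - wtk (offJ J k)) (lam - wtk k).
Proof.
move=> wk; have k0 := verma_wt_nonneg wk; set nu := offJ J k.
have nuJ j : J j -> nu j = 0 by apply: offJ_J.
have [W [actW [HW sW [w [w0 hw ew]]]]] := simple_levi_exists (offJ_nonneg k0) nuJ.
suff wW : wt hs actW (lam - wtk k).
  by exists W, actW; split=> //; exists w.
have [_ a2 _] := cart.
pose X k := wt hs act (lam - wtk k) /\ offJ J k = nu.
apply: (reflection_string_incl fin a2 (X := X) _ (simple_string_closed hlamJ HW sW w0 hw ew)).
- move=> k' i [wk' ok'] Ji; split; last by rewrite offJ_upd.
  exact: (string_reflection_closed verma_string_closed wk' Ji).
- move=> k' [wk' ->]; split; first exact: verma_wt_nonneg.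
  by exists w.
by [].
Qed.

(** Reflections [s_i] with [i] in [J] are linear and preserve [wt V], hence its hull; lattice points
    of the hull have nonnegative coordinates as averages of nonnegative ones. *)
Lemma wt_conv mu : wt hs act mu <->
  (intcomb (simple_root_in alpha (fun _ => True)) (lam - mu) /\ conv_hull (wt hs act) mu).
Proof.
split=> [wmu|[/intcombP[k [_ ek]]]].
  have [k [k0 ek]] := verma_wt setup cart fin vq wmu.
  split; first by apply/intcombP; exists k; rewrite ek opprB addrC subrK.
  exists [:: (1, mu)]; rewrite !big_seq1 scale1r; split=> // p.
  by rewrite inE => /eqP ->; rewrite ler01.
have -> : mu = lam - wtk k by rewrite -ek opprB addrC subrK.
apply: (reflection_closed_wt (X := fun k => conv_hull (wt hs act) (lam - wtk k))).
  move=> k' i [s [hs_ [s1 es]]] Ji.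
  exists [seq (p.1, refl alpha i p.2) | p <- s]; split.
    move=> p /mapP[q /hs_[q0 wq] ->]; split=> //=.
    have [kq [kq0 eq]] := verma_wt setup cart fin vq wq.
    rewrite eq (refl_lam_wtk cart _ Ji hlamJ) in wq *.
    exact: (string_reflection_closed verma_string_closed wq Ji).
  split; first by rewrite big_map.
  rewrite -(refl_lam_wtk cart _ Ji hlamJ) es big_map /=.
  exact: (refl_sum alpha i s (fun p => (p.1)%:C%C) (fun p => p.2)).
move=> {ek mu}k [s [hs_ [s1 es]]].
have /choice[K hK] : forall p : wght, exists k, wt hs act p -> nonneg k /\ p = lam - wtk k.
  move=> p; have [wp|nw] := pselect (wt hs act p); last by exists (fun _ => 0).
  by have [kp ?] := verma_wt setup cart fin vq wp; exists kp.
(* The [j]-th coordinate of the convex combination, compared with [k j] over [R], where finite type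
   gives independence. *)
pose T j : R := \sum_(p <- s) p.1 * (K p.2 j)%:~R.
have TE j : (T j)%:C%C = \sum_(p <- s) (p.1)%:C%C * (K p.2 j)%:~R.
  by rewrite rmorph_sum; apply: eq_bigr => p _; rewrite rmorphM /= rmorph_int.
have kT : forall j, (k j)%:~R - T j = 0.
  apply: (finite_type_indep fin) => i; apply: (@complexI R).
  transitivity ((wtk k - (\sum_(p <- s) (p.1)%:C%C *: wtk (K p.2))) 0 i); last first.
    have -> : wtk k = lam - (lam - wtk k) by rewrite opprB addrC subrK.
    rewrite es.
    have -> : lam = \sum_(p <- s) (p.1)%:C%C *: lam.
      by rewrite -scaler_suml -rmorph_sum s1 scale1r.
    rewrite -sumrB -sumrB big1_seq ?mxE // => p /andP[_ ps].
    have [_ wp] := hs_ _ ps; have [_ ep] := hK _ wp.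
    have -> : wtk (K p.2) = lam - p.2 by rewrite [X in _ - X]ep opprB addrC subrK.
    by rewrite scalerBr subrr.
  rewrite mxE (wtk_coord cart) [X in _ + X]mxE summxE rmorph_sum /=.
  under eq_bigr do rewrite rmorphM /= rmorphB /= mulrBr !rmorph_int.
  rewrite sumrB; congr (_ - _).
    by rewrite rmorph_sum; apply: eq_bigr => j _; rewrite rmorphM.
  transitivity (\sum_j \sum_(p <- s) (a i j)%:~R * ((p.1)%:C%C * (K p.2 j)%:~R) : C).
    by apply: eq_bigr => j _; rewrite TE mulr_sumr.
  rewrite exchange_big; apply: eq_bigr => p _ /=.
  rewrite mxE (wtk_coord cart) rmorph_sum mulr_sumr; apply: eq_bigr => j _.
  by rewrite rmorphM /=; ring.
move=> j; rewrite -(ler0z R) (_ : (k j)%:~R = T j); last first.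
  by apply/eqP; rewrite -subr_eq0 kT.
rewrite /T big_seq; apply: sumr_ge0 => p ps; have [p0 wp] := hs_ _ ps.
by have [k0 _] := hK _ wp; rewrite mulr_ge0 // ler0z.
Qed.

Lemma wt_union mu : wt hs act mu <->
  exists2 nu, natcomb (simple_root_in alpha (fun i => ~ J i)) nu & wtL (lam - nu) mu.
Proof.
split=> [wmu|[_ /natcombP[nu [nu0 nuJ ->]] wL]].
  have [k [k0 ek]] := verma_wt setup cart fin vq wmu.
  exists (wtk (offJ J k)); last by rewrite ek; apply: wt_sub_wtL; rewrite -ek.
  apply/natcombP; exists (offJ J k); split=> //; first exact: offJ_nonneg.
  by move=> j /contrapT; apply: offJ_J.
have nuJ' j : J j -> nu j = 0 by move=> Jj; apply: nuJ; apply.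
have [k [_ _ ek]] := wtL_wt nuJ' wL; rewrite ek in wL *.
exact: wtL_sub_wt wL.
Qed.

Lemma wtL_disjoint nu nu' mu :
  natcomb (simple_root_in alpha (fun i => ~ J i)) nu ->
  natcomb (simple_root_in alpha (fun i => ~ J i)) nu' ->
  wtL (lam - nu) mu -> wtL (lam - nu') mu -> nu = nu'.
Proof.
move=> /natcombP[k [k0 kJ ->]] /natcombP[k' [k0' kJ' ->]] wL wL'.
have [l [_ <- el]] := wtL_wt (fun j Jj => kJ j (fun nJ => nJ Jj)) wL.
have [l' [_ <- el']] := wtL_wt (fun j Jj => kJ' j (fun nJ => nJ Jj)) wL'.
by move: el; rewrite el' => /addrI/oppr_inj/(wtk_inj cart fin) ->.
Qed.

Definition levi_minus_nil (mu : wght) : Prop := exists nu beta,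
  [/\ wtL lam nu, natcomb (nil_root br hs alpha J) beta & mu = nu - beta].

(* [V] is spanned by vectors [y1 ... yr u] with [u] of weight in [lam - Z Delta_J] and
   [y1, ..., yr] root vectors of the opposite nilradical. *)
Lemma verma_levi_span u : weight_span hs act levi_minus_nil u.
Proof.
have lh i : linop (act (hs i)) by exact: act_linop Hm _.
pose base w := exists k, (forall j, ~ J j -> k j = 0) /\ weight_vec hs act (lam - wtk k) w.
pose nilv y := exists be, nil_root br hs alpha J be /\ weight_vec hs br (- be) y.
pose Sg u := forall P, subspace P -> (forall w, base w -> P w) ->
  (forall y w, nilv y -> P w -> P (act y w)) -> P u.
have sS : subspace Sg.
  split=> [P [] //|b x y hx hy P sP h1 h2].
  exact: (subspace_lin b sP (hx P sP h1 h2) (hy P sP h1 h2)).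
have S_base w : base w -> Sg w by move=> bw P sP h1 h2; apply: h1.
have S_nil y w : nilv y -> Sg w -> Sg (act y w).
  by move=> ny hw P sP h1 h2; exact: (h2 _ _ ny (hw P sP h1 h2)).
have S_root w : Sg w -> forall ga x, weight_vec hs br ga x -> Sg (act x w).
  move=> Sw; suff [] : Sg w /\ forall ga x, weight_vec hs br ga x -> Sg (act x w) by [].
  apply: (Sw (fun w => Sg w /\ forall ga x, weight_vec hs br ga x -> Sg (act x w))) => {w Sw}.
  - split; first split; first exact: (subspace_mem0 sS).
      by move=> ga x _; rewrite (linop0 (act_linop Hm _)); exact: (subspace_mem0 sS).
    move=> b x y [x1 x2] [y1 y2]; split; first exact: (subspace_lin b sS).
    by move=> ga z hz; rewrite (act_linop Hm); apply: (subspace_lin b sS);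
       [exact: (x2 ga) | exact: (y2 ga)].
  - move=> w bw; split; first exact: S_base.
    move=> ga x hx; have [->|x0] := eqVneq x 0.
      by rewrite (act0l Hm); exact: (subspace_mem0 sS).
    have [k [kJ hw]] := bw.
    have [c [ec sc]] := root_wtk setup x0 hx.
    have hxw := weight_act Hm (fun _ => I) I hx hw.
    have ewt : lam - wtk k + ga = lam - wtk (fun j => k j - c j).
      by rewrite wtkD wtkN -ec opprB addrA addrAC.
    rewrite ewt in hxw.
    (* A root supported on [J] keeps [w] in [base]. Otherwise a positive root leaves the cone of
       weights, because [w] has coordinates 0 off [J], and a negative one belongs to the opposite
       nilradical. *)
    have [[j [nJ cj]]|hn] := pselect (exists j, ~ J j /\ c j != 0); last first.
      apply: S_base; exists (fun j => k j - c j); split=> // j nJ.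
      rewrite kJ // sub0r; apply/eqP; rewrite oppr_eq0; apply/negPn/negP => cj.
      by apply: hn; exists j.
    case: sc => c0.
      have -> : act x w = 0; last exact: (subspace_mem0 sS).
      apply/eqP/negPn/negP => nz.
      have := verma_wt_nonneg (ex_intro _ _ (conj nz hxw)) j.
      by have := c0 j; rewrite kJ //; lia.
    apply: S_nil; last exact: S_base.
    exists (- ga); rewrite opprK; split=> //; apply/(nil_rootP br hs cart fin).
    have ega : - ga = wtk (fun j => - c j) by rewrite wtkN ec.
    split.
      rewrite ega; apply: (wt_adjoint_opp setup cart fin c0).
      by rewrite wtkN opprK -ec; exists x.
    by exists (fun j => - c j); split=> //; exists j => //; have := c0 j; lia.
  move=> y w ny [w1 w2]; split; first exact: S_nil.
  (* [x y w = [x, y] w + y x w], and [[x, y]] is again a weight vector, which the claim for all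
     weight vectors covers. *)
  move=> ga x hx; rewrite (act_br Hm _ I I); apply: (subspaceD sS); last first.
    by apply: S_nil => //; apply: (w2 ga).
  have [be [_ hy]] := ny.
  exact: (w2 _ _ (weight_act (br_lie_module setup (fun _ => True)) (fun _ => I) I hx hy)).
have Sall : Sg u.
  have [_ v0 [hv _] gen] := vq; apply: (gen Sg).
    split; [exact: (subspace_mem0 sS) | by move=> b x y; apply: subspace_lin |].
    move=> x w Sw.
    apply: (weight_span_ind (Q := fun x => Sg (act x w)) _ _ (root_decomposition setup x)).
      split; first by rewrite (act0l Hm); exact: (subspace_mem0 sS).
      by move=> b y z hy hz; rewrite (act_linl Hm); apply: (subspace_lin b sS).
    by move=> ga y _; apply: S_root.
  by apply: S_base; exists (fun _ => 0); rewrite wtk0 subr0.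
apply: Sall; first exact: weight_span_subspace.
  move=> w [k [kJ hw]]; have [->|w0] := eqVneq w 0.
    exact: (subspace_mem0 (weight_span_subspace _ lh)).
  apply: (weight_span1 hw); exists (lam - wtk k), 0; split; last by rewrite subr0.
    have ok : offJ J k = fun _ => 0.
      by apply/funext => j; rewrite /offJ; case: asboolP => // /kJ.
    have : wt hs act (lam - wtk k) by exists w.
    by move=> /wt_sub_wtL; rewrite ok wtk0 subr0.
  by exists [::]; rewrite big_nil.
move=> y w [be [hbe hy]] [s [hs_ ->]].
rewrite (linop_sum _ _ (act_linop Hm _)); apply: subspace_sum.
  exact: weight_span_subspace.
move=> p /hs_[hp [nu [beta [wL [t [ht et]] ep]]]].
apply: (weight_span1 (weight_act Hm (fun _ => I) I hy hp)).
exists nu, (beta + be); split=> //; last by rewrite ep opprD addrA.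
exists ((1%N, be) :: t); split; last by rewrite big_cons scale1r -et addrC.
by move=> q; rewrite inE => /predU1P[-> //|/ht].
Qed.

(** Both [wt L_J(lam)] and the set of roots of the nilradical are stable under [s_i] for [i] in [J],
    so the right-hand side is reflection closed. *)
Lemma wt_levi_minus_nil mu : wt hs act mu <-> levi_minus_nil mu.
Proof.
have lh i : linop (act (hs i)) by exact: act_linop Hm _.
split; first exact: (wt_weight_span lh verma_levi_span).
move=> lmu.
have wtL0 nu : wtL lam nu -> exists k, nonneg k /\ nu = lam - wtk k.
  move=> wL; have [||k [k0 _ ek]] := @wtL_wt (fun _ => 0) nu; rewrite ?wtk0 ?subr0 //.
  by exists k; split=> //; apply: k0.
have emu : exists k, mu = lam - wtk k.
  case: lmu => nu [beta [/wtL0[k [_ ->]] /(natcomb_nil_root_wtk cart fin)[k' [_ ->]] ->]].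
  by exists (fun j => k j + k' j); rewrite wtkD opprD addrA.
case: emu lmu => k -> lmu.
apply: (reflection_closed_wt (X := fun k => levi_minus_nil (lam - wtk k))) => //.
  move=> k' i [nu [beta [wL nb ek]]] Ji.
  exists (refl alpha i nu), (refl alpha i beta); split.
  - have [l [_ el]] := wtL0 _ wL.
    rewrite el (refl_lam_wtk cart _ Ji hlamJ).
    have := @wtL_reflection_closed (fun _ => 0) (fun _ _ => erefl) l i.
    by rewrite wtk0 subr0 -el; apply.
  - exact: (natcomb_refl setup cart fin Ji nb).
  by rewrite -(refl_lam_wtk cart _ Ji hlamJ) ek reflB.
move=> k' [nu [beta [/wtL0[l [l0 ->]] /(natcomb_nil_root_wtk cart fin)[l' [l0' ->]]]]].
rewrite -addrA -opprD -wtkD => /addrI/oppr_inj/(wtk_inj cart fin) -> j.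
exact: addr_ge0.
Qed.

End Quotient.
End WeightsOfQuotients.

Theorem theorem1 (R : realType) (n : nat) (g : vectType (complex R))
    (br : g -> g -> g) (hs e f : 'I_n -> g) (alpha : 'I_n -> 'rV[complex R]_n)
    (V : lmodType (complex R)) (act : g -> V -> V)
    (lam : 'rV[complex R]_n) (v : V) :
  chevalley_setup br hs e f alpha ->
  verma_quotient br hs e act lam v ->
  ((forall i j, J_lambda lam i -> ~ J_of f act lam v i ->
                J_lambda lam j -> ~ J_of f act lam v j -> i = j) \/
   (exists J' : 'I_n -> Prop, (forall i, J' i -> J_lambda lam i) /\
                is_parabolic_verma br hs e f act J' lam v)) ->
  let J := J_of f act lam v in
  [/\ (forall mu, wt hs act mu <->
         (intcomb (simple_root_in alpha (fun _ => True)) (lam - mu) /\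
          conv_hull (wt hs act) mu)),
      (forall mu, wt hs act mu <->
         exists nu beta, [/\ wt_L br hs e f J lam nu,
            natcomb (fun b => pos_root br hs alpha b /\ ~ pos_root_J br hs alpha J b) beta
            & mu = nu - beta]),
      (forall mu, wt hs act mu <->
         exists2 nu, natcomb (simple_root_in alpha (fun i => ~ J i)) nu
                   & wt_L br hs e f J (lam - nu) mu) &
      (forall nu nu' mu,
         natcomb (simple_root_in alpha (fun i => ~ J i)) nu ->
         natcomb (simple_root_in alpha (fun i => ~ J i)) nu' ->
         wt_L br hs e f J (lam - nu) mu -> wt_L br hs e f J (lam - nu') mu ->
         nu = nu')].
Proof.
move=> setup vq hyp J.
have [a cart] := cartan_exists setup.
have [d fin] := finite_type_cartan setup cart.
have offJ_wt k : nonneg k -> (forall j, J j -> k j = 0) -> wt hs act (lam - wtk alpha k).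
  case: hyp => [le1|[J' [J'l par]]]; first exact: (wt_off_J_le1 setup vq).
  exact: (wt_off_J_parabolic setup cart fin vq J'l par).
have [lamJ hlamJ] : exists lamJ : 'I_n -> int, forall i, J i -> lam 0 i = (lamJ i)%:~R.
  have /choice[z hz] : forall i, exists z : int, J i -> lam 0 i = z%:~R.
    move=> i; have [[k [hk _]]|nJ] := pselect (J i); last by exists 0.
    by exists k%:Z; rewrite hk -pmulrn.
  by exists z.
split.
- exact: (wt_conv setup cart fin vq offJ_wt hlamJ).
- exact: (wt_levi_minus_nil setup cart fin vq offJ_wt hlamJ).
- exact: (wt_union setup cart fin vq offJ_wt hlamJ).
exact: (wtL_disjoint setup cart fin).
Qed.
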